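(* Let $H$ be a real Hilbert space, $A:\mathcal D(A)\to H$ a positive self-adjoint operator with compact inverse, $V=\mathcal D(A^{1/2})$, $\tau>0$, $\mu$ an admissible memory kernel, and $b\in L^\infty_{loc}(0,+\infty)$ an on--off coefficient with switching times $(t_n)_{n\in\mathbb N}$, interval lengths $T_n=t_{n+1}-t_n$ and bounds $b_{2n+1}$. Consider $$u_{tt}(t)+Au(t)-\int_0^\infty\mu(s)Au(t-s)\,ds+b(t)u_t(t-\tau)=0,\quad t>0,\qquad u(t)=u_0(t),\quad t\le 0.\qquad (P)$$ Assume that $T_{2n+1}\le\tau$ and $T_{2n}\ge\tau$ for all $n\in\mathbb N$, and put $c_n=Ce^{-\alpha T_{2n}}$, where $C,\alpha$ are the decay constants of the problem without delay feedback. If $$\sum_{n=0}^\infty\ln\left[e^{b_{2n+1}T_{2n+1}}\left(c_n+1-e^{-b_{2n+1}T_{2n+1}}\right)\right]=-\infty,$$ then (P) is asymptotically stable, i.e. every solution $u$ of (P) satisfies $E_S(t)\to0$ as $t\to+\infty$.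
   Context: Admissible memory kernel: $\mu:[0,+\infty)\to[0,+\infty)$ with i) $\mu\in C^1(\mathbb R^+)\cap L^1(\mathbb R^+)$; ii) $\mu(0)=\mu_0>0$; iii) $\int_0^{+\infty}\mu(t)\,dt=\tilde\mu<1$; iv) $\mu'(t)\le-\delta\mu(t)$ for all $t$, for some $\delta>0$. On--off coefficient: there are times $0=t_0<t_1<t_2<\dots$ and numbers $b_{2n+1}>0$ such that, for all $n\in\mathbb N=\{0,1,2,\dots\}$, $b(t)=0$ for $t\in I_{2n}=[t_{2n},t_{2n+1})$ and $|b(t)|<b_{2n+1}$ for $t\in I_{2n+1}=[t_{2n+1},t_{2n+2})$. Write $T_n=t_{n+1}-t_n$. Phase space and solutions: with $\eta^t(s):=u(t)-u(t-s)$, $s>0$, let $\mathcal H=V\times H\times L^2_\mu((0,\infty);V)$, where $L^2_\mu((0,\infty);V)$ has squared norm $\int_0^\infty\mu(s)\|A^{1/2}w(s)\|_H^2ds$, and the squared norm of $\mathcal H$ is $(1-\tilde\mu)\|A^{1/2}u\|_H^2+\|v\|_H^2+\int_0^\infty\mu(s)\|A^{1/2}w(s)\|_H^2ds$. A solution of (P) with initial datum $U_0\in\mathcal H$ is $U=(u,u_t,\eta)\in C([0,\infty);\mathcal H)$ with $U(0)=U_0=(u_0(0),\partial_tu_0(0),\eta_0)$, $\eta_0(s)=u_0(0)-u_0(-s)$, such that for a.e. $t>0$, with $f(t)=-b(t)u_t(t-\tau)$ (which vanishes for $t<\tau$ because $b=0$ on $[0,t_1)$ and $t_1=T_0\ge\tau$),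 $$\langle u_{tt},\tilde v\rangle=-(1-\tilde\mu)\langle A^{1/2}u,A^{1/2}\tilde v\rangle_H-\int_0^\infty\mu(s)\langle A^{1/2}\eta(s),A^{1/2}\tilde v\rangle_Hds+\langle f,\tilde v\rangle_H,$$ $$\int_0^\infty\mu(s)\langle\eta_t(s)+\eta_s(s),A\tilde\eta(s)\rangle_Hds=\int_0^\infty\mu(s)\langle u_t,A\tilde\eta(s)\rangle_Hds$$ for all $\tilde v\in V$ and $\tilde\eta\in L^2_\mu(\mathbb R^+;\mathcal D(A))$. Standard energy: $E_S(t)=\frac12\|u_t(t)\|_H^2+\frac{1-\tilde\mu}2\|A^{1/2}u(t)\|_H^2+\frac12\int_0^\infty\mu(s)\|A^{1/2}\eta^t(s)\|_H^2ds$. Decay constants: it is a known result that for $b\equiv0$ the energy $E_S$ of every solution is non-increasing and there are constants $C>1$, $\alpha>0$, independent of the solution, with $E_S(t)\le Ce^{-\alpha t}E_S(0)$ for all $t\ge0$ and every solution. $C,\alpha$ denote such fixed constants. *)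

(* Defs.v *)
From HB Require Import structures.
From mathcomp Require Import all_boot all_order all_algebra.
From mathcomp Require Import sesquilinear.
From mathcomp Require Import all_classical all_reals all_analysis.

Set Implicit Arguments.
Unset Strict Implicit.
Unset Printing Implicit Defensive.

Import Order.TTheory GRing.Theory Num.Theory.
Import numFieldNormedType.Exports.

Local Open Scope classical_set_scope.
Local Open Scope ring_scope.

(* A real Hilbert space is a complete normed module with a dot product
   inducing its norm. *)
Definition dot_induces_norm (R : realType) (H : completeNormedModType R)
    (ip : {dot H for @idfun R}) : Prop :=
  forall x : H, ip x x = `|x| ^+ 2.

(* A possibly unbounded operator; the values of [opfun] outside [opdom] are
   meaningless. *)
Record operator (R : realType) (H : completeNormedModType R) := Operator {
  opdom : set H;
  opfun :> H -> H
}.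

Section operators.
Context (R : realType) (H : completeNormedModType R).
Context (ip : {dot H for @idfun R}).
Implicit Types B S : operator H.

Definition linear_operator B : Prop :=
  opdom B 0 /\
  forall (a : R) (x y : H), opdom B x -> opdom B y ->
    opdom B (a *: x + y) /\ B (a *: x + y) = a *: B x + B y.

(* B = B^*: the right-hand side of the equivalence says that y is in the domain
   of B with B y = z, the left-hand side says the same for the adjoint. *)
Definition self_adjoint B : Prop :=
  [/\ linear_operator B,
      dense (opdom B) &
      forall y z : H,
        (forall x, opdom B x -> ip (B x) y = ip x z) <->
        (opdom B y /\ B y = z)].

Definition positive_operator B : Prop :=
  forall x, opdom B x -> x != 0 -> 0 < ip (B x) x.

Definition compact_map (K : H -> H) : Prop :=
  forall X : set H, bounded_set X -> precompact (K @` X).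

Definition has_compact_inverse B : Prop :=
  exists K : H -> H,
    [/\ forall x, opdom B (K x) /\ B (K x) = x,
        forall x, opdom B x -> K (B x) = x &
        compact_map K].

(* S = B^{1/2}: the (unique) nonnegative self-adjoint S with S o S = B,
   including equality of the domains. *)
Definition is_sqrt_operator S B : Prop :=
  [/\ self_adjoint S,
      forall x, opdom S x -> 0 <= ip (S x) x,
      forall x, opdom B x <-> (opdom S x /\ opdom S (S x)) &
      forall x, opdom B x -> B x = S (S x)].

End operators.

Section kernel.
Context (R : realType).

Definition kernel_mass (mu : R -> R) : R :=
  \int[lebesgue_measure]_(s in `[0, +oo[) mu s.

(* Only the values of mu on [0, +oo) matter.  C^1 is required on the open
   half-line, with continuity up to 0. *)
Record admissible_kernel (mu : R -> R) : Prop := AdmissibleKernel {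
  kernel_ge0 : forall s : R, 0 <= s -> 0 <= mu s;
  kernel_continuous : {within `[0, +oo[, continuous mu};
  kernel_C1 : forall s : R, 0 < s ->
    derivable mu s 1 /\ {for s, continuous (derive1 mu)};
  kernel_integrable :
    lebesgue_measure.-integrable `[0, +oo[ (EFin \o mu);
  kernel_at0 : 0 < mu 0;
  kernel_mass_lt1 : kernel_mass mu < 1;
  kernel_decay : exists2 delta : R, 0 < delta &
    forall s, 0 < s -> derive1 mu s <= - delta * mu s
}.

End kernel.

Section weighted_space.
Context (R : realType) (H : completeNormedModType R).

(* Bochner measurability on D: a.e. pointwise limit of simple functions. *)
Definition strongly_measurable (D : set R) (f : R -> H) : Prop :=
  exists phi : nat -> R -> H,
    (forall n, finite_set (range (phi n)) /\
       forall x, measurable (phi n @^-1` [set x])) /\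
    {ae lebesgue_measure, forall s, D s -> phi n s @[n --> \oo] --> f s}.

Definition sqnorm_mu (mu : R -> R) (B : operator H) (w : R -> H) : \bar R :=
  (\int[lebesgue_measure]_(s in `]0%R, +oo[) (mu s * `|B (w s)| ^+ 2)%:E)%E.

(* w is in L^2_mu((0, oo); D(B)), where D(B) has the norm |B x|.  The space
   is relative to the measure mu(s) ds, so w is unconstrained where mu
   vanishes. *)
Definition L2mu (mu : R -> R) (B : operator H) (w : R -> H) : Prop :=
  let D := [set s : R | 0 < s /\ 0 < mu s] in
  [/\ {ae lebesgue_measure, forall s, D s -> opdom B (w s)},
      strongly_measurable D (fun s => B (w s)) &
      (sqnorm_mu mu B w < +oo)%E].

End weighted_space.

Section problem.
Context (R : realType) (H : completeNormedModType R).
Context (ip : {dot H for @idfun R}).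
Context (A S : operator H) (mu : R -> R) (tau : R).

Definition eta (u : R -> H) (t s : R) : H := u t - u (t - s).

(* g is the weak derivative of f on (0, +oo). *)
Definition weak_derivative (f g : R -> R) : Prop :=
  locally_integrable `]0, +oo[ g /\
  forall a c : R, 0 < a -> a <= c ->
    f c - f a = \int[lebesgue_measure]_(r in `[a, c]) g r.

(* [S] stands for A^{1/2}, so V = opdom S, with norm |S x|.  [v] is u_t on
   [0, +oo), and [v0] is the component of the initial datum written
   \partial_t u_0(0), an arbitrary element of H.  The values of u and eta
   determine the membership of (u_0(0), v0, eta_0) in the phase space (take
   t = 0).  The values of [v] at negative times are irrelevant as soon as b
   vanishes on [0, tau). *)
Record is_solution (b : R -> R) (u0 : R -> H) (v0 : H) (u v : R -> H) : Prop :=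
  IsSolution {
  sol_history : forall t : R, t <= 0 -> u t = u0 t;
  sol_velocity0 : v 0 = v0;
  sol_velocity : forall t : R, 0 < t -> is_derive t 1 u (v t);
  sol_u_dom : forall t : R, 0 <= t -> opdom S (u t);
  sol_u_continuous : {within `[0, +oo[, continuous (fun t => S (u t))};
  sol_v_continuous : {within `[0, +oo[, continuous v};
  sol_eta_L2mu : forall t : R, 0 <= t -> L2mu mu S (eta u t);
  sol_eta_continuous : forall t : R, 0 <= t ->
    sqnorm_mu mu S (fun s => eta u r s - eta u t s)
      @[r --> within `[0, +oo[ (nbhs t)] --> 0%E;
  (* [utt t w] is the duality pairing <u_tt(t), w> between V' and V: u_tt is
     the weak derivative of u_t as a V'-valued function *)
  sol_wave : exists utt : R -> H -> R,
    (forall w, opdom S w ->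
       weak_derivative (fun t => ip (v t) w) (fun t => utt t w)) /\
    {ae lebesgue_measure, forall t, 0 < t ->
       forall w, opdom S w ->
         utt t w =
           - (1 - kernel_mass mu) * ip (S (u t)) (S w)
           - \int[lebesgue_measure]_(s in `]0, +oo[)
               (mu s * ip (S (eta u t s)) (S w))
           + ip (- (b t *: v (t - tau))) w};
  (* eta_t + eta_s is the derivative of (t, s) |-> eta^t(s) along (1, 1); for
     histories of finite energy only this combination exists in general *)
  sol_transport : {ae lebesgue_measure, forall t, 0 < t ->
    let deta s :=
      'D_((1, 1) : R * R) (fun p : R * R => eta u p.1 p.2) (t, s) in
    (forall s, 0 < s ->
       derivable (fun p : R * R => eta u p.1 p.2) (t, s) ((1, 1) : R * R)) /\
    forall w, L2mu mu A w ->
      \int[lebesgue_measure]_(s in `]0, +oo[) (mu s * ip (deta s) (A (w s))) =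
      \int[lebesgue_measure]_(s in `]0, +oo[) (mu s * ip (v t) (A (w s)))}
}.

Definition energy (u v : R -> H) (t : R) : R :=
  2^-1 * `|v t| ^+ 2
  + (1 - kernel_mass mu) / 2 * `|S (u t)| ^+ 2
  + 2^-1 * fine (sqnorm_mu mu S (eta u t)).

(* Constants of exponential decay for the problem with b = 0. *)
Definition decay_constants (C alpha : R) : Prop :=
  [/\ 1 < C, 0 < alpha &
      forall u0 v0 u v, is_solution (fun=> 0) u0 v0 u v ->
        forall t, 0 <= t ->
          energy u v t <= C * expR (- (alpha * t)) * energy u v 0].

Definition asymptotically_stable (b : R -> R) : Prop :=
  forall u0 v0 u v, is_solution b u0 v0 u v ->
    energy u v t @[t --> +oo] --> 0.

End problem.

Section on_off.
Context (R : realType).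

Definition Linfty_loc (b : R -> R) : Prop :=
  measurable_fun (`]0, +oo[ : set R) b /\
  forall K : set R, compact K -> K `<=` `]0, +oo[ ->
    exists M : R, {ae lebesgue_measure, forall t, K t -> `|b t| <= M}.

(* Only the entries of odd index of beta are used. *)
Definition on_off (b : R -> R) (tm beta : nat -> R) : Prop :=
  [/\ tm 0%N = 0,
      forall n, tm n < tm n.+1,
      forall n, 0 < beta n.*2.+1,
      forall n t, tm n.*2 <= t < tm n.*2.+1 -> b t = 0 &
      forall n t, tm n.*2.+1 <= t < tm n.*2.+2 -> `|b t| < beta n.*2.+1].

Definition step (tm : nat -> R) (n : nat) : R := tm n.+1 - tm n.

End on_off.

(* Main.v *)
(* The operator A diagonalizes in an orthonormal basis (e_k), and testing the
   equation against e_k decouples it into scalar equations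
     V' = - ((1 - m) lam U + lam int mu(s) (U(t) - U(t - s)) ds) - b(t) V(t - tau)
   for U = <u, e_k>, V = <u_t, e_k>, m = int mu.  The energy is the sum of the
   energies E_k of the modes, so it suffices to bound each E_k by the same
   multiple of its initial value.
   Since mu is nonincreasing, transporting the history does not increase its
   weighted norm; hence E_k has upper right Dini derivative at most
   |V| |b(t) V(t - tau)|.  So E_k is nonincreasing where b = 0, and on an interval
   where |b| < beta, where t - tau lies in the preceding off interval, Gronwall
   applied to E_k + E_k(t_2n) gives
     E_k(t) + E_k(t_2n) <= e^(beta T) (E_k(t_2n+1) + E_k(t_2n)).
   On an off interval, E_k(t_2n+1) <= c_n E_k(t_2n): the constants C, alpha only
   concern global solutions without feedback, so the mode is continued beyond
   t_2n+1 by solving a scalar Volterra equation, and multiplied by e_k to give such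
   a solution.  Together E_k(t_2n+2) <= e^x (c_n + 1 - e^(-x)) E_k(t_2n) with
   x = beta T, and the product of these factors tends to 0. *)

Require Import Defs.
From HB Require Import structures.
From mathcomp Require Import all_boot all_order all_algebra.
From mathcomp Require Import sesquilinear.
From mathcomp Require Import all_classical all_reals all_analysis.
From mathcomp Require Import measurable_realfun.
From mathcomp Require Import ring lra.

Set Implicit Arguments.
Unset Strict Implicit.
Unset Printing Implicit Defensive.

Import Order.TTheory GRing.Theory Num.Theory.
Import numFieldNormedType.Exports.

Local Open Scope classical_set_scope.
Local Open Scope ring_scope.

(** * Spectral theorem for operators with compact inverse *)

Section hilbert.
Context (R : realType) (H : completeNormedModType R) (ip : {dot H for @idfun R}).

(** Passing to modes is what makes the energy argument rigorous. For a weak solution, [u_tt] lives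
    only in the dual of [V] and the history is merely square-integrable, so the total energy cannot
    be differentiated directly; paired with an eigenvector, the velocity and the undelayed force
    become continuous scalar functions. Even so, [b] has no regularity in time, hence on the on
    intervals a velocity need not be differentiable: only one-sided increments are estimated. Adding
    [E_k(t_2n)] before Gronwall comes from [|V(t)| |V(t - tau)| <= (V(t)^2 + V(t - tau)^2) / 2 <=
    E_k(t) + E_k(t_2n)]; removing it afterwards produces the term [- e^(-x)] of the gain. The other
    obstacle is measurability: the history of [u] is only almost everywhere equal to a Borel
    function. Each mode is therefore replaced by a Borel version, and integrals of possibly
    non-measurable functions are compared through null sets. *)

Lemma ipC x y : ip x y = ip y x.
Proof. by rewrite hermC expr0 mul1r. Qed.

Lemma ipDl x y z : ip (x + y) z = ip x z + ip y z.
Proof. by rewrite linearDl. Qed.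

Lemma ipDr x y z : ip z (x + y) = ip z x + ip z y.
Proof. by rewrite linearDr. Qed.

Lemma ipZl a x z : ip (a *: x) z = a * ip x z.
Proof. by rewrite linearZl_LR. Qed.

Lemma ipZr a x z : ip z (a *: x) = a * ip z x.
Proof. by rewrite linearZr_LR. Qed.

Lemma ipNl x z : ip (- x) z = - ip x z.
Proof. by rewrite linearNl. Qed.

Lemma ipBl x y z : ip (x - y) z = ip x z - ip y z.
Proof. by rewrite linearBl. Qed.

Lemma ipBr x y z : ip z (x - y) = ip z x - ip z y.
Proof. by rewrite linearBr. Qed.

Lemma ip0l z : ip 0 z = 0.
Proof. by rewrite linear0l. Qed.

Lemma ip0r z : ip z 0 = 0.
Proof. by rewrite linear0r. Qed.

Lemma ip_suml (I : Type) (r : seq I) (P : pred I) (F : I -> H) z :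
  ip (\sum_(i <- r | P i) F i) z = \sum_(i <- r | P i) ip (F i) z.
Proof. by rewrite linear_sumlz. Qed.

Context (ipE : dot_induces_norm ip).

Lemma sqr_normD x y : `|x + y| ^+ 2 = `|x| ^+ 2 + 2 * ip x y + `|y| ^+ 2.
Proof. by rewrite -!ipE ipDl !ipDr (ipC y x); ring. Qed.

Lemma sqr_normB x y : `|x - y| ^+ 2 = `|x| ^+ 2 - 2 * ip x y + `|y| ^+ 2.
Proof. by rewrite -!ipE ipBl !ipBr (ipC y x); ring. Qed.

Lemma Cauchy_Schwarz x y : `|ip x y| <= `|x| * `|y|.
Proof.
have [->|y0] := eqVneq y 0; first by rewrite ip0r !normr0 mulr0.
have ny : 0 < `|y| ^+ 2 by rewrite exprn_gt0 // normr_gt0.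
rewrite -(@ler_pXn2r _ 2) ?nnegrE ?mulr_ge0 //.
rewrite real_normK ?num_real // exprMn.
have := sqr_ge0 `| `|y| ^+ 2 *: x - ip x y *: y|.
rewrite sqr_normB ipZl ipZr !normrZ !exprMn !real_normK ?num_real //.
set p := ip x y; set a := `|x| ^+ 2; set c := `|y| ^+ 2.
rewrite [X in 0 <= X](_ : _ = c * (a * c - p ^+ 2)); last by rewrite /c; ring.
by rewrite pmulr_rge0 // subr_ge0.
Qed.

Lemma ip_cvg (T : Type) (F : set_system T) (FF : Filter F) (f : T -> H)
    (l z : H) :
  f x @[x --> F] --> l -> ip (f x) z @[x --> F] --> ip l z.
Proof.
move=> fl; apply/cvgrPdist_lt => eps eps0.
have d0 : 0 < eps / (`|z| + 1) by rewrite divr_gt0 // ltr_wpDl.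
move/cvgrPdist_lt : fl => /(_ _ d0); apply: filterS => x lx.
rewrite -ipBl (le_lt_trans (Cauchy_Schwarz _ _)) //.
rewrite (@le_lt_trans _ _ (`|l - f x| * (`|z| + 1))) //.
  by rewrite ler_wpM2l // lerDl.
by rewrite -ltr_pdivlMr // ltr_wpDl.
Qed.

End hilbert.

(** * Eigenvectors of a compact, symmetric, positive operator *)

Section compact_symmetric.
Context (R : realType) (H : completeNormedModType R) (ip : {dot H for @idfun R}).
Context (ipE : dot_induces_norm ip).
Context (K : H -> H).
Context (KD : forall a x y, K (a *: x + y) = a *: K x + K y).
Context (Ksym : forall x y, ip (K x) y = ip x (K y)).
Context (Kpos : forall x, x != 0 -> 0 < ip (K x) x).
Context (Kcpt : compact_map K).

Local Notation q x := (ip (K x) x).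

Let KZ a x : K (a *: x) = a *: K x.
Proof.
have K0 : K 0 = 0.
  have := KD 1 0 0; rewrite !scale1r addr0 => /eqP.
  by rewrite -subr_eq0 opprD addrA subrr sub0r oppr_eq0 => /eqP.
by have := KD a x 0; rewrite K0 !addr0.
Qed.

Let KB x y : K (x - y) = K x - K y.
Proof. by rewrite addrC -scaleN1r KD scaleN1r addrC. Qed.

Let q_ge0 x : 0 <= q x.
Proof.
by have [->|x0] := eqVneq x 0; [rewrite ip0r | exact/ltW/Kpos].
Qed.

Let unit_ball_bounded : bounded_set [set x : H | `|x| <= 1].
Proof.
exists 1; split; first exact: num_real.
by move=> M M1 x /= /le_trans; apply; exact: ltW.
Qed.

(** Boundedness comes from compactness: the image of the unit ball lies in a compact set, and
    homogeneity does the rest. *)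
Lemma compact_map_bound : exists2 M : R, 0 < M & forall x, `|K x| <= M * `|x|.
Proof.
have [U KU [cU _]] := Kcpt unit_ball_bounded.
have [M [_ MU]] := compact_bounded cU.
exists (`|M| + 1); first by rewrite ltr_wpDl.
move=> x; have [->|x0] := eqVneq x 0.
  by have := KZ 0 0; rewrite !scale0r => ->; rewrite !normr0 mulr0.
have nx : 0 < `|x| by rewrite normr_gt0.
have : `|K (`|x|^-1 *: x)| <= `|M| + 1.
  apply: (MU (`|M| + 1)); first by rewrite (le_lt_trans (ler_norm _))// ltrDl.
  apply: KU => /=; exists (`|x|^-1 *: x) => //=.
  by rewrite normrZ normfV normr_id mulVf // gt_eqF.
rewrite KZ normrZ normfV normr_id mulrC ler_pdivrMr //.
Qed.

(** [y] is a cluster point of [K (x n)]; quantifying over [d] and [N] replaces the extraction of a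
    convergent subsequence. *)
Lemma compact_map_cluster (x : nat -> H) : (forall n, `|x n| <= 1) ->
  exists y, forall d : R, 0 < d -> forall N, exists2 n, (N <= n)%N &
    `|K (x n) - y| < d.
Proof.
move=> x1; have [U KU [cU _]] := Kcpt unit_ball_bounded.
have FU : (K (x n) @[n --> \oo]) U.
  by exists 0%N => // n _; apply: KU; exists (x n) => //=.
have [y [_ yc]] := cU _ (fmap_proper_filter _ _) FU.
exists y => d d0 N.
have : [set K (x n) | n in [set n | (N <= n)%N]] `&` ball y d !=set0.
  apply: yc; last exact: nbhsx_ballx.
  by exists N => // n /= Nn; exists n.
move=> [_ [[n /= Nn <-]]]; rewrite -ball_normE /= => ynd.
by exists n => //; rewrite distrC.
Qed.

(** Cauchy-Schwarz for the positive definite form [ip (K x) y]. Taken at [y = K x], it turns an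
    upper bound of the quadratic form into a bound of [|K x|]. *)
Let q_CS x y : ip (K x) y ^+ 2 <= q x * q y.
Proof.
have [->|y0] := eqVneq y 0; first by rewrite !ip0r mulr0 expr0n.
have qy := Kpos y0.
have := q_ge0 (q y *: x - ip (K x) y *: y).
rewrite KB !KZ ipBl !ipBr !ipZl !ipZr.
have -> : ip (K y) x = ip (K x) y by rewrite Ksym ipC.
set p := ip (K x) y; set a := q x; set c := q y.
rewrite [X in 0 <= X](_ : _ = c * (a * c - p ^+ 2)); last by ring.
by rewrite pmulr_rge0 // subr_ge0.
Qed.

(* An eigenvector is found as a cluster point of [K x_n], where [x_n] is a
   maximizing sequence of the quadratic form [q] on the unit ball of the
   orthogonal complement of [E]. *)
Lemma eigenvector_orthogonal (E : set H) :
    (forall y, E y -> exists k : R, K y = k *: y) ->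
    let W := [set x | forall y, E y -> ip x y = 0] in
    (exists2 x, W x & x != 0) ->
  exists e, exists2 k : R, 0 < k &
    [/\ W e, `|e| = 1, K e = k *: e & forall x, W x -> q x <= k * `|x| ^+ 2].
Proof.
move=> EK W [x0 Wx0 x0n0].
have WK x : W x -> W (K x).
  by move=> Wx y Ey; have [k yk] := EK y Ey; rewrite Ksym yk ipZr Wx ?mulr0.
have WZ a x : W x -> W (a *: x).
  by move=> Wx y Ey; rewrite ipZl Wx ?mulr0.
have [M M0 KM] := compact_map_bound.
pose Q := [set q x | x in [set x | W x /\ `|x| <= 1]].
have ubQ : ubound Q M.
  move=> _ [x [Wx x1] <-].
  rewrite (le_trans (ler_norm _)) // (le_trans (Cauchy_Schwarz ipE _ _)) //.
  rewrite (le_trans (ler_wpM2r _ (KM x))) // -mulrA ger_pMr // -expr2.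
  by rewrite exprn_ile1.
have WN x : W x -> x != 0 -> `| `|x|^-1 *: x| = 1.
  by move=> Wx xn0; rewrite normrZ normfV normr_id mulVf // normr_eq0.
have Q0 : Q !=set0.
  exists (q (`|x0|^-1 *: x0)); exists (`|x0|^-1 *: x0) => //; split.
    exact: WZ.
  by rewrite WN.
have supQ : has_sup Q by split => //; exists M.
set k := sup Q.
have qk x : W x -> q x <= k * `|x| ^+ 2.
  move=> Wx; have [->|xn0] := eqVneq x 0.
    by rewrite ip0r normr0 expr0n mulr0.
  have nx : 0 < `|x| ^+ 2 by rewrite exprn_gt0 // normr_gt0.
  rewrite -ler_pdivrMr //.
  have -> : q x / `|x| ^+ 2 = q (`|x|^-1 *: x).
    by rewrite KZ ipZl ipZr expr2 invfM; ring.
  apply: sup_ubound; first by exists M.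
  exists (`|x|^-1 *: x) => //; split; first exact: WZ.
  by rewrite WN.
have k0 : 0 < k.
  have nx : 0 < `|x0| ^+ 2 by rewrite exprn_gt0 // normr_gt0.
  by rewrite -(pmulr_lgt0 _ nx) (lt_le_trans (Kpos x0n0)) // qk.
have /choice [x xP] : forall n : nat, exists x,
    [/\ W x, `|x| <= 1 & k - n.+1%:R^-1 < q x].
  move=> n; have n0 : 0 < n.+1%:R^-1 :> R by rewrite invr_gt0.
  by have [_ [x [Wx x1] <-] kx] := sup_adherent n0 supQ; exists x.
have [y yP] := @compact_map_cluster x (fun n => let: And3 _ h _ := xP n in h).
(* A maximizing sequence consists of approximate eigenvectors: expanding the square and using
   [|K x|^2 <= k * q x] leaves only the defect [k - q (x n)]. *)
have Kxk n : `|K (x n) - k *: x n| ^+ 2 <= k * (k - q (x n)).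
  have [Wx x1 _] := xP n.
  have Kx2 : `|K (x n)| ^+ 2 <= k * q (x n).
    have [->|Kn0] := eqVneq (K (x n)) 0.
      by rewrite normr0 expr0n ip0l mulr0.
    have nK : 0 < `|K (x n)| ^+ 2 by rewrite exprn_gt0 // normr_gt0.
    rewrite -(ler_pM2r nK).
    have := q_CS (x n) (K (x n)); rewrite ipE -expr2 => /le_trans; apply.
    by rewrite (mulrC k) -mulrA ler_wpM2l ?q_ge0 // qk //; exact: WK.
  rewrite (sqr_normB ipE) ipZr normrZ exprMn real_normK ?num_real //.
  have : k ^+ 2 * `|x n| ^+ 2 <= k ^+ 2.
    by rewrite ler_piMr ?sqr_ge0 // exprn_ile1.
  lra.
have Kykn d : 0 < d -> exists n,
    [/\ `|K (x n) - y| < d, `|K (x n) - k *: x n| < d & k - d < q (x n)].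
  move=> d0.
  (* The second bound makes [k * (k - q (x n))] less than [d ^+ 2]. *)
  have e0 : 0 < Order.min d (d ^+ 2 / k).
    by rewrite lt_min d0 divr_gt0 // exprn_gt0.
  have [N _ NP] := near_infty_natSinv_lt (PosNum e0).
  have [n Nn nP] := yP d d0 N.
  have /= := NP n Nn; rewrite lt_min => /andP[nd nd2].
  have [Wx x1 kx] := xP n.
  exists n; split => //; last by rewrite (lt_trans _ kx) // ltrD2l ltrN2.
  rewrite -(@ltr_pXn2r _ 2) ?nnegrE ?(ltW d0) //.
  rewrite (le_lt_trans (Kxk n)) // -ltr_pdivlMl // mulrC.
  by rewrite (lt_trans _ nd2) // ltrBlDr -ltrBlDl.
have Ky : K y = k *: y.
  apply/eqP; rewrite -subr_eq0 -normr_eq0; apply/eqP.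
  apply/le_anti; rewrite normr_ge0 andbT; apply/ler_addgt0Pr => e e0.
  rewrite add0r.
  have d0 : 0 < e / (M + M + k) by rewrite divr_gt0 // !addr_gt0.
  have [n [n1 n2 _]] := Kykn _ d0.
  have -> : K y - k *: y =
      K (y - K (x n)) + K (K (x n) - k *: x n) + k *: (K (x n) - y).
    by rewrite !KB KZ scalerBr !addrA !subrK.
  rewrite (le_trans (ler_normD _ _)) //.
  apply: (@le_trans _ _ ((M + M + k) * (e / (M + M + k)))); last first.
    by rewrite mulrC divfK // gt_eqF // !addr_gt0.
  rewrite [leRHS]mulrDl lerD //.
    rewrite (le_trans (ler_normD _ _)) // [leRHS]mulrDl lerD //.
      by rewrite (le_trans (KM _)) // distrC ler_wpM2l ?ltW.
    by rewrite (le_trans (KM _)) // ler_wpM2l ?ltW.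
  by rewrite normrZ gtr0_norm // ler_wpM2l ?ltW.
have Wy : W y.
  move=> z Ez; apply/eqP; rewrite -normr_eq0; apply/eqP/le_anti.
  rewrite normr_ge0 andbT; apply/ler_addgt0Pr => e e0; rewrite add0r.
  have d0 : 0 < e / (`|z| + 1) by rewrite divr_gt0 // ltr_wpDl.
  have [n [n1 _ _]] := Kykn _ d0.
  have [Wx _ _] := xP n.
  have -> : ip y z = ip (y - K (x n)) z by rewrite ipBl (WK _ Wx z Ez) subr0.
  rewrite (le_trans (Cauchy_Schwarz ipE _ _)) // distrC.
  rewrite (le_trans (ler_wpM2r _ (ltW n1))) //.
  by rewrite mulrAC ler_pdivrMr ?ltr_wpDl // ler_wpM2l ?(ltW e0) // lerDl.
(* If [y] were 0, some [K (x n)] would have norm less than [k / 2], whereas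
   [|K (x n)| >= q (x n) > k / 2]. *)
have yn0 : y != 0.
  apply/eqP => y0; have d0 : 0 < k / 2 by rewrite divr_gt0.
  have [n [n1 _ n3]] := Kykn _ d0.
  have [Wx x1 _] := xP n.
  have : q (x n) <= `|K (x n)|.
    rewrite (le_trans (ler_norm _)) // (le_trans (Cauchy_Schwarz ipE _ _)) //.
    by rewrite ler_piMr.
  by move: n1; rewrite y0 subr0; lra.
exists (`|y|^-1 *: y), k => //; split => //; first exact: WZ.
  by rewrite WN.
by rewrite KZ Ky scalerA mulrC -scalerA.
Qed.

End compact_symmetric.

(** * Parseval's identity and the orthonormal eigenvectors of [A] *)

Section eigenbasis.
Context (R : realType) (H : completeNormedModType R) (ip : {dot H for @idfun R}).
Context (ipE : dot_induces_norm ip).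

Lemma orthogonal_expansion_partial (e : nat -> H) (x : H) :
    (forall n, e n != 0 -> `|e n| = 1) ->
    (forall m n, m != n -> ip (e m) (e n) = 0) ->
  forall m n, `|x - \sum_(m <= k < n) ip x (e k) *: e k| ^+ 2 =
    `|x| ^+ 2 - \sum_(m <= k < n) ip x (e k) ^+ 2.
Proof.
move=> e1 eo m n; elim: n => [|n IH].
  by rewrite !big_geq // !subr0.
have [mn|nm] := leqP m n; last by rewrite !big_geq // !subr0.
rewrite !big_nat_recr //= opprD addrA (sqr_normB ipE) IH ipZr ipBl.
have -> : ip (\sum_(m <= k < n) ip x (e k) *: e k) (e n) = 0.
  rewrite ip_suml big_nat big1 // => k /andP[_ kn].
  by rewrite ipZl eo ?mulr0 // ltn_eqF.
rewrite subr0 normrZ exprMn real_normK ?num_real //.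
have [->|en0] := eqVneq (e n) 0.
  by rewrite ip0r normr0 !expr0n /= !mulr0 !(subr0, addr0).
by rewrite e1 // expr1n; ring.
Qed.

(** Bessel's inequality makes the squared coefficients summable, so [series s] is Cauchy and
    converges by completeness. The remainder is orthogonal to every [e n] and vanishes by
    totality. *)
Lemma parseval (e : nat -> H) (x : H) :
    (forall n, e n != 0 -> `|e n| = 1) ->
    (forall m n, m != n -> ip (e m) (e n) = 0) ->
    (forall y, (forall n, ip y (e n) = 0) -> y = 0) ->
  (\sum_(0 <= k < n) ip x (e k) ^+ 2) @[n --> \oo] --> `|x| ^+ 2.
Proof.
move=> e1 eo e_total.
pose c := fun k => ip x (e k) ^+ 2.
pose s := fun k => ip x (e k) *: e k.
have sE := orthogonal_expansion_partial x e1 eo.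
have c0 k : 0 <= c k by exact: sqr_ge0.
have cvgc : cvgn (series c).
  apply: nondecreasing_is_cvgn.
    apply/nondecreasing_seqP => n; rewrite /series /= big_nat_recr //=.
    by rewrite lerDl.
  exists (`|x| ^+ 2) => _ [n _ <-].
  by rewrite -subr_ge0 /series /= /c -sE sqr_ge0.
have sn m n : `|\sum_(m <= k < n) s k| ^+ 2 = \sum_(m <= k < n) c k.
  elim: n => [|n IH]; first by rewrite !big_geq // normr0 expr0n.
  have [mn|nm] := leqP m n; last by rewrite !big_geq // normr0 expr0n.
  rewrite !big_nat_recr //= (sqr_normD ipE) IH.
  have -> : ip (\sum_(m <= k < n) s k) (s n) = 0.
    rewrite ip_suml big_nat big1 // => k /andP[_ kn].
    by rewrite /s ipZl ipZr eo ?mulr0 // ltn_eqF.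
  rewrite mulr0 addr0 /s normrZ exprMn real_normK ?num_real // /c.
  have [->|en0] := eqVneq (e n) 0; first by rewrite ip0r expr0n /= mul0r.
  by rewrite e1 // expr1n mulr1.
have cvgs : cvgn (series s).
  apply/cauchy_cvgP/cauchy_seriesP => eps eps0.
  have /cvg_cauchy/cauchy_seriesP/(_ (eps ^+ 2)) : cvg (series c @ \oo) by [].
  rewrite exprn_gt0 // => /(_ isT); apply: filterS => -[m n] /=.
  rewrite ger0_norm; last by rewrite sumr_ge0.
  by rewrite -sn ltr_pXn2r ?nnegrE ?normr_ge0 ?(ltW eps0).
have xs : x - limn (series s) = 0.
  apply: e_total => n.
  have : ip (x - series s N) (e n) @[N --> \oo] --> ip (x - limn (series s)) (e n).
    by apply: (ip_cvg ipE); apply: cvgB => //; exact: cvg_cst.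
  suff : ip (x - series s N) (e n) @[N --> \oo] --> (0 : R).
    by move=> h1 h2; exact: (cvg_unique _ h2 h1).
  apply: cvg_near_cst; exists n.+1 => // N /= nN.
  rewrite ipBl /series /= ip_suml (big_cat_nat (n := n.+1)) //= big_nat_recr //=.
  rewrite big_nat big1 => [|k /andP[_ kn]]; last first.
    by rewrite /s ipZl eo ?mulr0 // ltn_eqF.
  rewrite big_nat big1 => [|k /andP[nk _]]; last first.
    by rewrite /s ipZl eo ?mulr0 // gtn_eqF.
  rewrite add0r addr0 /s ipZl ipE.
  have [->|en0] := eqVneq (e n) 0; first by rewrite ip0r mul0r subr0.
  by rewrite e1 // expr1n mulr1 subrr.
suff : `|x| ^+ 2 - `|x - series s n| ^+ 2 @[n --> \oo] --> `|x| ^+ 2.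
  apply: cvg_trans; apply: near_eq_cvg; apply: nearW => n.
  by rewrite /series /= sE opprB addrC subrK.
have -> : `|x| ^+ 2 = `|x| ^+ 2 - `|x - limn (series s)| ^+ 2 :> R.
  by rewrite xs normr0 expr0n subr0.
apply: cvgB; first by rewrite xs normr0 expr0n subr0; exact: cvg_cst.
rewrite !expr2; apply: cvgM; apply: cvg_norm; apply: cvgB => //; exact: cvg_cst.
Qed.

(* [e k] may be 0, to cover finite-dimensional [H]; the corresponding [lam k] is
   then meaningless. *)
Theorem eigenbasis (A : operator H) :
    self_adjoint ip A -> positive_operator ip A -> has_compact_inverse A ->
  exists (e : nat -> H) (lam : nat -> R),
    [/\ forall n, 0 < lam n,
        forall n, opdom A (e n) /\ A (e n) = lam n *: e n,
        forall n, e n != 0 -> `|e n| = 1,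
        forall m n, m != n -> ip (e m) (e n) = 0 &
        forall x, (forall n, ip x (e n) = 0) -> x = 0].
Proof.
move=> [[A0 Alin] _ Aadj] Apos [K [AK KA Kcpt]].
have KD a x y : K (a *: x + y) = a *: K x + K y.
  have [Kx Kx'] := AK x; have [Ky Ky'] := AK y.
  have [dom AE] := Alin a _ _ Kx Ky.
  by rewrite -(KA _ dom) AE Kx' Ky'.
have Ksym x y : ip (K x) y = ip x (K y).
  have [Kx Kx'] := AK x; have [Ky Ky'] := AK y.
  have := (Aadj (K y) y).2 (conj Ky Ky') (K x) Kx.
  by rewrite Kx' => <-.
have Kpos x : x != 0 -> 0 < ip (K x) x.
  move=> x0; have [Kx Kx'] := AK x.
  rewrite ipC -{1}Kx' Apos //; apply/eqP => Kx0; move/eqP: x0; apply.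
  rewrite -Kx' Kx0; have [_] := Alin (-1) _ _ A0 A0.
  by rewrite scaler0 addr0 scaleN1r addNr.
pose eigen (E : set H) := forall y, E y -> exists k : R, K y = k *: y.
pose good (E : set H) (e : H) (k : R) :=
  let W := [set x | forall y, E y -> ip x y = 0] in
  [/\ W e, 0 < k, K e = k *: e, e != 0 -> `|e| = 1 &
      if e == 0 then W `<=` [set 0]
      else forall x, W x -> ip (K x) x <= k * `|x| ^+ 2].
have next E : exists ek : H * R, eigen E -> good E ek.1 ek.2.
  have [Eig|] := pselect (eigen E); last by exists (0, 0).
  have [ex|nex] := pselect (exists2 x, (forall y, E y -> ip x y = 0) & x != 0).
    have [e [k k0 [We e1 Ke ke]]] :=
      eigenvector_orthogonal ipE KD Ksym Kpos Kcpt Eig ex.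
    exists (e, k) => _; split => //=.
    by case: ifPn => // /eqP e0; move: e1; rewrite e0 normr0 => /eqP;
       rewrite eq_sym oner_eq0.
  (* When only 0 is orthogonal to [E], the sequence is padded with the vector 0 and the dummy
     positive eigenvalue 1. *)
  exists (0, 1) => _; split => //=.
  - by move=> y _; rewrite ip0l.
  - by have := KD 1 0 0; rewrite !scale1r addr0 => /eqP;
       rewrite -subr_eq0 opprD addrA subrr sub0r oppr_eq0 => /eqP.
  - by rewrite eqxx.
  - rewrite eqxx => x Wx /=; apply/eqP; apply: contra_notT nex => x0.
    by exists x.
have {next} [f fP] := choice next.
pose E := fix E n := if n is m.+1 then E m `|` [set (f (E m)).1] else set0.
pose e n := (f (E n)).1; pose k n := (f (E n)).2.
have EigE n : eigen (E n).
  elim: n => [y //|n IH y /= [/IH //|->]].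
  by have [_ _ Ke _ _] := fP _ IH; exists (k n).
have eP n : good (E n) (e n) (k n) by exact: fP.
have Ein m n : (m < n)%N -> E n (e m).
  elim: n => // n IH; rewrite ltnS leq_eqVlt => /orP[/eqP -> |/IH]; first by right.
  by left.
have Eex n y : E n y -> exists m, y = e m.
  by elim: n => [//|n IH /= [/IH //|->]]; exists n.
have eo m n : m != n -> ip (e m) (e n) = 0.
  wlog mn : m n / (m < n)%N.
    move=> wl mn; case: (ltngtP m n) => [lt|lt|eq].
    - exact: wl.
    - by rewrite ipC wl // eq_sym.
    - by rewrite eq eqxx in mn.
  by move=> _; have [We _ _ _ _] := eP n; rewrite ipC We //; exact: Ein.
have e1 n : e n != 0 -> `|e n| = 1 by have [] := eP n.
have k0 n : 0 < k n by have [] := eP n.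
have Ke n : K (e n) = k n *: e n by have [] := eP n.
exists e, (fun n => (k n)^-1); split => //.
- by move=> n; rewrite invr_gt0.
- move=> n; have [Kd AKe] := AK (e n).
  have [+ +] := Alin (k n)^-1 _ _ Kd A0.
  have -> : A 0 = 0.
    have [_] := Alin (-1) _ _ A0 A0.
    by rewrite scaler0 addr0 scaleN1r addNr.
  by rewrite !addr0 AKe Ke scalerA mulVf ?gt_eqF // scale1r.
(* A nonzero [x] orthogonal to all [e n] competes in every maximization, so every [k n] is at least
   [eps]. The vectors [K (e n) = k n *: e n] are then at mutual distance at least [eps], which
   compactness of [K] excludes. *)
move=> x xe; apply/eqP; apply: contrapT => /negP x0.
have Wx n y : E n y -> ip x y = 0 by move=> /Eex[m ->].
have en0 n : e n != 0.
  apply/negP => /eqP en0; have [_ _ _ _] := eP n; rewrite en0 eqxx.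
  by move=> /(_ x (Wx n)) /= xx0; rewrite xx0 eqxx in x0.
have nx : 0 < `|x| ^+ 2 by rewrite exprn_gt0 // normr_gt0.
pose eps := ip (K x) x / `|x| ^+ 2.
have eps0 : 0 < eps by rewrite divr_gt0 // Kpos.
have keps n : eps <= k n.
  have [_ _ _ _] := eP n; rewrite (negPf (en0 n)) => /(_ x (Wx n)).
  by rewrite /eps ler_pdivrMr.
have [|y yP] := @compact_map_cluster _ _ K Kcpt e.
  by move=> n; rewrite e1.
have d0 : 0 < eps / 2 by rewrite divr_gt0.
have [m _ my] := yP _ d0 0%N.
have [n mn ny] := yP _ d0 m.+1.
have : `|K (e m) - K (e n)| < eps.
  rewrite -[K (e m)](subrK y) -addrA (le_lt_trans (ler_normD _ _)) //.
  by rewrite (distrC y); lra.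
apply/negP; rewrite -leNgt -(@ler_pXn2r _ 2) ?nnegrE ?(ltW eps0) //.
rewrite (sqr_normB ipE) !Ke ipZl ipZr eo; last by rewrite ltn_eqF.
rewrite !mulr0 subr0 !normrZ !e1 // !mulr1 !real_normK ?num_real //.
have : eps ^+ 2 <= k m ^+ 2 by rewrite ler_pXn2r ?nnegrE ?(ltW eps0) ?(ltW (k0 _)) ?keps.
have := sqr_ge0 (k n); lra.
Qed.

(** Formally [(S + r) (S - r) e = (A - lam) e = 0]: the vector [x = S e - r *: e] satisfies
    [S x = - r *: x], which nonnegativity of [S] allows only for [x = 0]. *)
Lemma sqrt_operator_eigenvector (A S : operator H) (lam : R) (e : H) :
    is_sqrt_operator ip S A -> 0 < lam ->
    opdom A e -> A e = lam *: e ->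
  opdom S e /\ S e = Num.sqrt lam *: e.
Proof.
move=> [[[S0 Slin] _ Sadj] Spos SA SSA] lam0 Ae Aee.
have [Se SSe] := (SA e).1 Ae.
split => //; set r := Num.sqrt lam.
have r0 : 0 < r by rewrite sqrtr_gt0.
have [domx Sx] := Slin (- r) _ _ Se SSe.
pose x := S e - r *: e.
have xE : x = (- r) *: e + S e by rewrite /x scaleNr addrC.
have : S x = (- r) *: x.
  rewrite xE Sx -SSA // Aee scalerDr scalerA mulrNN -expr2 sqr_sqrtr ?ltW //.
  by rewrite addrC.
move=> SxE; have := Spos x; rewrite xE => /(_ domx); rewrite -xE SxE ipZl ipE.
rewrite mulNr oppr_ge0 pmulr_rle0 // => x2.
apply/eqP; rewrite -subr_eq0 -/x -normr_eq0 -sqrf_eq0.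
by rewrite eq_le x2 sqr_ge0.
Qed.

End eigenbasis.

(** * Calculus preliminaries *)

Lemma within_cvgP (R : realType) (V : normedModType R) (A : set R) (f : R -> V) (t : R) (l : V) :
  f r @[r --> within A (nbhs t)] --> l <->
  forall e : R, 0 < e -> exists2 d : R, 0 < d &
    forall r, A r -> `|r - t| < d -> `|f r - l| < e.
Proof.
rewrite cvgrPdist_lt; split=> fl e e0.
  have := fl e e0; rewrite near_withinE => -[d /= d0 dP].
  exists d => // r Ar rt; rewrite distrC; apply: dP => //=.
  by rewrite distrC.
have [d d0 dP] := fl e e0; rewrite near_withinE; exists d => //= r /= rt Ar.
by rewrite distrC dP // distrC.
Qed.

Lemma within_continuousP (R : realType) (V : normedModType R) (A : set R)
    (f : R -> V) :
  {within A, continuous f} <->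
  forall t, A t -> forall e : R, 0 < e -> exists2 d : R, 0 < d &
    forall r, A r -> `|r - t| < d -> `|f r - f t| < e.
Proof.
rewrite subspace_continuousP; split=> cf t At.
  exact/within_cvgP/cf.
exact/within_cvgP/cf.
Qed.

(* The library's Lebesgue measure lives on Borel sets, whereas the histories of
   solutions are only almost everywhere equal to Borel functions: this section
   handles integrals of such possibly non-measurable functions. *)
Section nonmeasurable_integrand.
Local Open Scope ereal_scope.
Context d (T : measurableType d) (R : realType) (mu : {measure set T -> \bar R}).
Context (D : set T) (mD : measurable D).
Implicit Types f g : T -> \bar R.

(** The integral of a nonnegative function is a supremum over the simple functions below it; this is
    monotone, measurable or not. *)
Lemma ge0_le_integral_nomeas f g : (forall x, D x -> 0 <= f x) ->
    (forall x, D x -> f x <= g x) ->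
  \int[mu]_(x in D) f x <= \int[mu]_(x in D) g x.
Proof.
move=> f0 fg.
have g0 x : D x -> 0 <= g x by move=> Dx; rewrite (le_trans (f0 _ Dx)) ?fg.
rewrite !ge0_integralE //; apply: ge_ereal_sup => _ [h /= hf <-].
apply: ereal_sup_ubound; exists h => //= x; rewrite (le_trans (hf x)) //.
by rewrite !patchE; case: ifPn => // /set_mem; exact: fg.
Qed.

Lemma measurable_fun_override g (N : set T) (c : \bar R) : measurable N ->
  measurable_fun D g -> measurable_fun D (fun x => if x \in N then c else g x).
Proof.
move=> mN mg; apply: (measurable_fun_if mD) => //.
  apply: (measurable_fun_bool true) => //.
  rewrite (_ : _ @^-1` _ = N); first exact: measurableI.
  by apply/seteqP; split => x /=; [exact: set_mem|exact: mem_set].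
by apply: measurable_funS mg => //; exact: subIsetl.
Qed.

Lemma ae_override g (N : set T) (c : \bar R) : measurable N -> mu N = 0 ->
  ae_eq mu D g (fun x => if x \in N then c else g x).
Proof.
move=> mN N0; exists N; split => // x /= /not_implyP[_].
by case: ifPn => // /set_mem.
Qed.

(** Setting the measurable function [g] to [+oo] on the exceptional null set keeps its integral and
    makes the inequality hold everywhere. The companion lemma below uses the value 0 instead. *)
Lemma ge0_ae_le_integral_nomeasl f g : measurable_fun D g ->
    (forall x, D x -> 0 <= f x) -> (forall x, D x -> 0 <= g x) ->
    {ae mu, forall x, D x -> f x <= g x} ->
  \int[mu]_(x in D) f x <= \int[mu]_(x in D) g x.
Proof.
move=> mg f0 g0 [N [mN N0 fgN]].
rewrite [leRHS](ge0_ae_eq_integral mD mg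
  (measurable_fun_override +oo mN mg) _ _ (ae_override g +oo mN N0)) //; last first.
  by move=> x Dx; case: ifPn => // _; exact: g0.
apply: ge0_le_integral_nomeas => // x Dx; case: ifPn => [_|]; first exact: leey.
move=> /negP xN; apply: contrapT => fg; apply: xN; apply/mem_set/fgN => /=.
by move=> h; apply: fg; exact: h.
Qed.

Lemma ge0_ae_le_integral_nomeasr f g : measurable_fun D g ->
    (forall x, D x -> 0 <= f x) -> (forall x, D x -> 0 <= g x) ->
    {ae mu, forall x, D x -> g x <= f x} ->
  \int[mu]_(x in D) g x <= \int[mu]_(x in D) f x.
Proof.
move=> mg f0 g0 [N [mN N0 fgN]].
rewrite [leLHS](ge0_ae_eq_integral mD mg
  (measurable_fun_override 0 mN mg) _ _ (ae_override g 0 mN N0)) //; last first.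
  by move=> x Dx; case: ifPn => // _; exact: g0.
apply: ge0_le_integral_nomeas => x Dx; case: ifPn => //; [move=> _| move=> _| ].
- exact: g0.
- exact: f0.
move=> /negP xN; apply: contrapT => fg; apply: xN; apply/mem_set/fgN => /=.
by move=> h; apply: fg; exact: h.
Qed.

Lemma ge0_ae_eq_integral_nomeas f g : measurable_fun D g ->
    (forall x, D x -> 0 <= f x) -> (forall x, D x -> 0 <= g x) ->
    ae_eq mu D f g ->
  \int[mu]_(x in D) f x = \int[mu]_(x in D) g x.
Proof.
move=> mg f0 g0 fg; apply/eqP; rewrite eq_le.
rewrite ge0_ae_le_integral_nomeasl ?ge0_ae_le_integral_nomeasr //;
  by apply: filterS fg => x fg Dx; rewrite fg.
Qed.

Lemma ae_eq_integral_nomeas f g : measurable_fun D g -> ae_eq mu D f g ->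
  \int[mu]_(x in D) f x = \int[mu]_(x in D) g x.
Proof.
move=> mg fg; rewrite integralE [RHS]integralE.
have /ae_eq_funeposneg[fgp fgn] := fg.
by congr (_ - _); apply: ge0_ae_eq_integral_nomeas => //;
  [exact: measurable_funepos|exact: measurable_funeneg].
Qed.

End nonmeasurable_integrand.

(** * Monotonicity and Gronwall's inequality from Dini derivatives *)

Section dini.
Context (R : realType).
Implicit Types F : R -> R.

(** For each slope [e > 0], the set where [F t - e * (t - p) <= F p] contains its supremum by
    continuity and, if this is less than [q], also a point beyond it by the Dini bound; hence the
    supremum is [q]. *)
Lemma dini_nonincreasing F (p q : R) : p <= q ->
    {within `[p, q], continuous F} ->
    (forall t, p <= t -> t < q -> forall e, 0 < e ->
       \forall h \near 0^'+, F (t + h) - F t <= e * h) ->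
  F q <= F p.
Proof.
move=> pq cF dF; apply/ler_addgt0Pr => e0 e0_gt0.
pose e := e0 / (q - p + 1).
have qp1 : 0 < q - p + 1 by rewrite ltr_wpDl // subr_ge0.
have e_gt0 : 0 < e by rewrite divr_gt0.
suff : F q <= F p + e * (q - p).
  move=> /le_trans; apply; rewrite lerD2l /e mulrAC ler_pdivrMr //.
  by rewrite ler_pM2l // lerDl.
rewrite leNgt; apply/negP => Fqp.
pose phi t := F t - e * (t - p).
have cphi : {within `[p, q], continuous phi}.
  move=> t; apply: cvgB; first exact: cF.
  apply: cvgM; first exact: cvg_cst.
  apply: cvgB; last exact: cvg_cst.
  by apply: (@continuous_subspaceT _ _ _ id); exact: (fun x => cvg_id).
pose K := [set t | p <= t <= q /\ phi t <= F p].
have Kp : K p by split; rewrite ?lexx // /phi subrr mulr0 subr0.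
have supK : has_sup K by split; [exists p|exists q => t [/andP[]]].
pose c := sup K.
have pc : p <= c by apply: sup_ubound => //; case: supK.
have cq : c <= q.
  by apply: ge_sup => [|t [/andP[]]//]; exists p.
have phic : phi c <= F p.
  rewrite leNgt; apply/negP => Fpc.
  have [||d d0 dP] := (within_continuousP _ _).1 cphi c _ (phi c - F p).
    by rewrite /= in_itv /= pc.
  by rewrite subr_gt0.
  have [t [tpq tF] ct] := sup_adherent d0 supK.
  have tc : t <= c by apply: sup_ubound => //; case: supK.
  have : F p < phi t.
    have /= := dP t; rewrite in_itv /= tpq => /(_ isT).
    rewrite distrC ger0_norm ?subr_ge0 // ltrBlDl -ltrBlDr => /(_ ct).
    by rewrite ltr_norml => /andP[]; lra.
  by rewrite ltNge tF.
have {cq} cq : c < q.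
  rewrite lt_neqAle cq andbT; apply/eqP => cq'.
  by move: phic; rewrite cq' /phi lerBlDr leNgt Fqp.
have dFc := dF c pc cq _ e_gt0.
near (0 : R)^'+ => h.
have h0 : 0 < h by near: h; exact: nbhs_right_gt.
have : K (c + h).
  split.
    have : h <= q - c by near: h; apply: nbhs_right_le; rewrite subr_gt0.
    lra.
  have : F (c + h) - F c <= e * h by near: h; exact: dFc.
  move: phic; rewrite /phi; lra.
move=> /(sup_ubound supK.2); rewrite -/c; lra.
Unshelve. all: by end_near. Qed.

(** The factor [expR (- b * t)] reduces the claim to monotonicity. As [F] need not be
    differentiable, the product rule is replaced by the inequality
    [expR (- b * h) * (1 + b * h) <= 1]. *)
Lemma dini_gronwall F (p q b : R) : p <= q -> 0 <= b ->
    {within `[p, q], continuous F} -> (forall t, p <= t <= q -> 0 <= F t) ->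
    (forall t, p <= t -> t < q -> forall e, 0 < e ->
       \forall h \near 0^'+, F (t + h) - F t <= (b * F t + e) * h) ->
  F q <= expR (b * (q - p)) * F p.
Proof.
move=> pq b0 cF F0 dF.
pose G t := expR (- b * t) * F t.
suff : G q <= G p.
  rewrite /G => h; rewrite -(ler_pM2l (expR_gt0 (- b * q))).
  rewrite (le_trans h) // mulrA -expRD.
  by rewrite (_ : _ + _ = - b * p) //; ring.
apply: dini_nonincreasing => //.
  move=> t; apply: cvgM; last exact: cF.
  apply: (@continuous_subspaceT _ _ _ (fun t => expR (- b * t))) => s.
  apply: continuous_comp; last exact: continuous_expR.
  by apply: cvgM; [exact: cvg_cst|exact: cvg_id].
move=> t pt tq e e0.
have e1 : 0 < e * expR (b * t) by rewrite mulr_gt0 ?expR_gt0.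
have := dF t pt tq _ e1; apply: filter_app.
have F0t : 0 <= F t by rewrite F0 // pt ltW.
near=> h.
have h0 : 0 < h by near: h; exact: nbhs_right_gt.
move=> Fh; rewrite /G mulrDr expRD -mulrA -mulrBr.
have le1 : expR (- b * h) <= 1 by rewrite -expR0 ler_expR; nra.
have le2 : expR (- b * h) * (1 + b * h) <= 1.
  rewrite -(@ler_pM2l _ (expR (b * h))) ?expR_gt0 // mulrA -expRD.
  rewrite mulNr subrr expR0 mul1r mulr1; exact: expR_ge1Dx.
have e2 : expR (- b * t) * (e * expR (b * t)) = e.
  by rewrite mulrCA -expRD mulNr addNr expR0 mulr1.
rewrite -[in leRHS]e2 -mulrA ler_pM2l ?expR_gt0 //.
have := expR_gt0 (- b * h).
set x := expR (- b * h) in le1 le2 *; set E := e * _ in Fh *.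
move=> x0.
have : x * F (t + h) <= x * (F t + (b * F t + E) * h).
  by rewrite ler_pM2l // -lerBlDl.
have : F t * (x * (1 + b * h)) <= F t by rewrite ler_piMr.
have : x * (E * h) <= E * h by rewrite ler_piMl // mulr_ge0 ?(ltW e1) ?ltW.
lra.
Unshelve. all: by end_near. Qed.

End dini.

(** * The memory space *)

Section translation.
Context (R : realType).
Local Notation leb := (@lebesgue_measure R).

Lemma measurable_addr (h : R) : measurable_fun [set: R] (fun x : R => x + h).
Proof. by apply: measurable_funD => //; exact: measurable_cst. Qed.

Lemma addr_preimage_itv (h : R) (b0 b1 : bool) (x y : R) :
  (fun z => z + h) @^-1` [set` Interval (BSide b0 x) (BSide b1 y)] =
  [set` Interval (BSide b0 (x - h)) (BSide b1 (y - h))].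
Proof.
apply/seteqP; split => z /=; rewrite !in_itv /= => /andP[xz zy].
  by rewrite lteifBlDr lteifBrDr; apply/andP.
by move: xz zy; rewrite lteifBlDr lteifBrDr => -> ->.
Qed.

Lemma lebesgue_measure_shift (h : R) (A : set R) : measurable A ->
  pushforward leb (fun x : measurableTypeR R => x + h : measurableTypeR R) A =
  leb A.
Proof.
move=> mA; apply/esym; apply: lebesgue_measure_unique => //=.
  exact: measurable_addr.
move=> mh _ [[a b]] _ <-.
rewrite /pushforward addr_preimage_itv /= !lebesgue_measure_itv /=.
rewrite !lte_fin ltrD2r; case: ifPn => // _.
by rewrite -!EFinB opprB addrA subrK.
Qed.

Lemma ge0_integral_shift (h : R) (D : set (measurableTypeR R)) (f : R -> \bar R) :
    measurable D -> measurable_fun D f -> (forall y, D y -> 0 <= f y)%E ->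
  (\int[leb]_(y in D) f y =
   \int[leb]_(x in (fun x => (x + h)%R) @^-1` D) f (x + h)%R)%E.
Proof.
move=> mD mf f0.
pose phi := fun x : measurableTypeR R => x + h : measurableTypeR R.
have mphi : measurable_fun setT phi by exact: measurable_addr.
transitivity (\int[pushforward leb phi]_(y in D) f y)%E.
  apply: eq_measure_integral => //= A mA AS; apply/esym.
  exact: lebesgue_measure_shift.
rewrite (ge0_integral_pushforward mphi) //.
by move=> y /set_mem; exact: f0.
Qed.

Lemma ae_shift (h : R) (P : set R) : {ae leb, forall x, P x} ->
  {ae leb, forall x, P (x + h)}.
Proof.
move=> [N [mN N0 PN]]; exists ((fun x => x + h) @^-1` N); split.
- by rewrite -[X in measurable X]setTI; exact: measurable_addr.
- by rewrite -[RHS]N0 -(lebesgue_measure_shift h mN).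
- by move=> x /= nP; apply: PN => /=.
Qed.

End translation.

Section admissible_kernel_theory.
Context (R : realType) (mu : R -> R) (adm : admissible_kernel mu).
Local Notation leb := (@lebesgue_measure R).
Local Notation D := (`]0, +oo[%classic : set R).

Let mD : measurable (D : set (measurableTypeR R)). Proof. exact: measurable_itv. Qed.

Lemma kernel_measurable : measurable_fun (`[0, +oo[%classic : set R) mu.
Proof.
apply: subspace_continuous_measurable_fun; first exact: measurable_itv.
exact: kernel_continuous.
Qed.

Lemma kernel_measurable0 : measurable_fun D mu.
Proof.
apply: measurable_funS kernel_measurable => //.
by apply: subset_itvr; rewrite bnd_simp.
Qed.

Lemma kernel_nonincreasing (s t : R) : 0 <= s -> s <= t -> mu t <= mu s.
Proof.
move=> s0 st; have [del del0 hdel] := kernel_decay adm.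
apply: (@ler0_derive1_nincry _ mu 0) => //.
- by move=> x; rewrite in_itv /= andbT => /(kernel_C1 adm)[].
- move=> x; rewrite in_itv /= andbT => x0.
  rewrite (le_trans (hdel _ x0)) // mulNr oppr_le0 mulr_ge0 ?(ltW del0) //.
  by apply: (kernel_ge0 adm); exact: ltW.
- exact: kernel_continuous.
Qed.

Implicit Types f g : R -> R.

Let mu_ge0 s : D s -> 0 <= mu s.
Proof. by rewrite /= in_itv /= andbT => /ltW; exact: kernel_ge0. Qed.

(* Everything is relative to the measure [mu s ds] on (0, +oo). *)
Definition wint (f : R -> R) := leb.-integrable D (EFin \o (fun s => mu s * f s)).
Definition wI (f : R -> R) : R := \int[leb]_(s in D) (mu s * f s).
Definition wL2 (f : R -> R) :=
  measurable_fun D f /\ wint (fun s => f s ^+ 2).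

Lemma eq_wint f g : f =1 g -> wint f -> wint g.
Proof. by move=> /funext ->. Qed.

Lemma eq_wI f g : f =1 g -> wI f = wI g.
Proof. by move=> /funext ->. Qed.

Lemma measurable_wfun f : measurable_fun D f ->
  measurable_fun D (fun s => mu s * f s).
Proof. by move=> mf; apply: measurable_funM => //; exact: kernel_measurable0. Qed.

Lemma wint_le f g : measurable_fun D f -> wint g ->
  (forall s, D s -> `|f s| <= g s) -> wint f.
Proof.
move=> mf wg fg; move: wg; rewrite /wint; apply: le_integrable => //.
  by apply/measurable_EFinP; exact: measurable_wfun.
move=> s Ds; rewrite lee_fin /= !normrM ler_wpM2l //.
by rewrite (le_trans (fg s Ds)) // ler_norm.
Qed.

Lemma wintD f g : wint f -> wint g -> wint (fun s => f s + g s).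
Proof.
move=> wf wg; have := integrableD mD wf wg; rewrite /wint.
by congr (is_true (_ _)); apply/funext => s /=; rewrite mulrDr EFinD.
Qed.

Lemma wintZ a f : wint f -> wint (fun s => a * f s).
Proof.
move=> wf; have := integrableZl mD a wf; rewrite /wint.
by congr (is_true (_ _)); apply/funext => s /=; rewrite mulrCA EFinM.
Qed.

Lemma wint_cst (a : R) : wint (fun=> a).
Proof.
have h : leb.-integrable D (EFin \o mu).
  apply: integrableS (kernel_integrable adm) => //.
  by apply: subset_itvr; rewrite bnd_simp.
have := integrableZl mD a h; rewrite /wint.
by congr (is_true (_ _)); apply/funext => s /=; rewrite mulrC.
Qed.

Lemma wI_ge0 f : (forall s, D s -> 0 <= f s) -> 0 <= wI f.
Proof. by move=> f0; apply: Rintegral_ge0 => s Ds; rewrite mulr_ge0 ?f0 ?mu_ge0. Qed.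

Lemma wI_le f g : wint f -> wint g -> (forall s, D s -> f s <= g s) ->
  wI f <= wI g.
Proof.
move=> wf wg fg; apply: le_Rintegral => // s Ds.
by rewrite ler_wpM2l ?fg ?mu_ge0.
Qed.

Lemma wID f g : wint f -> wint g -> wI (fun s => f s + g s) = wI f + wI g.
Proof.
move=> wf wg; rewrite /wI -RintegralD //.
by apply: eq_Rintegral => s _; rewrite mulrDr.
Qed.

Lemma wIZ a f : wint f -> wI (fun s => a * f s) = a * wI f.
Proof.
move=> wf; rewrite /wI -RintegralZl //.
by apply: eq_Rintegral => s _; rewrite mulrCA.
Qed.

Lemma wI_cst a : wI (fun=> a) = kernel_mass mu * a.
Proof.
rewrite -[X in wI (fun=> X)]mulr1 wIZ; last exact: wint_cst.
rewrite mulrC; congr (_ * _); rewrite /kernel_mass -Rintegral_itv_obnd_cbnd.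
  by apply: eq_Rintegral => s _; rewrite mulr1.
have := wint_cst 1; rewrite /wint; congr (is_true (_ _)).
by apply/funext => s /=; rewrite mulr1.
Qed.

Lemma kernel_mass_ge0 : 0 <= kernel_mass mu.
Proof.
apply: Rintegral_ge0 => s; rewrite /= in_itv /= andbT; exact: kernel_ge0.
Qed.

Lemma wI_EFin f : wint f -> (\int[leb]_(s in D) (mu s * f s)%:E)%E = (wI f)%:E.
Proof. by move=> wf; rewrite /wI /Rintegral fineK //; exact: integrable_fin_num. Qed.

Lemma wL2_cst a : wL2 (fun=> a).
Proof. by split; [exact: measurable_cst|exact: wint_cst]. Qed.

Lemma wL2M f g : wL2 f -> wL2 g -> wint (fun s => f s * g s).
Proof.
move=> [mf wf] [mg wg]; apply: (wint_le _ (wintD wf wg)).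
  exact: measurable_funM.
move=> s _; rewrite normrM -(real_normK (num_real (f s))).
rewrite -(real_normK (num_real (g s))).
have := sqr_ge0 (`|f s| - `|g s|); have := normr_ge0 (f s).
have := normr_ge0 (g s); nra.
Qed.

Lemma wL2_wint f : wL2 f -> wint f.
Proof.
move=> wf; by have := wL2M wf (wL2_cst 1); apply: eq_wint => s; rewrite mulr1.
Qed.

Lemma wL2D f g : wL2 f -> wL2 g -> wL2 (fun s => f s + g s).
Proof.
move=> wf wg; split; first exact: measurable_funD wf.1 wg.1.
have := wintD wf.2 (wintD (wintZ 2 (wL2M wf wg)) wg.2).
by apply: eq_wint => s; ring.
Qed.

Lemma wL2Z a f : wL2 f -> wL2 (fun s => a * f s).
Proof.
move=> wf; split; first exact: measurable_funM (measurable_cst _) wf.1.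
by have := wintZ (a ^+ 2) wf.2; apply: eq_wint => s; rewrite exprMn.
Qed.

Lemma wL2B f g : wL2 f -> wL2 g -> wL2 (fun s => f s - g s).
Proof.
move=> wf wg; have := wL2D wf (wL2Z (-1) wg).
by congr wL2; apply/funext => s; rewrite mulN1r.
Qed.

Lemma wL2P f : measurable_fun D f ->
  (\int[leb]_(s in D) (mu s * f s ^+ 2)%:E < +oo)%E -> wL2 f.
Proof.
move=> mf fy; split => //; apply/integrableP; split.
  by apply/measurable_EFinP; apply: measurable_wfun; exact: measurable_funX.
apply: le_lt_trans fy; rewrite le_eqVlt; apply/orP; left; apply/eqP.
apply: eq_integral => s /set_mem Ds /=.
by rewrite ger0_norm // mulr_ge0 ?mu_ge0 ?sqr_ge0.
Qed.

Lemma wI_sqrD f g : wL2 f -> wL2 g ->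
  wI (fun s => (f s + g s) ^+ 2) =
  wI (fun s => f s ^+ 2) + 2 * wI (fun s => f s * g s) + wI (fun s => g s ^+ 2).
Proof.
move=> wf wg; have wfg := wL2M wf wg.
rewrite -wIZ // -wID //; [|exact: wf.2|exact: wintZ].
rewrite -wID //; [|exact/wintD/wintZ/wfg/wf.2|exact: wg.2].
by apply: eq_wI => s; ring.
Qed.

Lemma wI_Cauchy_Schwarz f g : wL2 f -> wL2 g ->
  wI (fun s => f s * g s) ^+ 2 <= wI (fun s => f s ^+ 2) * wI (fun s => g s ^+ 2).
Proof.
move=> wf wg; set a := wI (fun s => f s ^+ 2); set c := wI (fun s => g s ^+ 2).
set p := wI (fun s => f s * g s).
have quad x : 0 <= a + 2 * (x * p) + x ^+ 2 * c.
  have := wI_sqrD wf (wL2Z x wg).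
  have -> : wI (fun s => f s * (x * g s)) = x * p.
    by rewrite -wIZ ?wL2M //; apply: eq_wI => s; rewrite mulrCA.
  have -> : wI (fun s => (x * g s) ^+ 2) = x ^+ 2 * c.
    by rewrite -wIZ ?wg.2 //; apply: eq_wI => s; rewrite exprMn.
  by move=> <-; apply: wI_ge0 => s _; exact: sqr_ge0.
have c0 : 0 <= c by apply: wI_ge0 => s _; exact: sqr_ge0.
have [c_eq0|cn0] := eqVneq c 0.
  have [->|p0] := eqVneq p 0; first by rewrite expr0n c_eq0 mulr0.
  (* For [c = 0] the quadratic is affine in [x], and this [x] gives it the value [-1]. *)
  have := quad (- (a + 1) / (2 * p)).
  rewrite c_eq0 mulr0 addr0 (_ : _ + _ = -1); first by rewrite oppr_ge0 ler10.
  by field.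
have {}c0 : 0 < c by rewrite lt_neqAle eq_sym cn0.
have := quad (- p / c).
rewrite (_ : _ + _ = (a * c - p ^+ 2) / c); last by field.
by rewrite pmulr_lge0 ?invr_gt0 // subr_ge0.
Qed.

Lemma wI_sqr_le f : wL2 f ->
  wI f ^+ 2 <= kernel_mass mu * wI (fun s => f s ^+ 2).
Proof.
move=> wf; have := wI_Cauchy_Schwarz wf (wL2_cst 1).
rewrite wI_cst expr1n mulr1 [leRHS]mulrC.
by rewrite (@eq_wI _ f) // => s; rewrite mulr1.
Qed.

End admissible_kernel_theory.

(** * Energy of a mode *)

Lemma near0_rightP (R : realType) (P : R -> Prop) :
  (exists2 d : R, 0 < d & forall h, 0 < h -> h < d -> P h) ->
  \forall h \near 0^'+, P h.
Proof.
move=> [d d0 dP]; near=> h; apply: dP.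
  by near: h; exact: nbhs_right_gt.
by near: h; exact: nbhs_right_lt.
Unshelve. all: by end_near. Qed.

Section trajectory.
Context (R : realType) (mu : R -> R).
Implicit Types U V : R -> R.

Definition hist U (t s : R) : R := U t - U (t - s).

(** The regularity that a mode inherits from a solution, without any equation: it is shared by modes
    with feedback and by their continuations without feedback. *)
Record trajectory U V : Prop := Trajectory {
  traj_measurable : measurable_fun [set: R] U;
  traj_derive : forall t : R, 0 < t -> is_derive t 1 U (V t);
  traj_U_continuous : {within `[0, +oo[, continuous U};
  traj_V_continuous : {within `[0, +oo[, continuous V};
  traj_wL2 : forall t, 0 <= t -> wL2 mu (hist U t);
  traj_hist_continuous : forall t, 0 <= t -> forall e, 0 < e ->
    exists2 d : R, 0 < d & forall r, 0 <= r -> `|r - t| < d ->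
      wI mu (fun s => (hist U r s - hist U t s) ^+ 2) < e
}.

Context (adm : admissible_kernel mu).
Local Notation leb := (@lebesgue_measure R).
Local Notation D := (`]0, +oo[%classic : set R).
Local Notation m := (kernel_mass mu).

Definition mode_force (lam : R) U (t : R) : R :=
  - ((1 - m) * lam * U t + lam * wI mu (hist U t)).

Definition mode_energy (lam : R) U V (t : R) : R :=
  2^-1 * V t ^+ 2 + (1 - m) / 2 * lam * U t ^+ 2
  + 2^-1 * lam * wI mu (fun s => hist U t s ^+ 2).

Lemma mode_energy_ge0 lam U V t : 0 <= lam -> 0 <= mode_energy lam U V t.
Proof.
move=> lam0; have m1 := kernel_mass_lt1 adm.
have : 0 <= (1 - m) / 2 * lam * U t ^+ 2.
  by rewrite mulr_ge0 ?sqr_ge0 // mulr_ge0 // divr_ge0 // subr_ge0 ltW.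
have : 0 <= 2^-1 * lam * wI mu (fun s => hist U t s ^+ 2).
  rewrite mulr_ge0 ?mulr_ge0 ?invr_ge0 //; apply: (wI_ge0 adm) => s _; exact: sqr_ge0.
have := sqr_ge0 (V t).
rewrite /mode_energy; lra.
Qed.

Lemma velocity_le_mode_energy lam U V t : 0 <= lam ->
  V t ^+ 2 <= 2 * mode_energy lam U V t.
Proof.
move=> lam0; have := mode_energy_ge0 U (cst 0) t lam0.
by rewrite /mode_energy /= expr0n /= mulr0 add0r; lra.
Qed.

Section fixed_trajectory.
Context U V (UV : trajectory U V).

Lemma measurable_hist t : measurable_fun D (hist U t).
Proof.
apply: measurable_funB; first exact: measurable_cst.
apply: measurableT_comp; first exact: traj_measurable UV.
by apply: measurable_funB => //; exact: measurable_cst.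
Qed.

Lemma wI_hist_continuous : {within `[0, +oo[, continuous (fun t => wI mu (hist U t))}.
Proof.
apply/within_continuousP => t; rewrite /= in_itv /= andbT => t0 e e0.
have m0 := kernel_mass_ge0 adm.
have e1 : 0 < e ^+ 2 / (m + 1) by rewrite divr_gt0 ?exprn_gt0 // ltr_wpDl.
have [d d0 dP] := traj_hist_continuous UV t0 e1.
exists d => // r; rewrite /= in_itv /= andbT => r0 rt.
have wr := traj_wL2 UV r0; have wt := traj_wL2 UV t0.
have := wI_sqr_le adm (wL2B adm wr wt).
have -> : wI mu (fun s => hist U r s - hist U t s) =
    wI mu (hist U r) - wI mu (hist U t).
  transitivity (wI mu (fun s => hist U r s + (-1) * hist U t s)).
    by apply: eq_wI => s; rewrite mulN1r.
  rewrite (wID (wL2_wint adm wr) (wintZ (-1) (wL2_wint adm wt))) wIZ ?mulN1r //.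
  exact: wL2_wint.
rewrite -(@ltr_pXn2r _ 2) ?nnegrE ?(ltW e0) // real_normK ?num_real //.
move=> /le_lt_trans; apply.
have := dP r r0 rt; rewrite ltr_pdivlMr; last by rewrite ltr_wpDl.
apply: le_lt_trans; rewrite mulrC ler_wpM2l ?lerDl //.
by apply: (wI_ge0 adm) => s _; exact: sqr_ge0.
Qed.

Lemma wI_hist_sqr_continuous :
  {within `[0, +oo[, continuous (fun t => wI mu (fun s => hist U t s ^+ 2))}.
Proof.
apply/within_continuousP => t; rewrite /= in_itv /= andbT => t0 e e0.
have wt := traj_wL2 UV t0.
set a := wI mu (fun s => hist U t s ^+ 2).
have a0 : 0 <= a by apply: (wI_ge0 adm) => s _; exact: sqr_ge0.
have ea : 0 < 1 + 16 * a by lra.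
(* In the expansion of the square, [c < e / 2] controls the quadratic term. The cross term [2 * p]
   satisfies [p ^+ 2 <= a * c], so [16 * a * c < e ^+ 2] makes it less than [e / 2]. *)
have e1 : 0 < Order.min (e / 2) (e ^+ 2 / (1 + 16 * a)).
  by rewrite lt_min !divr_gt0 ?exprn_gt0.
have [d d0 dP] := traj_hist_continuous UV t0 e1.
exists d => // r; rewrite /= in_itv /= andbT => r0 rt.
have wr := traj_wL2 UV r0.
have := dP r r0 rt; set c := wI mu _; rewrite lt_min => /andP[c1 c2].
have c0 : 0 <= c by apply: (wI_ge0 adm) => s _; exact: sqr_ge0.
have := wI_sqrD adm wt (wL2B adm wr wt); rewrite -/a -/c.
have -> : wI mu (fun s => (hist U t s + (hist U r s - hist U t s)) ^+ 2) =
    wI mu (fun s => hist U r s ^+ 2).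
  by apply: eq_wI => s; rewrite addrC subrK.
move=> ->; have := wI_Cauchy_Schwarz adm wt (wL2B adm wr wt).
rewrite -/a -/c; set p := wI mu _ => pac.
have : `|2 * p| < e / 2.
  rewrite -(@ltr_pXn2r _ 2) ?nnegrE ?divr_ge0 ?(ltW e0) // real_normK ?num_real //.
  rewrite !exprMn exprVn; move: c2; rewrite ltr_pdivlMr // => c2.
  have := exprn_gt0 2 e0; nra.
rewrite ltr_norml => /andP[p1 p2]; rewrite ltr_norml; apply/andP; split; lra.
Qed.

(* Since [mu] is nonincreasing, transporting the history by [h] does not
   increase its weighted norm. *)
Lemma wI_hist_sqr_increment t h L : 0 <= t -> 0 < h ->
    (forall s, 0 < s -> s <= h -> `|U (t + h) - U (t + h - s)| <= L) ->
  wI mu (fun s => hist U (t + h) s ^+ 2) <=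
  wI mu (fun s => hist U t s ^+ 2) + 2 * (U (t + h) - U t) * wI mu (hist U t) +
  m * (U (t + h) - U t) ^+ 2 + mu 0 * L ^+ 2 * h.
Proof.
move=> t0 h0 UL; set c := U (t + h) - U t.
have wt := traj_wL2 UV t0.
have wth := traj_wL2 UV (addr_ge0 t0 (ltW h0)).
have -> : wI mu (fun s => hist U t s ^+ 2) + 2 * c * wI mu (hist U t) +
    m * c ^+ 2 = wI mu (fun s => (hist U t s + c) ^+ 2).
  rewrite (wI_sqrD adm wt (wL2_cst adm c)) wI_cst //; congr (_ + _ + _).
  rewrite -mulrA -(wIZ c (wL2_wint adm wt)); congr (_ * _).
  by apply: eq_wI => s; rewrite mulrC.
have wtc := wL2D adm wt (wL2_cst adm c).
rewrite -lee_fin EFinD -(wI_EFin wth.2) -(wI_EFin wtc.2).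
have mH : measurable_fun (D : set (measurableTypeR R))
    (fun s => (mu s * hist U (t + h) s ^+ 2)%:E).
  apply/measurable_EFinP; apply: (measurable_wfun adm).
  exact: measurable_funX wth.1.
have H0 s : D s -> (0 <= (mu s * hist U (t + h) s ^+ 2)%:E)%E.
  rewrite /= in_itv /= andbT => s0.
  by rewrite lee_fin mulr_ge0 ?sqr_ge0 // (kernel_ge0 adm) // ltW.
(* On []h, +oo[], the substitution [s = x + h] turns the history into [hist U t x + c] with the
   smaller weight [mu (x + h)]. On []0, h]] the integrand is at most [mu 0 * L ^+ 2]. *)
have DE : D = (`]0, h]%classic `|` `]h, +oo[%classic : set R).
  by rewrite -itv_bndbnd_setU // bnd_simp ltW.
rewrite [in leLHS]DE ge0_integral_setU //; last 3 first.
- by rewrite -DE.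
- by move=> s; rewrite -DE; exact: H0.
- apply/disj_setPLR => s /=; rewrite !in_itv /= andbT => /andP[_ sh].
  by apply/negP; rewrite -leNgt.
rewrite addrC leeD //.
  rewrite [leLHS](ge0_integral_shift h) //; last 2 first.
  - by apply: measurable_funS mH => //; apply: subset_itvr; rewrite bnd_simp ltW.
  - move=> s /=; rewrite in_itv /= andbT => hs; apply: H0.
    by rewrite /= in_itv /= andbT (lt_trans h0).
  have -> : (fun x => x + h) @^-1` `]h, +oo[%classic = D.
    by apply/seteqP; split => x /=; rewrite !in_itv /= !andbT ltrDr.
  apply: ge0_le_integral => //.
  - by move=> x; rewrite /= in_itv /= andbT => x0; apply: H0; rewrite /= in_itv /= andbT addr_gt0.
  - apply: (measurable_comp (F := D) _ _ mH) => //.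
      by move=> _ [x /= + <-]; rewrite !in_itv /= !andbT => x0; rewrite addr_gt0.
    exact: measurable_funS (measurable_addr h).
  - apply/measurable_EFinP; apply: (measurable_wfun adm).
    exact: measurable_funX wtc.1.
  - move=> x; rewrite /= in_itv /= andbT => x0; rewrite lee_fin.
    have -> : hist U (t + h) (x + h) = hist U t x + c.
      by rewrite /hist /c opprD addrACA subrr addr0; ring.
    rewrite ler_wpM2r ?sqr_ge0 // (kernel_nonincreasing adm) ?lerDl ?ltW //.
have -> : (mu 0 * L ^+ 2 * h)%:E =
    (\int[leb]_(s in `]0%R, h]) (cst (mu 0 * L ^+ 2)%:E s))%E.
  rewrite integral_cst //= lebesgue_measure_itv /= lte_fin h0 -EFinB subr0.
  by rewrite -EFinM.
apply: ge0_le_integral => //.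
- by move=> s /= /[!in_itv] /= /andP[s0 _]; apply: H0; rewrite /= in_itv /= s0.
- by apply: measurable_funS mH => //; apply: subset_itvl; rewrite bnd_simp.
- move=> s /=; rewrite in_itv /= => /andP[s0 sh]; rewrite lee_fin.
  rewrite ler_pM ?sqr_ge0 ?(kernel_ge0 adm) ?(ltW s0) //.
    by rewrite (kernel_nonincreasing adm) // ltW.
  rewrite -real_normK ?num_real // ler_pXn2r ?nnegrE ?normr_ge0 //.
    exact: UL.
  exact: le_trans (normr_ge0 _) (UL s s0 sh).
Qed.

Lemma traj_MVT a b : 0 <= a -> a < b ->
  exists2 c, a < c < b & U b - U a = V c * (b - a).
Proof.
move=> a0 ab; have [||c cab ->] := @MVT R U V a b ab.
- move=> x; rewrite in_itv /= => /andP[ax _].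
  exact: (traj_derive UV (le_lt_trans a0 ax)).
- apply: continuous_subspaceW (traj_U_continuous UV).
  by move=> x /=; rewrite !in_itv /= andbT => /andP[ax _]; exact: le_trans ax.
by exists c => //; move: cab; rewrite in_itv.
Qed.

(** Both ends of the increment vary, because the fresh part of the history at time [t + h] consists
    of the increments from [t + h - s] to [t + h]. *)
Lemma traj_increment t : 0 <= t -> forall e, 0 < e ->
  exists2 d : R, 0 < d & forall r s, t <= r -> r < s -> s < t + d ->
    `|U s - U r - (s - r) * V t| <= e * (s - r).
Proof.
move=> t0 e e0.
have [||d d0 dP] := (within_continuousP _ _).1 (traj_V_continuous UV) t _ e.
- by rewrite /= in_itv /= andbT.
- exact: e0.
exists d => // r s tr rs sd.
have [c /andP[rc cs] ->] := traj_MVT (le_trans t0 tr) rs.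
rewrite mulrC -mulrBr normrM gtr0_norm ?subr_gt0 // mulrC ler_wpM2r //.
  by rewrite subr_ge0 ltW.
apply/ltW/dP; first by rewrite /= in_itv /= andbT; lra.
by rewrite ger0_norm; lra.
Qed.

(** If [dV] and [dU] are [h] times the force and the velocity, the first two terms cancel: this is
    energy conservation to first order. The others are of higher order in [h], since [L] will itself
    be of order [h]. *)
Lemma mode_energy_increment lam t h L dU dV : 0 <= lam -> 0 <= t -> 0 < h ->
    (forall s, 0 < s -> s <= h -> `|U (t + h) - U (t + h - s)| <= L) ->
  U (t + h) = U t + dU -> V (t + h) = V t + dV ->
  mode_energy lam U V (t + h) - mode_energy lam U V t <=
  V t * dV - mode_force lam U t * dU + 2^-1 * dV ^+ 2 + 2^-1 * lam * dU ^+ 2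
  + 2^-1 * lam * (mu 0 * L ^+ 2 * h).
Proof.
move=> lam0 t0 h0 UL UE VE.
have lam2 : 0 <= 2^-1 * lam by rewrite mulr_ge0 // invr_ge0.
have := ler_wpM2l lam2 (wI_hist_sqr_increment t0 h0 UL).
rewrite /mode_energy /mode_force UE VE (addrC (U t)) addrK.
move: (wI mu _) (wI mu _) (wI mu _) (mu 0) => M' M g mu0.
lra.
Qed.

Lemma mode_energy_dini lam t k : 0 <= lam -> 0 <= t -> 0 <= k ->
    (forall e, 0 < e -> exists2 d : R, 0 < d & forall h, 0 < h -> h < d ->
       `|V (t + h) - V t - h * mode_force lam U t| <= (k + e) * h) ->
  forall e, 0 < e -> exists2 d : R, 0 < d & forall h, 0 < h -> h < d ->
    mode_energy lam U V (t + h) - mode_energy lam U V t <=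
    (`|V t| * k + e) * h.
Proof.
move=> lam0 t0 k0 dV e e0.
set v := V t; set G := mode_force lam U t in dV *.
have mu0 : 0 <= mu 0 by rewrite (kernel_ge0 adm).
(* For small [h], the increments of [U] and [V] are at most [L * h] and [A * h]. [C] collects the
   coefficients of the remainder, whose cubic history term becomes quadratic by [h <= 1]. The
   remainder and the first-order errors each take [e / 2 * h]. *)
pose L := `|v| + 1; pose A := `|G| + k + 1.
pose C := A ^+ 2 + lam * L ^+ 2 + lam * (mu 0 * L ^+ 2).
have L0 : 0 <= L by rewrite addr_ge0.
have A0 : 0 <= A by rewrite !addr_ge0.
have C0 : 0 <= C by rewrite !addr_ge0 ?mulr_ge0 ?sqr_ge0.
have B0 : 0 < `|v| + `|G| + 1 by rewrite ltr_wpDl // addr_ge0.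
pose eps := Order.min 1 (e / 2 / (`|v| + `|G| + 1)).
have eps0 : 0 < eps by rewrite lt_min ltr01 !divr_gt0.
have epsB : eps * (`|v| + `|G|) <= e / 2.
  apply: (@le_trans _ _ (e / 2 / (`|v| + `|G| + 1) * (`|v| + `|G| + 1))).
    apply: ler_pM; rewrite ?addr_ge0 ?(ltW eps0) // ?lerDl //.
    by rewrite ge_min lexx orbT.
  by rewrite divfK // gt_eqF.
have eps1 : eps <= 1 by rewrite ge_min lexx.
have [d1 d10 dV1] := dV eps eps0.
have [d2 d20 dU] := traj_increment t0 eps0.
pose d := Order.min (Order.min d1 d2) (Order.min 1 (e / (C + 1))).
exists d; first by rewrite !lt_min d10 d20 ltr01 divr_gt0 // ltr_wpDl.
move=> h h0; rewrite !lt_min => /andP[/andP[hd1 hd2] /andP[h1 hC]].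
have {hC} hC : h * C <= e.
  move: hC; rewrite ltr_pdivlMr ?ltr_wpDl // => hC.
  by rewrite (le_trans _ (ltW hC)) // ler_wpM2l ?(ltW h0) // lerDl.
have dUs s : 0 < s -> s <= h -> `|U (t + h) - U (t + h - s)| <= L * h.
  move=> s0 sh.
  have dUs : `|U (t + h) - U (t + h - s) - s * v| <= eps * s.
    have := dU (t + h - s) (t + h).
    by rewrite (_ : t + h - (t + h - s) = s); [apply; lra|ring].
  apply: (@le_trans _ _ (L * s)); last by rewrite ler_wpM2l.
  rewrite -[X in `|X|](subrK (s * v)) (le_trans (ler_normD _ _)) //.
  rewrite normrM (gtr0_norm s0) mulrDl mul1r addrC (mulrC s) lerD2l.
  by rewrite (le_trans dUs) // ler_piMl // ltW.
have := mode_energy_increment lam0 t0 h0 dUs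
  (esym (subrKC (U t) (U (t + h)))) (esym (subrKC (V t) (V (t + h)))).
have := dV1 h h0 hd1.
have := dU t (t + h) (lexx t); rewrite ltrDl ltrD2l => /(_ h0 hd2).
rewrite (addrC t h) addrK (addrC h t) -/v -/G.
set x := U (t + h) - U t; set y := V (t + h) - V t => hx hy /le_trans; apply.
have vy : v * (y - h * G) <= `|v| * ((k + eps) * h).
  by rewrite (le_trans (ler_norm _)) // normrM ler_wpM2l.
have Gx : - G * (x - h * v) <= `|G| * (eps * h).
  by rewrite (le_trans (ler_norm _)) // normrM normrN ler_wpM2l.
have y2 : y ^+ 2 <= (A * h) ^+ 2.
  rewrite -real_normK ?num_real // ler_pXn2r ?nnegrE ?mulr_ge0 ?(ltW h0) //.
  rewrite -[X in `|X|](subrK (h * G)) (le_trans (ler_normD _ _)) //.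
  rewrite (normrM h) (gtr0_norm h0) /A.
  apply: (@le_trans _ _ ((k + eps) * h + h * `|G|)); first by rewrite lerD2r.
  rewrite (mulrC h) -mulrDl ler_wpM2r ?(ltW h0) //; lra.
have x2 : x ^+ 2 <= (L * h) ^+ 2.
  rewrite -real_normK ?num_real // ler_pXn2r ?nnegrE ?mulr_ge0 ?(ltW h0) //.
  by have := dUs h h0 (lexx h); rewrite addrK.
have hh : (L * h) ^+ 2 * h <= (L * h) ^+ 2.
  by rewrite ler_piMr ?sqr_ge0 // ltW.
have c1 : lam * x ^+ 2 <= lam * (L * h) ^+ 2 by rewrite ler_wpM2l.
have c2 : lam * (mu 0 * (L * h) ^+ 2 * h) <= lam * (mu 0 * (L * h) ^+ 2).
  by rewrite -mulrA ler_wpM2l // ler_wpM2l.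
have hCh : h * C * h <= e * h by rewrite ler_wpM2r // ltW.
have epsh : eps * (`|v| + `|G|) * h <= e / 2 * h by rewrite ler_wpM2r // ltW.
have hCE : h * C * h = (A * h) ^+ 2 + lam * (L * h) ^+ 2 + lam * (mu 0 * (L * h) ^+ 2).
  by rewrite /C; ring.
lra.
Qed.

Lemma mode_energy_continuous lam :
  {within `[0, +oo[, continuous (mode_energy lam U V)}.
Proof.
move=> t; apply: cvgD; first apply: cvgD.
- apply: cvgM; first exact: cvg_cst.
  by apply: cvgM; exact: traj_V_continuous UV t.
- apply: cvgM; first exact: cvg_cst.
  by apply: cvgM; exact: traj_U_continuous UV t.
- apply: cvgM; first exact: cvg_cst.
  exact: wI_hist_sqr_continuous.
Qed.

Lemma mode_force_continuous lam :
  {within `[0, +oo[, continuous (mode_force lam U)}.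
Proof.
move=> t; apply: cvgN; apply: cvgD; (apply: cvgM; first exact: cvg_cst).
  exact: traj_U_continuous UV t.
exact: wI_hist_continuous.
Qed.

(* The forcing is bounded by [b] times the largest velocity compatible with the
   energy level [E0]. *)
Lemma mode_energy_growth lam p q b E0 : 0 <= lam -> 0 <= p -> p <= q ->
    0 <= b -> 0 <= E0 ->
    (forall t, p <= t -> t < q -> forall e, 0 < e ->
       exists2 d : R, 0 < d & forall h, 0 < h -> h < d ->
       `|V (t + h) - V t - h * mode_force lam U t| <=
         (b * Num.sqrt (2 * E0) + e) * h) ->
  mode_energy lam U V q + E0 <=
    expR (b * (q - p)) * (mode_energy lam U V p + E0).
Proof.
move=> lam0 p0 pq b0 E00 force.
apply: (@dini_gronwall _ (fun t => mode_energy lam U V t + E0)) => //.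
- have cE : {within `[p, q], continuous (mode_energy lam U V)}.
    apply: continuous_subspaceW (@mode_energy_continuous lam).
    by move=> x /=; rewrite !in_itv /= andbT => /andP[px _]; exact: le_trans px.
  by move=> t; apply: cvgD; [exact: cE|exact: cvg_cst].
- by move=> t _; rewrite addr_ge0 // mode_energy_ge0.
move=> t pt tq e e0; apply: near0_rightP.
have t0 : 0 <= t by exact: le_trans pt.
have k0 : 0 <= b * Num.sqrt (2 * E0) by rewrite mulr_ge0 ?sqrtr_ge0.
have [d d0 dP] := mode_energy_dini lam0 t0 k0 (force t pt tq) e0.
exists d => // h h0 hd; rewrite opprD addrACA subrr addr0.
rewrite (le_trans (dP h h0 hd)) // ler_wpM2r ?(ltW h0) // lerD2r.
rewrite mulrCA ler_wpM2l //.
have := velocity_le_mode_energy U V t lam0.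
rewrite -(real_normK (num_real (V t))).
have := sqr_sqrtr (mulr_ge0 (ler0n _ 2) E00).
have := sqr_ge0 (`|V t| - Num.sqrt (2 * E0)).
set a := `|V t|; set c := Num.sqrt _; lra.
Qed.

End fixed_trajectory.

End trajectory.

(** * Continuation of a mode without feedback *)

Section causal.
Context (R : realType).
Implicit Types (f g F : R -> R).
Local Notation leb := (@lebesgue_measure R).

(** Corrections to a mode, with time counted from the instant of continuation: vanishing up to 0,
    they leave the past untouched. *)
Definition causal f := continuous f /\ forall t, t <= 0 -> f t = 0.

Lemma causalD f g : causal f -> causal g -> causal (fun t => f t + g t).
Proof.
move=> [cf f0] [cg g0]; split => [t|t t0]; first by apply: cvgD; [exact: cf|exact: cg].
by rewrite f0 // g0 // addr0.
Qed.

Lemma causalZ a f : causal f -> causal (fun t => a * f t).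
Proof.
move=> [cf f0]; split => [t|t t0].
  by apply: cvgM; [exact: cvg_cst|exact: cf].
by rewrite f0 // mulr0.
Qed.

Lemma causalN f : causal f -> causal (fun t => - f t).
Proof.
move=> [cf f0]; split => [t|t t0]; first by apply: cvgN; exact: cf.
by rewrite f0 // oppr0.
Qed.

Lemma causalB f g : causal f -> causal g -> causal (fun t => f t - g t).
Proof. by move=> cf cg; exact/causalD/causalN. Qed.

Lemma causal_bounded f T : causal f ->
  exists2 M, 0 <= M & forall t, t <= T -> `|f t| <= M.
Proof.
move=> [cf f0]; have [T0|T0] := ltP T 0.
  by exists 0 => // t tT; rewrite f0 ?normr0 // (le_trans tT) // ltW.
have cn : {within `[0, T], continuous (fun t => `|f t|)}.
  apply: continuous_subspaceT => t; apply: cvg_norm; exact: cf.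
have [c _ cP] := EVT_max T0 cn.
exists `|f c| => // t tT; have [t0|t0] := leP t 0.
  by rewrite f0 // normr0.
by apply: cP; rewrite in_itv /= tT ltW.
Qed.

(** With [-oo] as lower end, the primitive of a causal function is differentiable at every real,
    without a case distinction at 0. *)
Definition prim f (t : R) : R := \int[leb]_(r in `]-oo, t]) f r.

Lemma causal_integrable f u : causal f ->
  leb.-integrable `]-oo, u] (EFin \o f).
Proof.
move=> [cf f0].
have : leb.-integrable `[0, u] (EFin \o f).
  apply: continuous_compact_integrable; first exact: segment_compact.
  exact: continuous_subspaceT.
rewrite integrable_mkcond // => h; rewrite integrable_mkcond //.
congr (is_true (_ _)) : h; apply/funext => r; rewrite !patchE.
have [r0|r0] := leP r 0.
  by rewrite /= f0 //; case: ifPn; case: ifPn.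
by rewrite !mem_setE !in_itv /= (ltW r0).
Qed.

Lemma is_derive_prim f (t : R) : causal f -> is_derive t 1 (prim f) (f t).
Proof.
move=> cf; have tt1 : t < t + 1 by rewrite ltrDl.
have [|dF Ff] := continuous_FTC1 tt1 (causal_integrable (t + 1) cf) _ (cf.1 t).
  exact: ltNyr.
by apply: DeriveDef => //; rewrite -derive1E Ff.
Qed.

Lemma prim_le0 f t : causal f -> t <= 0 -> prim f t = 0.
Proof.
move=> [_ f0] t0; transitivity (\int[leb]_(r in `]-oo, t]) (0 : R)).
  apply: eq_Rintegral => r; rewrite inE /= in_itv /= => rt.
  by rewrite f0 // (le_trans rt).
by rewrite /Rintegral integral0.
Qed.

Lemma causal_prim f : causal f -> causal (prim f).
Proof.
move=> cf; split => [t|t]; last exact: prim_le0.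
apply: differentiable_continuous; apply/derivable1_diffP.
by have [] := is_derive_prim t cf.
Qed.

Lemma primB f g t : causal f -> causal g ->
  prim (fun t => f t - g t) t = prim f t - prim g t.
Proof.
move=> cf cg; have cfg := causalB cf cg; apply/eqP; rewrite -subr_eq0; apply/eqP.
transitivity (prim (fun t => f t - g t) 0 - (prim f 0 - prim g 0)); last first.
  by rewrite !prim_le0 // !subrr.
pose d := prim (fun t => f t - g t) - (prim f - prim g).
apply: (@is_derive_0_is_cst _ d) => x.
have h1 := is_derive_prim x cfg; have h2 := is_derive_prim x cf.
have h3 := is_derive_prim x cg.
by apply: is_derive_eq; rewrite subrr.
Qed.

Lemma exp_bound_derive F f (T M k : R) : 0 < k -> 0 <= M ->
    (forall t : R, is_derive t 1 F (f t)) -> F 0 = 0 ->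
    (forall t, 0 <= t -> t <= T -> f t <= M * expR (k * t)) ->
  forall t, 0 <= t -> t <= T -> F t <= M / k * expR (k * t).
Proof.
move=> k0 M0 dF F0 fM t; rewrite le_eqVlt => /predU1P[<- _|t0 tT].
  by rewrite F0 mulr_ge0 ?expR_ge0 // divr_ge0 // ltW.
pose phi (x : R) : R := M / k * expR (k * x) - F x.
have dphi (x : R) : is_derive x 1 phi (M * expR (k * x) - f x).
  have h1 := dF x.
  have h2 : is_derive x 1 (fun x : R => k * x) k.
    by apply: is_derive_eq; exact: mulr1.
  have h3 := is_derive1_comp (is_derive_expR (k * x)) h2.
  have h4 : is_derive x 1 (fun x : R => M / k * expR (k * x)) (M * expR (k * x)).
    apply: is_derive_eq.
    by rewrite /GRing.scale /=; field; rewrite gt_eqF.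
  exact: is_deriveB.
have [|c] := MVT t0 (fun x _ => dphi x).
  apply: derivable_within_continuous => x _; by have [] := dphi x.
rewrite in_itv /= => /andP[c0 ct] phit.
have : 0 <= phi t - phi 0.
  rewrite phit mulr_ge0 ?subr_ge0 ?(ltW t0) // fM ?(ltW c0) //.
  by rewrite (le_trans (ltW ct)).
rewrite /phi F0 mulr0 expR0 mulr1 subr0.
have : 0 <= M / k by rewrite divr_ge0 // ltW.
lra.
Qed.

(** In the supremum norm weighted by [expR (- k * t)], each integration gains a factor [1 / k]. *)
Lemma prim_exp_bound f (T M k : R) : 0 < k -> 0 <= M -> causal f ->
    (forall t, t <= T -> `|f t| <= M * expR (k * t)) ->
  forall t, t <= T -> `|prim f t| <= M / k * expR (k * t).
Proof.
move=> k0 M0 cf fM t tT; have Mk : 0 <= M / k by rewrite divr_ge0 // ltW.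
have [t0|t0] := leP t 0.
  by rewrite prim_le0 // normr0 mulr_ge0 ?expR_ge0.
have F0 : prim f 0 = 0 by rewrite prim_le0.
rewrite ler_norml; apply/andP; split; last first.
  apply: (exp_bound_derive k0 M0 (fun t => is_derive_prim t cf) F0 _ (ltW t0) tT).
  by move=> s _ sT; rewrite (le_trans _ (fM s sT)) // ler_norm.
rewrite lerNl.
apply: (@exp_bound_derive (- prim f) (fun t => - f t) _ _ _ k0 M0 _ _ _ _ (ltW t0) tT).
- by move=> x; have h := is_derive_prim x cf; exact: is_deriveN.
- by rewrite /= fctE F0 oppr0.
- by move=> s _ sT; rewrite (le_trans _ (fM s sT)) // -normrN ler_norm.
Qed.

Lemma prim_lipschitz f (T : R) : causal f -> exists2 K, 0 <= K &
  forall r s, r <= T -> s <= T -> `|prim f r - prim f s| <= K * `|r - s|.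
Proof.
move=> cf; have [M M0 fM] := causal_bounded T cf; exists M => //.
have wl r s : r <= T -> s < r -> `|prim f r - prim f s| <= M * `|r - s|.
  move=> rT sr; have [|c] := MVT sr (fun x _ => is_derive_prim x cf).
    by apply: continuous_subspaceT; exact: (causal_prim cf).1.
  rewrite in_itv /= => /andP[sc cr] ->; rewrite normrM ler_wpM2r // fM //.
  by rewrite (le_trans (ltW cr)).
move=> r s rT sT; case: (ltgtP r s) => [rs|sr|->].
- by rewrite distrC (distrC r) wl.
- exact: wl.
- by rewrite !subrr !normr0 mulr0.
Qed.

End causal.

Lemma geometric_limit (R : realType) (u : nat -> R) (B : R) :
    (forall n, `|u n.+1 - u n| <= B / 2 ^+ n) ->
  forall n, `|limn u - u n| <= 2 * B / 2 ^+ n.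
Proof.
move=> uB; pose r n : R := 2 * B / 2 ^+ n.
have rS n : r n = B / 2 ^+ n + r n.+1.
  by rewrite /r exprS invfM; field; rewrite expf_neq0.
have B0 : 0 <= B by have := uB 0%N; rewrite expr0 divr1; apply: le_trans.
have r0 n : 0 <= r n by rewrite divr_ge0 ?mulr_ge0 ?exprn_ge0.
have near_u n k : `|u (n + k)%N - u n| <= r n - r (n + k)%N.
  elim: k => [|k IH]; first by rewrite addn0 !subrr normr0.
  rewrite addnS -[u _.+1](subrK (u (n + k)%N)) -addrA.
  rewrite (le_trans (ler_normD _ _)) //.
  have := uB (n + k)%N; have := rS (n + k)%N; lra.
have r_cvg : r n @[n --> \oo] --> 0.
  have h : `|2^-1 : R| < 1 by rewrite ger0_norm ?invr_ge0 // invf_lt1 // ltr1n.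
  apply: cvg_trans (cvg_geometric (2 * B) h); apply: near_eq_cvg.
  by apply: nearW => n; rewrite /geometric /= /r exprVn.
(* The increments of [u] are dominated by those of the tail [r], so [u - r] is nondecreasing and
   bounded above; adding back [r], which tends to 0, gives convergence of [u]. *)
have ur_cvg : cvgn (u - r).
  apply: nondecreasing_is_cvgn.
    apply/nondecreasing_seqP => n; rewrite !fctE.
    by have := uB n; rewrite ler_norml => /andP[+ _]; have := rS n; lra.
  exists (u 0%N + r 0%N) => _ [n _ <-]; rewrite !fctE.
  have := near_u 0%N n; rewrite add0n ler_norml => /andP[_].
  have := r0 n; lra.
have u_cvg : cvgn u.
  rewrite (_ : u = (u - r) + r); last by rewrite subrK.
  by apply: is_cvgD => //; apply/cvg_ex; exists 0.
move=> n.
have : `|u k - u n| @[k --> \oo] --> `|limn u - u n|.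
  by apply: cvg_norm; apply: cvgB => //; exact: cvg_cst.
move=> /cvgr_to_le; apply; exists n => // k /= nk.
by rewrite -(subnKC nk) (le_trans (near_u _ _)) // gerBl.
Qed.

(** * A scalar Volterra equation with memory *)

Section volterra.
Context (R : realType) (mu : R -> R) (adm : admissible_kernel mu).
Implicit Types f g : R -> R.
Local Notation leb := (@lebesgue_measure R).
Local Notation D := (`]0, +oo[%classic : set R).
Local Notation m := (kernel_mass mu).

Lemma wI_norm_le f (B : R) : wint mu f -> (forall s, 0 < s -> `|f s| <= B) ->
  `|wI mu f| <= m * B.
Proof.
move=> wf fB; rewrite ler_norml; apply/andP; split.
  rewrite -mulrN -(wI_cst adm); apply: (wI_le adm) => //; first exact: wint_cst.
  move=> s; rewrite /= in_itv /= andbT => /fB.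
  by rewrite ler_norml => /andP[].
rewrite -(wI_cst adm); apply: (wI_le adm) => //; first exact: wint_cst.
move=> s; rewrite /= in_itv /= andbT => /fB.
by rewrite ler_norml => /andP[].
Qed.

Definition kconv f (t : R) : R := wI mu (fun s => f (t - s)).

Lemma causal_wL2 f t : causal f -> wL2 mu (fun s => f (t - s)).
Proof.
move=> cf; have mf : measurable_fun D (fun s => f (t - s)).
  apply: measurable_funTS; apply: continuous_measurable_fun => s.
  apply: continuous_comp; last exact: cf.1.
  by apply: cvgB; [exact: cvg_cst|exact: cvg_id].
have [M M0 fM] := causal_bounded t cf.
split => //; apply: (wint_le adm _ (wint_cst adm (M ^+ 2))).
  exact: measurable_funX.
move=> s; rewrite /= in_itv /= andbT => s0; rewrite normrX.
by rewrite ler_pXn2r ?nnegrE ?normr_ge0 // fM // gerBl ltW.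
Qed.

Lemma kconv_bound f (B t : R) : causal f -> 0 <= B ->
  (forall r, r <= t -> `|f r| <= B) -> `|kconv f t| <= B.
Proof.
move=> cf B0 fB; apply: (@le_trans _ _ (m * B)).
  apply: wI_norm_le; first exact: wL2_wint (causal_wL2 t cf).
  by move=> s s0; apply: fB; rewrite gerBl ltW.
by rewrite ler_piMl // ltW // (kernel_mass_lt1 adm).
Qed.

Lemma kconvB f g t : causal f -> causal g ->
  kconv (fun t => f t - g t) t = kconv f t - kconv g t.
Proof.
move=> cf cg; have wf := wL2_wint adm (causal_wL2 t cf).
have wg := wL2_wint adm (causal_wL2 t cg).
rewrite /kconv -mulN1r -(wIZ (-1) wg) -(wID wf); last exact: wintZ.
by apply: eq_wI => s; rewrite mulN1r.
Qed.

(** Continuity follows from the Lipschitz bound of [prim f] on a half-line, which is uniform in the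
    lag [s]. *)
Lemma causal_kconv_prim f : causal f -> causal (kconv (prim f)).
Proof.
move=> cf; split=> [t|t t0]; last first.
  rewrite /kconv -[RHS](mulr0 m) -(wI_cst adm).
  rewrite /wI; apply: eq_Rintegral => s; rewrite inE /= in_itv /= andbT => s0.
  by rewrite prim_le0 // subr_le0 (le_trans t0) // ltW.
have [K K0 fK] := prim_lipschitz (t + 1) cf.
apply/cvgrPdist_lt => e e0.
have e1 : 0 < Order.min 1 (e / (K + 1)).
  by rewrite lt_min ltr01 divr_gt0 // ltr_wpDl.
near=> r.
have : `|t - r| < Order.min 1 (e / (K + 1)).
  by near: r; exact: (@cvgr_dist_lt _ _ _ _ _ id t cvg_id _ e1).
rewrite lt_min => /andP[tr1 tre].
have rt1 : r <= t + 1 by move: tr1; rewrite ltr_norml => /andP[]; lra.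
have cp := causal_prim cf.
have wr := wL2_wint adm (causal_wL2 r cp).
have wt := wL2_wint adm (causal_wL2 t cp).
rewrite /kconv -mulN1r -(wIZ (-1) wr) -(wID wt); last exact: wintZ.
apply: (@le_lt_trans _ _ (m * (K * `|t - r|))).
  apply: wI_norm_le; first by apply: wintD => //; exact: wintZ.
  move=> s s0; rewrite mulN1r (le_trans (fK _ _ _ _)) //; [lra|lra|].
  by rewrite (_ : t - s - (r - s) = t - r) //; ring.
rewrite (le_lt_trans (ler_piMl _ (ltW (kernel_mass_lt1 adm)))) ?mulr_ge0 //.
move: tre; rewrite ltr_pdivlMr ?ltr_wpDl // mulrC; apply: le_lt_trans.
by rewrite ler_wpM2r // lerDl.
Unshelve. all: by end_near. Qed.

Context (lam : R) (lam0 : 0 <= lam).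

(** Adding a displacement [z = prim f] to a mode changes its force by [- ((1 - m) * lam * z + lam *
    (m * z - kconv z)) = lam * (kconv z - z)]. [volt f] is the velocity generated by this change. *)
Definition volt f : R -> R := prim (fun r => lam * (kconv (prim f) r - prim f r)).

Let causal_volt_integrand f : causal f ->
  causal (fun r => lam * (kconv (prim f) r - prim f r)).
Proof.
by move=> cf; apply/causalZ/causalB; [exact: causal_kconv_prim|exact: causal_prim].
Qed.

Lemma causal_volt f : causal f -> causal (volt f).
Proof. by move=> cf; exact/causal_prim/causal_volt_integrand. Qed.

Lemma voltB f g t : causal f -> causal g ->
  volt (fun t => f t - g t) t = volt f t - volt g t.
Proof.
move=> cf cg.
rewrite /volt -primB; [|exact: causal_volt_integrand|exact: causal_volt_integrand].
have -> : prim (fun t => f t - g t) = (fun t => prim f t - prim g t).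
  by apply/funext => r; rewrite primB.
congr prim; apply/funext => r.
by rewrite kconvB; [ring|exact: causal_prim|exact: causal_prim].
Qed.

(* The exponential weight makes the Volterra operator a contraction. *)
Let k := 4 * lam + 1.

Let k0 : 0 < k. Proof. by rewrite /k; have := lam0; lra. Qed.

Lemma volt_contraction f (T M : R) : 0 <= M -> causal f ->
    (forall t, t <= T -> `|f t| <= M * expR (k * t)) ->
  forall t, t <= T -> `|volt f t| <= M / 2 * expR (k * t).
Proof.
move=> M0 cf fM t tT; have cp := causal_prim cf.
have Mk : 0 <= M / k by rewrite divr_ge0 // ltW.
have pM := prim_exp_bound k0 M0 cf fM.
have cM r : r <= T -> `|kconv (prim f) r| <= M / k * expR (k * r).
  move=> rT; apply: kconv_bound => //; first by rewrite mulr_ge0 ?expR_ge0.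
  move=> s sr; rewrite (le_trans (pM s (le_trans sr rT))) // ler_wpM2l //.
  by rewrite ler_expR ler_pM2l.
have N0 : 0 <= 2 * lam * (M / k) by rewrite mulr_ge0 // mulr_ge0.
apply: (@le_trans _ _ (2 * lam * (M / k) / k * expR (k * t))).
  apply: (prim_exp_bound k0 N0 (causal_volt_integrand cf)) (tT).
  move=> r rT; rewrite normrM (ger0_norm lam0).
  rewrite (_ : _ * expR _ = lam * (M / k * expR (k * r) + M / k * expR (k * r))).
    rewrite ler_wpM2l // (le_trans (ler_normB _ _)) // lerD ?cM //.
    exact: pM.
  by ring.
rewrite ler_wpM2r ?expR_ge0 //.
(* The two integrations in [volt] gain [1 / k ^+ 2], and [4 * lam <= k * k] because
   [k = 4 * lam + 1 >= 1]. *)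
have -> : 2 * lam * (M / k) / k = 2 * lam * M / (k * k).
  by rewrite invfM; ring.
rewrite ler_pdivrMr ?mulr_gt0 //.
rewrite (_ : 2 * lam * M = M / 2 * (4 * lam)) //; last by field.
by rewrite ler_wpM2l ?divr_ge0 //; have := lam0; rewrite /k; nra.
Qed.

(** Picard iteration. On every half-line [t <= T] the contraction bounds the [n]-th increment by
    [B / 2 ^+ n]; convergence is uniform there, so the limit is continuous and passes through
    [volt]. *)
Theorem volterra (G : R -> R) : causal G ->
  exists2 y, causal y & forall t, y t = G t + volt y t.
Proof.
move=> cG.
pose Y := fix Y n := if n is n'.+1 then fun t => G t + volt (Y n') t else G.
have YS n t : Y n.+1 t = G t + volt (Y n) t by [].
have cY n : causal (Y n) by elim: n => [//|n IH] /=; exact/causalD/causal_volt.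
have bnd T : exists2 B, 0 <= B & forall n t, t <= T ->
    `|Y n.+1 t - Y n t| <= B / 2 ^+ n.
  have [M M0 GM] := causal_bounded T (causal_volt cG).
  exists (M * expR (k * `|T|)) => [|n t tT]; first by rewrite mulr_ge0 ?expR_ge0.
  suff h : forall r, r <= T ->
      `|Y n.+1 r - Y n r| <= M / 2 ^+ n * expR (k * r).
    rewrite (le_trans (h t tT)) // mulrAC ler_pM2r ?invr_gt0 ?exprn_gt0 //.
    by rewrite ler_wpM2l // ler_expR ler_pM2l // (le_trans tT) // ler_norm.
  elim: n {t tT} => [|n IH] r rT.
    rewrite /= addrC addKr expr0 divr1.
    have [r0|r0] := leP r 0.
      by rewrite (causal_volt cG).2 // normr0 mulr_ge0 ?expR_ge0.
    rewrite (le_trans (GM r rT)) // ler_peMr // -expR0 ler_expR.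
    by rewrite mulr_ge0 ?(ltW k0) ?(ltW r0).
  have -> : Y n.+2 r - Y n.+1 r = volt (fun t => Y n.+1 t - Y n t) r.
    by rewrite voltB // (YS n.+1 r) (YS n r) opprD addrACA subrr add0r.
  have Mn : 0 <= M / 2 ^+ n by rewrite divr_ge0 ?exprn_ge0.
  rewrite exprSr invfM mulrA.
  exact: (volt_contraction Mn (causalB (cY n.+1) (cY n)) IH).
pose y t := limn (fun n => Y n t).
have yY T : exists2 B, 0 <= B & forall n t, t <= T -> `|y t - Y n t| <= B / 2 ^+ n.
  have [B B0 YB] := bnd T; exists (2 * B); first by rewrite mulr_ge0.
  move=> n t tT; apply: geometric_limit => i; exact: YB.
have small (B e : R) : 0 <= B -> 0 < e -> exists n, B / 2 ^+ n < e.
  move=> B0 e0; have h : `|2^-1 : R| < 1.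
    by rewrite ger0_norm ?invr_ge0 // invf_lt1 // ltr1n.
  have /cvgr_lt /(_ e e0)[n _ nP] := cvg_geometric B h.
  by exists n; have := nP n (leqnn n); rewrite /geometric /= exprVn.
have cy : causal y.
  split=> [t|t t0]; last first.
    rewrite /y (_ : (fun n => Y n t) = cst 0); first exact: lim_cst.
    by apply/funext => n; rewrite (cY n).2.
  apply/cvgrPdist_lt => e e0; have [B B0 yB] := yY (t + 1).
  have e3 : 0 < e / 3 by rewrite divr_gt0.
  have [n Bn] := small B _ B0 e3.
  near=> r.
  have rt1 : r <= t + 1.
    have : `|t - r| < 1 by near: r; exact: (@cvgr_dist_lt _ _ _ _ _ id t cvg_id).
    by rewrite ltr_norml => /andP[]; lra.
  have : `|Y n t - Y n r| < e / 3.
    by near: r; exact: (cvgr_dist_lt _ _ ((cY n).1 t) _ e3).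
  have := yB n r rt1; have := yB n t.
  rewrite lerDl ler01 => /(_ isT); rewrite !ler_norml !ltr_norml.
  move=> /andP[? ?] /andP[? ?] /andP[? ?].
  by apply/andP; split; lra.
exists y => // t; have [B B0 yB] := yY t.
have BE : 0 <= B * expR (k * `|t|) by rewrite mulr_ge0 ?expR_ge0.
apply/eqP; rewrite -subr_eq0 -normr_eq0 eq_le normr_ge0 andbT.
apply/ler_addgt0Pr => e e0; rewrite add0r.
have e2 : 0 < e / 2 by rewrite divr_gt0.
have [n Bn] := small _ _ (addr_ge0 B0 BE) e2.
have -> : y t - (G t + volt y t) =
    (y t - Y n.+1 t) - volt (fun t => y t - Y n t) t.
  by rewrite voltB // YS; ring.
have Bn0 : 0 <= B / 2 ^+ n by rewrite divr_ge0 ?exprn_ge0.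
have v1 : `|volt (fun t => y t - Y n t) t| <= B / 2 ^+ n / 2 * expR (k * t).
  apply: (volt_contraction Bn0 (causalB cy (cY n)) _ (lexx t)) => r rt.
  have [r0|r0] := leP r 0.
    by rewrite cy.2 // (cY n).2 // subrr normr0 mulr_ge0 ?expR_ge0.
  rewrite (le_trans (yB n r rt)) // ler_peMr // -expR0 ler_expR.
  by rewrite mulr_ge0 ?(ltW k0) ?(ltW r0).
have v2 := yB n.+1 t (lexx t).
have v3 : B / 2 ^+ n.+1 <= B / 2 ^+ n.
  by rewrite ler_wpM2l // lef_pV2 ?posrE ?exprn_gt0 // ler_eXn2l ?ltr1n.
have v4 : B / 2 ^+ n / 2 * expR (k * t) <= B / 2 ^+ n * expR (k * `|t|).
  apply: ler_pM; rewrite ?expR_ge0 ?divr_ge0 //.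
    by rewrite ler_piMr // invf_le1 // ler1n.
  by rewrite ler_expR ler_pM2l // ler_norm.
have v5 : (B + B * expR (k * `|t|)) / 2 ^+ n =
   B / 2 ^+ n + B / 2 ^+ n * expR (k * `|t|) by ring.
rewrite (le_trans (ler_normB _ _)) //.
move: Bn; rewrite v5; lra.
Unshelve. all: by end_near. Qed.

End volterra.

Section extension.
Context (R : realType) (mu : R -> R) (adm : admissible_kernel mu).
Implicit Types U V : R -> R.
Local Notation D := (`]0, +oo[%classic : set R).
Local Notation m := (kernel_mass mu).

Lemma trajectory_shift U V p : 0 <= p -> trajectory mu U V ->
  trajectory mu (fun t => U (t + p)) (fun t => V (t + p)).
Proof.
move=> p0 UV.
have hE t : hist (fun t => U (t + p)) t = hist U (t + p).
  by apply/funext => s; rewrite /hist addrAC.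
have sh (f : R -> R) : {within `[0, +oo[, continuous f} ->
    {within `[0, +oo[, continuous (fun t => f (t + p))}.
  move=> /within_continuousP cf; apply/within_continuousP => t.
  rewrite /= in_itv /= andbT => t0 e e0.
  have [||d d0 dP] := cf (t + p) _ e.
  - by rewrite /= in_itv /= andbT addr_ge0.
  - exact: e0.
  exists d => // r; rewrite /= in_itv /= andbT => r0 rt; apply: dP.
    by rewrite /= in_itv /= andbT addr_ge0.
  by rewrite opprD addrACA subrr addr0.
split.
- apply: measurableT_comp; first exact: traj_measurable UV.
  exact: measurable_addr.
- move=> t t0; have h1 := traj_derive UV (ltr_wpDr p0 t0).
  have h2 : is_derive t 1 (fun t : R => t + p) 1.
    by apply: is_derive_eq; rewrite addr0.
  by have := @is_derive1_comp _ U (fun t => t + p) t _ _ h1 h2; rewrite mulr1.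
- exact/sh/(traj_U_continuous UV).
- exact/sh/(traj_V_continuous UV).
- by move=> t t0; rewrite hE; apply: (traj_wL2 UV); rewrite addr_ge0.
- move=> t t0 e e0.
  have [d d0 dP] := traj_hist_continuous UV (addr_ge0 t0 p0) e0.
  exists d => // r r0 rt; rewrite !hE; apply: dP; first by rewrite addr_ge0.
  by rewrite opprD addrACA subrr addr0.
Qed.

(** Freezing the argument at [T] for negative [t] turns continuity within the half-line into
    continuity on the whole line, as needed for causal functions and for Borel measurability. *)
Lemma continuous_stopped (g : R -> R) (T : R) : 0 <= T ->
  {within `[0, +oo[, continuous g} ->
  continuous (fun t : R => g (T + Order.max t 0)).
Proof.
move=> T0 /within_continuousP cg t.
apply/cvgrPdist_lt => e e0.
have [||d d0 dP] := cg (T + Order.max t 0) _ e.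
- by rewrite /= in_itv /= andbT addr_ge0 // le_max lexx orbT.
- exact: e0.
near=> r; rewrite distrC; apply: dP.
  by rewrite /= in_itv /= andbT addr_ge0 // le_max lexx orbT.
have : `|t - r| < d by near: r; exact: (@cvgr_dist_lt _ _ _ _ _ id t cvg_id).
rewrite opprD addrACA subrr add0r; apply: le_lt_trans.
rewrite /Order.max; case: ltP => ?; case: ltP => ?;
  rewrite ?ler_norml; apply/andP; split; have := ler_norm (t - r);
  have := ler_norm (r - t); rewrite (distrC r); lra.
Unshelve. all: by end_near. Qed.

(** [U] and [V] already exist after [T], but with the wrong dynamics. The continuation is [U] plus a
    correction starting at [T], so its regularity reduces to that of the correction. The equation
    without feedback for the sum is a Volterra equation for the velocity correction [y]. *)
Lemma extension U V (lam T : R) : 0 <= lam -> 0 <= T -> trajectory mu U V ->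
  exists W W',
  [/\ trajectory mu W W',
      forall t, t <= T -> W t = U t,
      forall t, t <= T -> W' t = V t &
      forall t : R, T < t -> is_derive t 1 W' (mode_force mu lam W t)].
Proof.
move=> lam0 T0 UV.
pose F := mode_force mu lam U.
pose tp (t : R) := Order.max t 0.
have tp0 t : t <= 0 -> tp t = 0 by move=> t0; rewrite /tp max_r.
have tpp t : 0 <= t -> tp t = t by move=> t0; rewrite /tp max_l.
have ctp : continuous tp.
  have := @continuous_stopped id 0 (lexx 0) (continuous_subspaceT (fun x => cvg_id)).
  by rewrite (_ : tp = (fun t => 0 + Order.max t 0)) //; apply/funext => t;
     rewrite add0r.
have cF := continuous_stopped T0 (@mode_force_continuous _ _ adm _ _ UV lam).
have cV := continuous_stopped T0 (traj_V_continuous UV).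
(* [phi] subtracts [F T] in order to vanish at 0, and the term [tp t * F T] of [G] restores it. [G]
   cancels the actual velocity after [T] and replaces it by [V T] plus the integral of the force
   [F]. *)
pose phi t := F (T + tp t) - F T.
have cphi : causal phi.
  split=> [t|t t0]; last by rewrite /phi tp0 // addr0 subrr.
  by apply: cvgB; [exact: cF|exact: cvg_cst].
pose G t := V T - V (T + tp t) + prim phi t + tp t * F T.
have cG : causal G.
  split=> [t|t t0]; last first.
    by rewrite /G tp0 // addr0 subrr prim_le0 // mul0r !addr0.
  apply: cvgD; first apply: cvgD.
  - by apply: cvgB; [exact: cvg_cst|exact: cV].
  - exact: (causal_prim cphi).1.
  - by apply: cvgM; [exact: ctp|exact: cvg_cst].
have [y cy yE] := volterra adm lam0 cG.
pose z := prim y; have cz : causal z by exact: causal_prim.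
have dshift (f : R -> R) (l t : R) :
    is_derive (t - T) 1 f l -> is_derive t 1 (fun t => f (t - T)) l.
  move=> h1.
  have h2 : is_derive t 1 (fun t : R => t - T) 1.
    by apply: is_derive_eq; rewrite subr0.
  by have := @is_derive1_comp _ f (fun t => t - T) t _ _ h1 h2; rewrite mulr1.
have cshift (f : R -> R) : continuous f -> continuous (fun t => f (t - T)).
  move=> cf t; apply: continuous_comp; last exact: cf.
  by apply: cvgB; [exact: cvg_id|exact: cvg_cst].
pose W t := U t + z (t - T); pose W' t := V t + y (t - T).
have hW t : hist W t = (fun s => hist U t s + (z (t - T) - z (t - T - s))).
  apply/funext => s; rewrite /hist /W (_ : t - s - T = t - T - s); first by ring.
  by ring.
have wz t : wL2 mu (fun s => z (t - T) - z (t - T - s)).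
  by apply: (wL2B adm); [exact: wL2_cst|exact: causal_wL2].
exists W, W'; split; last first.
- move=> t Tt; have t0 : 0 < t - T by rewrite subr_gt0.
  pose k1 (t : R) := V T + prim phi t + t * F T +
    prim (fun r => lam * (kconv mu (prim y) r - prim y r)) t.
  have ck : causal (fun r => lam * (kconv mu (prim y) r - prim y r)).
    by apply/causalZ/causalB; [exact: causal_kconv_prim|exact: causal_prim].
  have d1 : is_derive (t - T) 1 k1
      (phi (t - T) + F T + lam * (kconv mu (prim y) (t - T) - prim y (t - T))).
    have h1 := is_derive_prim (t - T) cphi.
    have h2 := is_derive_prim (t - T) ck.
    by apply: is_derive_eq; rewrite /GRing.scale /=; ring.
  have -> : mode_force mu lam W t =
      phi (t - T) + F T + lam * (kconv mu (prim y) (t - T) - prim y (t - T)).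
    rewrite /phi subrK tpp ?(ltW t0) // (addrC T) subrK /F /mode_force hW.
    rewrite (wID (wL2_wint adm (traj_wL2 UV _)) (wL2_wint adm (wz t))); last first.
      by rewrite (le_trans T0) // ltW.
    have -> : wI mu (fun s => z (t - T) - z (t - T - s)) =
        m * z (t - T) - kconv mu z (t - T).
      have wc := wL2_wint adm (causal_wL2 adm (t - T) cz).
      have := wID (wint_cst adm (z (t - T))) (wintZ (-1) wc).
      rewrite (wI_cst adm) (wIZ (-1) wc) mulN1r => <-.
      by apply: eq_wI => s; rewrite mulN1r.
    by rewrite /W -/z; ring.
  have := dshift _ _ _ d1; apply: near_eq_is_derive.
  near=> r.
  have rT : 0 < r - T by rewrite subr_gt0; near: r; exact: lt_nbhsr.
  rewrite /W' yE /G /volt tpp ?(ltW rT) // (addrC T) subrK /k1.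
  by ring.
- by move=> t tT; rewrite /W' cy.2 ?addr0 // subr_le0.
- by move=> t tT; rewrite /W cz.2 ?addr0 // subr_le0.
split.
- apply: measurable_funD; first exact: traj_measurable UV.
  by apply: continuous_measurable_fun; exact/cshift/cz.1.
- move=> t t0; have h1 := traj_derive UV t0.
  have h2 := dshift _ _ _ (is_derive_prim (t - T) cy).
  exact: is_deriveD.
- move=> t; apply: cvgD; first exact: traj_U_continuous UV t.
  exact: (continuous_subspaceT (cshift _ cz.1)).
- move=> t; apply: cvgD; first exact: traj_V_continuous UV t.
  exact: (continuous_subspaceT (cshift _ cy.1)).
- by move=> t t0; rewrite hW; apply: (wL2D adm) => //; exact: traj_wL2 UV t t0.
move=> t t0 e e0.
have e4 : 0 < e / 4 by rewrite divr_gt0.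
have [d1 d10 d1P] := traj_hist_continuous UV t0 e4.
have [K K0 zK] := prim_lipschitz (t - T + 1) cy.
have m0 := kernel_mass_ge0 adm; have m1 := kernel_mass_lt1 adm.
(* The increment [b] of the history of the correction satisfies [b s ^+ 2 <= 4 * K ^+ 2 * |r - t|],
   where [|r - t| <= 1] lowers a square to the first power. With the [e / 4] reserved for [U],
   doubling each part gives at most [e / 2]. *)
pose d := Order.min (Order.min 1 d1) (e / (16 * K ^+ 2 + 1)).
have K1 : 0 < 16 * K ^+ 2 + 1 by rewrite ltr_wpDl // mulr_ge0 // sqr_ge0.
exists d; first by rewrite !lt_min ltr01 d10 divr_gt0.
move=> r r0; rewrite !lt_min => /andP[/andP[rt1 rtd] rte].
pose a s := hist U r s - hist U t s.
pose b s := (z (r - T) - z (r - T - s)) - (z (t - T) - z (t - T - s)).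
have wa : wL2 mu a by apply: (wL2B adm); exact: (traj_wL2 UV).
have wb : wL2 mu b by apply: (wL2B adm); exact: wz.
have bB s : 0 < s -> `|b s ^+ 2| <= 4 * K ^+ 2 * `|r - t|.
  move=> s0; have rt : `|r - t| <= 1 by exact: ltW.
  have rt' : r <= t + 1 by move: rt; rewrite ler_norml => /andP[]; lra.
  have : `|b s| <= 2 * K * `|r - t|.
    rewrite (_ : b s = (z (r - T) - z (t - T)) -
      (z (r - T - s) - z (t - T - s))); last by rewrite /b; ring.
    rewrite (le_trans (ler_normB _ _)) //.
    have := zK (r - T) (t - T); rewrite (_ : r - T - (t - T) = r - t); last by ring.
    have := zK (r - T - s) (t - T - s).
    rewrite (_ : r - T - s - (t - T - s) = r - t); last by ring.
    have h1 : r - T <= t - T + 1 by lra.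
    have h2 : t - T <= t - T + 1 by lra.
    have h3 : r - T - s <= t - T + 1 by lra.
    have h4 : t - T - s <= t - T + 1 by lra.
    move=> /(_ h3 h4) ? /(_ h1 h2) ?; lra.
  move=> bs; rewrite normrX.
  apply: (@le_trans _ _ ((2 * K * `|r - t|) ^+ 2)).
    by rewrite ler_pXn2r ?nnegrE ?mulr_ge0.
  rewrite !exprMn -natrX ler_wpM2l ?mulr_ge0 ?sqr_ge0 //.
  by rewrite expr2 ler_piMl.
have : wI mu (fun s => (hist W r s - hist W t s) ^+ 2) <=
    2 * wI mu (fun s => a s ^+ 2) + 2 * wI mu (fun s => b s ^+ 2).
  rewrite -(wIZ 2 wa.2) -(wIZ 2 wb.2) -(wID (wintZ 2 wa.2) (wintZ 2 wb.2)).
  apply: (wI_le adm).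
  - have := (wL2D adm wa wb).2; apply: eq_wint => s.
    by rewrite !hW /a /b; congr (_ ^+ 2); ring.
  - by apply: wintD; apply: wintZ; [exact: wa.2|exact: wb.2].
  - move=> s _; rewrite !hW.
    rewrite (_ : _ - _ = a s + b s); last by rewrite /a /b; ring.
    have := sqr_ge0 (a s - b s); lra.
move=> /le_lt_trans; apply.
have := d1P r r0 rtd; rewrite -/a.
have : wI mu (fun s => b s ^+ 2) <= 4 * K ^+ 2 * `|r - t|.
  rewrite (le_trans (ler_norm _)) // (le_trans (wI_norm_le adm wb.2 bB)) //.
  by rewrite ler_piMl ?mulr_ge0 ?sqr_ge0 // ltW.
have : 16 * K ^+ 2 * `|r - t| <= e.
  move: rte; rewrite ltr_pdivlMr // => rte.
  rewrite (le_trans _ (ltW rte)) // mulrC ler_wpM2l // lerDl //.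
lra.
Unshelve. all: by end_near. Qed.

End extension.

(** * Modes and solutions *)

Lemma FTC_within (R : realType) (F f : R -> R) (a c : R) : a <= c ->
    {within `[a, c], continuous F} -> {within `[a, c], continuous f} ->
    (forall x : R, a < x -> x < c -> is_derive x 1 F (f x)) ->
  F c - F a = \int[lebesgue_measure]_(r in `[a, c]) f r.
Proof.
rewrite le_eqVlt => /predU1P[<- _ _ _|ac cF cf dF].
  by rewrite subrr set_itv1 Rintegral_set1.
have [_ Fa Fc] := (continuous_within_itvP F ac).1 cF.
rewrite /Rintegral (@continuous_FTC2 _ _ F) //.
  split => // x; rewrite in_itv /= => /andP[ax xc].
  by have [] := dF x ax xc.
move=> x; rewrite in_itv /= => /andP[ax xc].
by rewrite derive1E; have [_ ->] := dF x ax xc.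
Qed.

Section strongly_measurable_scale.
Import HBSimple.

Lemma strongly_measurable_scale (R : realType) (H : completeNormedModType R)
    (E : set R) (g : R -> R) (e : H) : measurable_fun [set: R] g ->
  strongly_measurable E (fun s => g s *: e).
Proof.
move=> mg; have mg' : measurable_fun [set: measurableTypeR R] (EFin \o g).
  exact/measurable_EFinP.
have [phi phiP] := approximation_sfun measurableT mg'.
exists (fun n s => phi n s *: e); split; last first.
  apply: aeW => s _; apply: cvgZr_tmp.
  by have /fine_cvgP[_] := phiP s I.
move=> n; split.
  have -> : range (fun s => phi n s *: e) = (fun a => a *: e) @` range (phi n).
    by rewrite image_comp.
  by apply: finite_image; exact: (fimfunP (phi n)).
move=> x.
have [[s0 <-]|nx] := pselect (exists s, phi n s *: e = x); last first.
  rewrite (_ : _ @^-1` _ = set0); first exact: measurable0.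
  by apply/seteqP; split => // s /= sx; apply: nx; exists s.
have [->|e0] := eqVneq e 0.
  rewrite (_ : _ @^-1` _ = setT); first exact: measurableT.
  by apply/seteqP; split => // s _ /=; rewrite !scaler0.
rewrite (_ : _ @^-1` _ = phi n @^-1` [set phi n s0]).
  exact: (measurable_funPTI (phi n) (measurable_set1 _)).
apply/seteqP; split => s /= => [/eqP|->//].
by rewrite -subr_eq0 -scalerBl scaler_eq0 (negPf e0) orbF subr_eq0 => /eqP.
Qed.

End strongly_measurable_scale.

Lemma is_derive_cvg (R : numFieldType) (V W : normedModType R) (f : V -> W)
    (a v : V) (l : W) :
  h^-1 *: (f (h *: v + a) - f a) @[h --> 0^'] --> l -> is_derive a v f l.
Proof.
move=> fl; apply: DeriveDef; first exact: (cvgP l fl).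
by apply: cvg_lim fl; exact: norm_hausdorff.
Qed.

Lemma is_derive_scale_cvg (R : realType) (H : normedModType R) (f : R -> R)
    (t l : R) (e : H) : is_derive t 1 f l ->
  h^-1 *: (f (h + t) *: e - f t *: e) @[h --> 0^'] --> l *: e.
Proof.
move=> [dl le].
have : h^-1 *: (f (h *: 1 + t) - f t) @[h --> (0 : R)^'] --> l.
  by rewrite -le; exact: dl.
move=> fl; apply: cvg_trans (cvgZr_tmp (a := e) fl).
apply: near_eq_cvg; apply: nearW => h.
by rewrite -scalerBl scalerA (_ : h *: 1 = h) //; exact: mulr1.
Qed.

Lemma continuous_locally_integrable (R : realType) (f : R -> R) :
  {within `[0, +oo[, continuous f} -> locally_integrable `]0, +oo[ f.
Proof.
move=> cf; split; last 2 first.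
- exact: interval_open.
- move=> K K0 cK.
  have cK' : {within K, continuous f}.
    apply: continuous_subspaceW cf => x /K0 /=; rewrite !in_itv /= !andbT.
    exact: ltW.
  by have /integrableP[_] := continuous_compact_integrable cK cK'.
apply: measurable_funS (subspace_continuous_measurable_fun _ cf) => //.
by apply: subset_itvr; rewrite bnd_simp.
Qed.

(** * From a scalar trajectory to a solution without feedback *)

Section mode_solution.
Context (R : realType) (H : completeNormedModType R) (ip : {dot H for @idfun R}).
Context (A S : operator H) (mu : R -> R) (tau : R) (adm : admissible_kernel mu).
Context (lam : R) (e : H).
Context (lam0 : 0 < lam) (Slin : linear_operator S).
Context (Ssym : forall x y, opdom S x -> opdom S y -> ip (S x) y = ip x (S y)).
Context (Se : opdom S e) (SeE : S e = Num.sqrt lam *: e) (e1 : `|e| = 1).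
Context (U V : R -> R) (UV : trajectory mu U V).
Local Notation D := (`]0, +oo[%classic : set R).

Lemma opdomZ a : opdom S (a *: e) /\ S (a *: e) = (a * Num.sqrt lam) *: e.
Proof.
have [S0 Sl] := Slin; have [h1 h2] := Sl a _ _ Se S0.
have S00 : S 0 = 0.
  have [_] := Sl (-1) _ _ S0 S0.
  by rewrite scaler0 addr0 scaleN1r addNr.
by rewrite addr0 in h1 h2; split; rewrite // h2 S00 addr0 SeE scalerA.
Qed.

Lemma sqnorm_mu_mode (f : R -> R) : wL2 mu f ->
  sqnorm_mu mu S (fun s => f s *: e) = (lam * wI mu (fun s => f s ^+ 2))%:E.
Proof.
move=> wf; rewrite -(wIZ lam wf.2) -wI_EFin; last exact/wintZ/wf.2.
rewrite /sqnorm_mu; apply: eq_integral => s _; congr (_ * _)%:E.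
rewrite (opdomZ _).2 normrZ e1 mulr1 real_normK ?num_real // exprMn.
by rewrite sqr_sqrtr ?(ltW lam0) // mulrC.
Qed.

Lemma eta_mode t : Defs.eta (fun t => U t *: e) t = (fun s => hist U t s *: e).
Proof. by apply/funext => s; rewrite /Defs.eta /hist scalerBl. Qed.

Lemma energy_mode t : 0 <= t ->
  energy S mu (fun t => U t *: e) (fun t => V t *: e) t = mode_energy mu lam U V t.
Proof.
move=> t0; rewrite /energy eta_mode sqnorm_mu_mode; last exact: traj_wL2 UV t t0.
rewrite (opdomZ _).2 !normrZ e1 !mulr1 exprMn !(real_normK (num_real _)).
by rewrite sqr_sqrtr ?(ltW lam0) // /mode_energy /=; ring.
Qed.

Lemma mode_solution :
    (forall a c, 0 <= a -> a <= c ->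
       V c - V a = \int[lebesgue_measure]_(r in `[a, c]) mode_force mu lam U r) ->
  is_solution ip A S mu tau (fun=> 0) (fun t => U t *: e) (V 0 *: e)
    (fun t => U t *: e) (fun t => V t *: e).
Proof.
move=> wave.
have scale_cont (f : R -> R) (x : H) : {within `[0, +oo[, continuous f} ->
    {within `[0, +oo[, continuous (fun t => f t *: x)}.
  by move=> cf t; apply: cvgZr_tmp; exact: cf.
split => //.
- move=> t t0; apply: is_derive_cvg.
  apply: cvg_trans (is_derive_scale_cvg (e := e) (traj_derive UV t0)).
  apply: near_eq_cvg; apply: nearW => h; rewrite (_ : h *: 1 = h) //.
  exact: mulr1.
- by move=> t _; have [] := opdomZ (U t).
- have -> : (fun t => S (U t *: e)) = (fun t => U t *: (Num.sqrt lam *: e)).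
    by apply/funext => t; rewrite (opdomZ _).2 scalerA.
  exact/scale_cont/(traj_U_continuous UV).
- exact/scale_cont/(traj_V_continuous UV).
- move=> t t0; rewrite eta_mode; split.
  + by apply: aeW => s _; have [] := opdomZ (hist U t s).
  + rewrite (_ : (fun s => _) = (fun s => hist U t s *: (Num.sqrt lam *: e))).
      apply: strongly_measurable_scale.
      apply: measurable_funB; first exact: measurable_cst.
      apply: measurableT_comp; first exact: traj_measurable UV.
      by apply: measurable_funB => //; exact: measurable_cst.
    by apply/funext => s; rewrite (opdomZ _).2 scalerA.
  + rewrite sqnorm_mu_mode ?ltry //; exact: traj_wL2 UV t t0.
- move=> t t0.
  have sqE : \forall r \near within `[0, +oo[ (nbhs t),
      (lam * wI mu (fun s => (hist U r s - hist U t s) ^+ 2))%:E =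
      sqnorm_mu mu S (fun s => Defs.eta (fun t => U t *: e) r s -
        Defs.eta (fun t => U t *: e) t s).
    rewrite near_withinE; apply: nearW => r /=; rewrite in_itv /= andbT => r0.
    rewrite !eta_mode -sqnorm_mu_mode; last by apply: wL2B => //; exact: traj_wL2 UV _ _.
    by congr sqnorm_mu; apply/funext => s; rewrite scalerBl.
  apply: cvg_trans (near_eq_cvg sqE) _; apply: cvg_EFin; first exact: nearW.
  apply/within_cvgP => eps eps0.
  have el : 0 < eps / lam by rewrite divr_gt0.
  have [d d0 dP] := traj_hist_continuous UV t0 el; exists d => // r.
  rewrite /= in_itv /= andbT => r0 rt; rewrite subr0 ger0_norm.
    by rewrite mulrC -ltr_pdivlMr // dP.
  by rewrite mulr_ge0 ?(ltW lam0) //; apply: (wI_ge0 adm) => s _; exact: sqr_ge0.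
- exists (fun t w => mode_force mu lam U t * ip e w).
  have cF := @mode_force_continuous _ _ adm _ _ UV lam.
  split=> [w Sw|].
    have cFw : {within `[0, +oo[, continuous (fun t => mode_force mu lam U t * ip e w)}.
      by move=> t; apply: cvgM; [exact: cF|exact: cvg_cst].
    split; first exact: continuous_locally_integrable.
    move=> a c a0 ac; rewrite !ipZl -mulrBl wave ?(ltW a0) // RintegralZr //.
    apply: continuous_compact_integrable; first exact: segment_compact.
    apply: continuous_subspaceW cF => x /=; rewrite !in_itv /= andbT.
    by move=> /andP[ax _]; rewrite (le_trans (ltW a0)).
  apply: aeW => t t0 w Sw.
  have ipS a : ip (S (a *: e)) (S w) = a * (lam * ip e w).
    rewrite (opdomZ _).2 ipZl -(Ssym Se Sw) SeE ipZl.
    by rewrite mulrA -(mulrA a) -expr2 sqr_sqrtr ?(ltW lam0) // mulrA.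
  rewrite ipS scale0r oppr0 ip0l addr0 eta_mode.
  have wt := wL2_wint adm (traj_wL2 UV (ltW t0)).
  have -> : \int[lebesgue_measure]_(s in `]0, +oo[)
      (mu s * ip (S (hist U t s *: e)) (S w)) =
      lam * ip e w * wI mu (hist U t).
    rewrite -(wIZ _ wt) /wI; apply: eq_Rintegral => s _.
    by rewrite ipS; ring.
  by rewrite /mode_force; ring.
apply: aeW => t t0 /=.
(* In the direction [(1, 1)] the difference [t - s] is constant, so only the term [U t] of the
   history varies. *)
have dE (s : R) : is_derive ((t, s) : R * R) ((1, 1) : R * R)
    (fun p : R * R => Defs.eta (fun t => U t *: e) p.1 p.2) (V t *: e).
  apply: is_derive_cvg.
  apply: cvg_trans (is_derive_scale_cvg (e := e) (traj_derive UV t0)).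
  apply: near_eq_cvg; apply: nearW => h; congr (_ *: _).
  rewrite /Defs.eta /= (_ : h *: 1 = h); last exact: mulr1.
  by rewrite (_ : h + t - (h + s) = t - s); [rewrite opprB addrA subrK|ring].
split=> [s _|w _]; first by have [] := dE s.
by apply: eq_Rintegral => s _; have [_ ->] := dE s.
Qed.

End mode_solution.

Lemma ae_imply (R : realType) (P Q : R -> Prop) :
  (forall x, P x -> Q x) -> {ae lebesgue_measure, forall x, P x} ->
  {ae lebesgue_measure, forall x, Q x}.
Proof.
move=> PQ; apply: filterS; first exact: (ae_filter_ringOfSetsType lebesgue_measure).
exact: PQ.
Qed.

Lemma ae_imply2 (R : realType) (P P' Q : R -> Prop) :
  (forall x, P x -> P' x -> Q x) -> {ae lebesgue_measure, forall x, P x} ->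
  {ae lebesgue_measure, forall x, P' x} -> {ae lebesgue_measure, forall x, Q x}.
Proof.
move=> PQ; apply: filterS2; first exact: (ae_filter_ringOfSetsType lebesgue_measure).
exact: PQ.
Qed.

Lemma self_adjoint_sym (R : realType) (H : completeNormedModType R)
    (ip : {dot H for @idfun R}) (S : operator H) : self_adjoint ip S ->
  forall x y, opdom S x -> opdom S y -> ip (S x) y = ip x (S y).
Proof. by move=> [_ _ Sadj] x y Sx Sy; exact: (Sadj y (S y)).2. Qed.

(** The upper limit of the scalar simple functions is Borel on the whole line and equals
    [ip (f s) e] wherever the approximation converges. *)
Lemma strongly_measurable_ip (R : realType) (H : completeNormedModType R)
    (ip : {dot H for @idfun R}) (ipE : dot_induces_norm ip)
    (E : set R) (f : R -> H) (e : H) : strongly_measurable E f ->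
  exists2 g : R -> R, measurable_fun [set: R] g &
    {ae lebesgue_measure, forall s, E s -> ip (f s) e = g s}.
Proof.
move=> [phi [phim phif]].
pose psi n s := (ip (phi n s) e)%:E.
exists (fun s => fine (limn_esup (psi ^~ s))).
  apply: measurableT_comp; first exact: fine_measurable.
  apply: measurable_fun_limn_esup => n; apply/measurable_EFinP => _ Y mY.
  rewrite setTI (_ : _ @^-1` Y = \bigcup_(x in range (phi n) `&`
      [set x | Y (ip x e)]) (phi n @^-1` [set x])).
    apply: fin_bigcup_measurable => [|x _]; last exact: (phim n).2.
    by apply: finite_setIl; exact: (phim n).1.
  apply/seteqP; split => [s /= Ys|s [x [_ Yx] /= sx]]; last by rewrite sx.
  by exists (phi n s).
apply: ae_imply phif => s h Es.
have psi_cvg : psi ^~ s @ \oo --> (ip (f s) e)%:E.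
  by apply: cvg_EFin; [exact: nearW|exact: (ip_cvg ipE) (h Es)].
rewrite is_cvg_limn_esupE; last by apply/cvg_ex; eexists; exact: psi_cvg.
by have /cvg_lim -> := psi_cvg.
Qed.

Lemma is_derive_ip (R : realType) (H : completeNormedModType R)
    (ip : {dot H for @idfun R}) (ipE : dot_induces_norm ip) (f : R -> H)
    (t : R) (l e : H) : is_derive t 1 f l ->
  is_derive t 1 (fun t => ip (f t) e) (ip l e).
Proof.
move=> [dl le]; apply: is_derive_cvg.
have fl : h^-1 *: (f (h *: 1 + t) - f t) @[h --> (0 : R)^'] --> l.
  by rewrite -le; exact: dl.
apply: cvg_trans (@ip_cvg _ _ _ ipE _ _ _ _ _ e fl); apply: near_eq_cvg.
by apply: nearW => h; rewrite ipZl ipBl.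
Qed.

(** * From a solution to its scalar modes *)

Section mode_of_solution.
Context (R : realType) (H : completeNormedModType R) (ip : {dot H for @idfun R}).
Context (ipE : dot_induces_norm ip).
Context (A S : operator H) (mu : R -> R) (tau : R) (adm : admissible_kernel mu).
Context (Sadj : self_adjoint ip S).
Context (b : R -> R) (u0 : R -> H) (v0 : H) (u v : R -> H).
Context (sol : is_solution ip A S mu tau b u0 v0 u v).
Context (lam : R) (e : H).
Context (lam0 : 0 < lam) (Se : opdom S e) (SeE : S e = Num.sqrt lam *: e).
Context (e1 : `|e| <= 1).
Local Notation leb := (@lebesgue_measure R).
Local Notation D := (`]0, +oo[%classic : set R).

Let mD : measurable (D : set (measurableTypeR R)).
Proof. exact: measurable_itv. Qed.

Let sl0 : 0 < Num.sqrt lam. Proof. by rewrite sqrtr_gt0. Qed.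

Let ipSe x : opdom S x -> ip (S x) e = Num.sqrt lam * ip x e.
Proof. by move=> Sx; rewrite (self_adjoint_sym Sadj) // SeE ipZr. Qed.

Let ip_le x : ip x e ^+ 2 <= `|x| ^+ 2.
Proof.
rewrite -real_normK ?num_real // ler_pXn2r ?nnegrE //.
by rewrite (le_trans (Cauchy_Schwarz ipE _ _)) // ler_piMr.
Qed.

(* [U] is a Borel version of [t |-> ip (u t) e]. *)
Lemma mode_of_solution : exists U,
  [/\ trajectory mu U (fun t => ip (v t) e),
      forall t, 0 <= t -> U t = ip (u t) e &
      forall t, 0 <= t -> {ae leb, forall s, 0 < s -> 0 < mu s ->
         hist U t s = ip (Defs.eta u t s) e}].
Proof.
have [dom0 sm0 _] := sol_eta_L2mu sol (lexx 0).
have [g mg gE] := strongly_measurable_ip ipE e sm0.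
have {}gE : {ae leb, forall s, 0 < s /\ 0 < mu s ->
    ip (Defs.eta u 0 s) e = g s / Num.sqrt lam}.
  apply: ae_imply2 dom0 gE => s dom gE Ds.
  rewrite -gE // ipSe; last exact: dom.
  by rewrite mulrC mulKf // gt_eqF.
have cu : {within `[0, +oo[, continuous (fun t => ip (u t) e)}.
  have cSu : {within `[0, +oo[, continuous
      (fun t => (Num.sqrt lam)^-1 * ip (S (u t)) e)}.
    move=> t; apply: cvgM; first exact: cvg_cst.
    by apply: (ip_cvg ipE); exact: (sol_u_continuous sol).
  apply/within_continuousP => t t0 eps eps0.
  have [d d0 dP] := (within_continuousP _ _).1 cSu t t0 eps eps0.
  exists d => // r r0 rt; have := dP r r0 rt.
  move: t0 r0; rewrite /= !in_itv /= !andbT => t0 r0.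
  rewrite !ipSe; [|exact: (sol_u_dom sol)|exact: (sol_u_dom sol)].
  by rewrite !mulKf ?gt_eqF.
(* As [eta u 0 s = u 0 - u (- s)], the past of the mode is read off [g], the Borel version of
   [ip (S (eta u 0 s)) e], divided by the eigenvalue of [S]. *)
pose U (t : R) := if 0 <= t then ip (u (0 + Order.max t 0)) e
  else ip (u 0) e - g (- t) / Num.sqrt lam.
have Up t : 0 <= t -> U t = ip (u t) e.
  by move=> t0; rewrite /U t0 add0r max_l.
have mU : measurable_fun [set: R] U.
  apply: measurable_fun_ifT.
  - by apply: measurable_fun_ler; [exact: measurable_cst|exact: measurable_id].
  - by apply: continuous_measurable_fun; exact: continuous_stopped cu.
  - apply: measurable_funB; first exact: measurable_cst.
    apply: measurable_funM; last exact: measurable_cst.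
    by apply: measurableT_comp => //; exact: measurable_funN.
have UE t : 0 <= t -> {ae leb, forall s, 0 < s -> 0 < mu s ->
    hist U t s = ip (Defs.eta u t s) e}.
  move=> t0; apply: ae_imply (ae_shift (- t) gE) => s gEs s0 mus.
  rewrite /hist /Defs.eta ipBl Up //; congr (_ - _).
  have [ts|ts] := leP 0 (t - s); first by rewrite Up.
  have st : 0 < s - t by lra.
  (* [g] represents the history only where the kernel is positive; monotonicity transfers positivity
     from [s] to the earlier lag [s - t]. *)
  have : 0 < mu (s - t).
    rewrite (lt_le_trans mus) // (kernel_nonincreasing adm) ?(ltW st) //.
    by rewrite gerBl.
  move=> /(conj st) /gEs; rewrite /Defs.eta ipBl sub0r opprB => h.
  by rewrite /U leNgt ts /= opprB -h opprB addrC subrK.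
have mh t : measurable_fun D (hist U t).
  apply: measurable_funB; first exact: measurable_cst.
  apply: measurableT_comp => //.
  by apply: measurable_funB => //; exact: measurable_cst.
(* Pointwise, [lam * ip (w s) e ^+ 2 = ip (S (w s)) e ^+ 2 <= |S (w s)| ^+ 2] since [|e| <= 1]. The
   larger integrand may fail to be measurable. *)
have bessel (f : R -> R) (w : R -> H) : measurable_fun D f ->
    {ae leb, forall s, 0 < s -> 0 < mu s -> opdom S (w s) /\ f s = ip (w s) e} ->
    (\int[leb]_(s in D) (mu s * (lam * f s ^+ 2))%:E <= sqnorm_mu mu S w)%E.
  move=> mf fw; apply: ge0_ae_le_integral_nomeasr => //.
  - apply/measurable_EFinP; apply: (measurable_wfun adm).
    by apply: measurable_funM; [exact: measurable_cst|exact: measurable_funX].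
  - move=> s; rewrite /= in_itv /= andbT => s0.
    by rewrite lee_fin mulr_ge0 ?sqr_ge0 // (kernel_ge0 adm) // ltW.
  - move=> s; rewrite /= in_itv /= andbT => s0.
    rewrite lee_fin mulr_ge0 ?(kernel_ge0 adm) ?(ltW s0) //.
    by rewrite mulr_ge0 ?sqr_ge0 // ltW.
  apply: ae_imply fw => s fw; rewrite /= in_itv /= andbT => s0.
  have := kernel_ge0 adm (ltW s0); rewrite le_eqVlt => /predU1P[<-|mus].
    by rewrite !mul0r.
  have [dw ->] := fw s0 mus; rewrite lee_fin ler_pM2l //.
  rewrite -[X in X * _](sqr_sqrtr (ltW lam0)) -exprMn -ipSe //; exact: ip_le.
have bound (f : R -> R) (w : R -> H) : measurable_fun D f ->
    {ae leb, forall s, 0 < s -> 0 < mu s -> opdom S (w s) /\ f s = ip (w s) e} ->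
    (sqnorm_mu mu S w < +oo)%E ->
    wL2 mu f /\ ((lam * wI mu (fun s => f s ^+ 2))%:E <= sqnorm_mu mu S w)%E.
  move=> mf fw wy; have le := bessel f w mf fw.
  have wf : wL2 mu f.
    have : wL2 mu (fun s => Num.sqrt lam * f s).
      apply: (wL2P adm).
        by apply: measurable_funM => //; exact: measurable_cst.
      apply: le_lt_trans wy; apply: le_trans le; apply: ge0_le_integral_nomeas.
        move=> s; rewrite /= in_itv /= andbT => s0.
        by rewrite lee_fin mulr_ge0 ?sqr_ge0 // (kernel_ge0 adm) // ltW.
      by move=> s _; rewrite exprMn sqr_sqrtr ?(ltW lam0).
    move=> /(wL2Z (Num.sqrt lam)^-1); congr wL2; apply/funext => s.
    by rewrite mulKf // gt_eqF.
  by split => //; rewrite -(wIZ lam wf.2) -wI_EFin //; exact/wintZ/wf.2.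
have etaE t : 0 <= t -> {ae leb, forall s, 0 < s -> 0 < mu s ->
    opdom S (Defs.eta u t s) /\ hist U t s = ip (Defs.eta u t s) e}.
  move=> t0; have [domt _ _] := sol_eta_L2mu sol t0.
  by apply: ae_imply2 domt (UE t t0) => s dom UEs s0 mus; split; [exact: dom|exact: UEs].
exists U; split => //; split => //.
- move=> t t0; have h := is_derive_ip ipE e (sol_velocity sol t0).
  apply: near_eq_is_derive h; near=> r; rewrite Up // ltW //.
  by near: r; exact: lt_nbhsr.
- apply/within_continuousP => t t0 eps eps0.
  have [d d0 dP] := (within_continuousP _ _).1 cu t t0 eps eps0.
  exists d => // r r0 rt; have := dP r r0 rt.
  by move: t0 r0; rewrite /= !in_itv /= !andbT => t0 r0; rewrite !Up.
- by move=> t; apply: (ip_cvg ipE); exact: (sol_v_continuous sol).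
- move=> t t0; have [_ _ fint] := sol_eta_L2mu sol t0.
  by have [] := bound _ _ (mh t) (etaE t t0) fint.
move=> t t0 eps eps0.
have el : 0 < lam * eps by rewrite mulr_gt0.
have nb : nbhs (0%E : \bar R) [set y | (y < (lam * eps)%:E)%E].
  by rewrite /nbhs /=; have := @lt_nbhsl R 0 _ el; apply: filterS => y; rewrite lte_fin.
have near_t : \forall r \near within `[0, +oo[ (nbhs t),
    (sqnorm_mu mu S (fun s => Defs.eta u r s - Defs.eta u t s)%R < (lam * eps)%:E)%E.
  exact: (sol_eta_continuous sol t0 nb).
move: near_t; rewrite near_withinE => -[d /= d0 dP].
exists d => // r r0 rt.
have {dP} : (sqnorm_mu mu S (fun s => Defs.eta u r s - Defs.eta u t s)%R <
    (lam * eps)%:E)%E.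
  by apply: dP => /=; [rewrite distrC|rewrite in_itv /= andbT].
move=> small.
have ae_rt : {ae leb, forall s, 0 < s -> 0 < mu s ->
    opdom S (Defs.eta u r s - Defs.eta u t s) /\
    hist U r s - hist U t s = ip (Defs.eta u r s - Defs.eta u t s) e}.
  apply: ae_imply2 (etaE r r0) (etaE t t0) => s hr ht s0 mus.
  have [dr ->] := hr s0 mus; have [dt ->] := ht s0 mus.
  split; last by rewrite (ipBl _ (Defs.eta u r s)).
  have [[_ Slin] _ _] := Sadj.
  have [+ _] := Slin (-1) _ _ dt dr.
  by rewrite scaleN1r addrC.
have [|_ le] := bound _ _ (measurable_funB (mh r) (mh t)) ae_rt.
  by rewrite (lt_trans small) // ltry.
have := le_lt_trans le small; rewrite lte_fin ltr_pM2l //.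
Unshelve. all: by end_near. Qed.

End mode_of_solution.

(** * The scalar equation satisfied by a mode *)

Section mode_equation.
Context (R : realType) (H : completeNormedModType R) (ip : {dot H for @idfun R}).
Context (A S : operator H) (mu : R -> R) (tau : R) (adm : admissible_kernel mu).
Context (Sadj : self_adjoint ip S).
Context (b : R -> R) (u0 : R -> H) (v0 : H) (u v : R -> H).
Context (sol : is_solution ip A S mu tau b u0 v0 u v).
Context (lam : R) (e : H).
Context (lam0 : 0 < lam) (Se : opdom S e) (SeE : S e = Num.sqrt lam *: e).
Local Notation leb := (@lebesgue_measure R).
Local Notation D := (`]0, +oo[%classic : set R).
Context (U : R -> R) (UV : trajectory mu U (fun t => ip (v t) e)).
Context (Up : forall t, 0 <= t -> U t = ip (u t) e).
Context (UE : forall t, 0 <= t -> {ae leb, forall s, 0 < s -> 0 < mu s ->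
   hist U t s = ip (Defs.eta u t s) e}).

Lemma ip_sqrt_eigenvector x : opdom S x -> ip (S x) (S e) = lam * ip x e.
Proof.
move=> Sx; rewrite SeE ipZr (self_adjoint_sym Sadj) // SeE ipZr mulrA -expr2.
by rewrite sqr_sqrtr // ltW.
Qed.

(** The wave equation holds almost everywhere and in integrated form, so it is used through a
    comparison of the velocity with an affine function of slope [G]. The left end is positive
    because weak derivatives live on the open half-line. *)
Lemma mode_velocity_increment (a c G k : R) : 0 < a -> a <= c ->
    (forall r, a < r -> r < c ->
       `|mode_force mu lam U r - b r * ip (v (r - tau)) e - G| <= k) ->
  `|ip (v c) e - ip (v a) e - (c - a) * G| <= k * (c - a).
Proof.
move=> a0; rewrite le_eqVlt => /predU1P[<- _|ac bound].
  by rewrite !subrr mul0r subr0 normr0 mulr0.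
have [utt [wd uttE]] := sol_wave sol.
have [[mg og lg] vE] := wd e Se.
rewrite (vE a c a0 (ltW ac)).
set g := utt^~ e in mg lg *.
have gE : {ae leb, forall r, a <= r <= c -> `|g r - G| <= k}.
  have aeN (x : R) : {ae leb, forall r, r != x}.
    exists [set x]; split; [exact: measurable_set1|exact: lebesgue_measure_set1|].
    by move=> r /= /negP; rewrite negbK => /eqP.
  apply: ae_imply2 (aeN c) (ae_imply2 (fun _ x y => conj x y) (aeN a) uttE).
  move=> r rc [ra rE] /andP[ar rc'].
  have r0 : 0 < r by exact: lt_le_trans ar.
  suff -> : g r = mode_force mu lam U r - b r * ip (v (r - tau)) e.
    by apply: bound; rewrite lt_neqAle ?ar ?rc' ?andbT // eq_sym.
  rewrite /g rE // ipNl ipZl (ip_sqrt_eigenvector (sol_u_dom sol (ltW r0))).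
  rewrite -Up ?(ltW r0) //.
  have -> : \int[leb]_(s in D) (mu s * ip (S (Defs.eta u r s)) (S e)) =
      lam * wI mu (hist U r).
    have wr := wL2_wint adm (traj_wL2 UV (ltW r0)).
    rewrite -(wIZ lam wr) /wI /Rintegral; congr fine.
    apply: ae_eq_integral_nomeas; first exact: measurable_itv.
      apply/measurable_EFinP; apply: (measurable_wfun adm).
      apply: measurable_funM; first exact: measurable_cst.
      exact: measurable_hist UV _.
    have [dom _ _] := sol_eta_L2mu sol (ltW r0).
    apply: ae_imply2 dom (UE (ltW r0)) => s dom hE.
    rewrite /= in_itv /= andbT => s0; congr EFin.
    have := kernel_ge0 adm (ltW s0); rewrite le_eqVlt => /predU1P[<-|mus].
      by rewrite !mul0r.
    by rewrite hE // ip_sqrt_eigenvector //; exact: dom.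
  by rewrite /mode_force; ring.
have mac : measurable (`[a, c]%classic : set (measurableTypeR R)).
  exact: measurable_itv.
have acD : `[a, c] `<=` D.
  move=> x /=; rewrite !in_itv /= andbT => /andP[ax _]; exact: lt_le_trans ax.
have ig : leb.-integrable `[a, c] (EFin \o g).
  apply/integrableP; split; last by apply: lg => //; exact: segment_compact.
  by apply/measurable_EFinP; apply: measurable_funS mg.
have iG : leb.-integrable `[a, c] (EFin \o (fun=> G)).
  apply: continuous_compact_integrable; first exact: segment_compact.
  by apply: continuous_subspaceT; exact: cst_continuous.
have -> : (c - a) * G = \int[leb]_(r in `[a, c]) (fun=> G) r.
  by rewrite Rintegral_cst //= lebesgue_measure_itv /= lte_fin ac mulrC.
rewrite -RintegralB //.
have igG : leb.-integrable `[a, c] (EFin \o (fun r => g r - G)).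
  exact: (integrableB mac ig iG).
apply: le_trans (le_normr_Rintegral _ igG) _ => //.
have k0 : 0 <= k.
  by apply: le_trans (normr_ge0 _) (bound ((a + c) / 2) _ _); lra.
have inG : leb.-integrable `[a, c] (EFin \o (fun r => `|g r - G|)).
  by have := integrable_norm igG.
rewrite -lee_fin /Rintegral fineK; last exact: integrable_fin_num.
have -> : (k * (c - a))%:E = (\int[leb]_(r in `[a, c]) cst k%:E r)%E.
  by rewrite integral_cst //= lebesgue_measure_itv /= lte_fin ac -EFinB -EFinM.
apply: ae_ge0_le_integral => //.
by have /integrableP[] := inG.
Qed.

Lemma mode_force_near t : 0 <= t -> forall eps, 0 < eps ->
  exists2 d : R, 0 < d & forall r, 0 <= r -> `|r - t| < d ->
    `|mode_force mu lam U r - mode_force mu lam U t| < eps.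
Proof.
move=> t0 eps eps0.
have cF := @mode_force_continuous _ _ adm _ _ UV lam.
have [||d d0 dP] := (within_continuousP _ _).1 cF t _ eps.
- by rewrite /= in_itv /= andbT.
- exact: eps0.
by exists d => // r r0; apply: dP; rewrite /= in_itv /= andbT.
Qed.

Lemma mode_velocity_dini (p q k : R) : 0 <= p -> 
    (forall r, p < r -> r < q -> `|b r * ip (v (r - tau)) e| <= k) ->
  forall t, p <= t -> t < q -> forall eps, 0 < eps ->
    exists2 d : R, 0 < d & forall h, 0 < h -> h < d ->
    `|ip (v (t + h)) e - ip (v t) e - h * mode_force mu lam U t| <= (k + eps) * h.
Proof.
move=> p0 bk t pt tq eps eps0.
have t0 : 0 <= t by exact: le_trans pt.
have [d d0 dP] := mode_force_near t0 eps0.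
exists (Order.min d (q - t)); first by rewrite lt_min d0 subr_gt0.
move=> h h0; rewrite lt_min => /andP[hd hq].
set G := mode_force mu lam U t.
(* The increment estimate needs a positive left end, but [t = 0] is allowed: it is applied from some
   [a > t], and continuity of the velocity then lets [a] tend to [t]. *)
have inc a : t < a -> a <= t + h ->
    `|ip (v (t + h)) e - ip (v a) e - (t + h - a) * G| <= (k + eps) * (t + h - a).
  move=> ta ah; apply: mode_velocity_increment => //.
    exact: le_lt_trans ta.
  move=> r ar rth.
  rewrite [X in `|X|](_ : _ = - (b r * ip (v (r - tau)) e) +
    (mode_force mu lam U r - G)); last by ring.
  rewrite (le_trans (ler_normD _ _)) // normrN lerD //.
    by apply: bk; lra.
  apply/ltW/dP; first by lra.
  by rewrite ger0_norm; lra.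
apply/ler_addgt0Pr => eta eta0.
have [||d' d'0 d'P] := (within_continuousP _ _).1 (traj_V_continuous UV) t _ (eta / 2).
- by rewrite /= in_itv /= andbT.
- by rewrite divr_gt0.
have G1 : 0 < `|G| + 1 by rewrite ltr_wpDl.
have del0 : 0 < Order.min (Order.min d' h) (eta / 2 / (`|G| + 1)).
  by rewrite !lt_min d'0 h0 !divr_gt0.
set del := Order.min _ _ in del0.
pose a := t + del / 2.
have : del <= Order.min d' h by rewrite ge_min lexx.
rewrite le_min => /andP[deld' delh].
have delG : del * `|G| <= eta / 2.
  have : del <= eta / 2 / (`|G| + 1) by rewrite ge_min lexx orbT.
  rewrite ler_pdivlMr // => h1; apply: le_trans h1.
  by rewrite ler_wpM2l ?lerDl // ltW.
have ta : t < a by rewrite /a; lra.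
have ah : a <= t + h by rewrite /a; lra.
have k0 : 0 <= k.
  by apply: le_trans (normr_ge0 _) (bk ((t + q) / 2) _ _); lra.
have := inc a ta ah.
have : `|ip (v a) e - ip (v t) e| < eta / 2.
  apply: d'P; first by rewrite /= in_itv /= andbT; lra.
  by rewrite ger0_norm /a; lra.
have : `|(a - t) * G| <= eta / 2.
  rewrite normrM gtr0_norm; last by rewrite subr_gt0.
  by apply: le_trans delG; rewrite ler_wpM2r // /a; lra.
rewrite [ip (v (t + h)) e - ip (v t) e - h * G](_ : _ =
  (ip (v (t + h)) e - ip (v a) e - (t + h - a) * G) +
  (ip (v a) e - ip (v t) e - (a - t) * G)); last by ring.
move=> h1 h2 h3; rewrite (le_trans (ler_normD _ _)) // lerD //; last first.
  rewrite (le_trans (ler_normB _ _)) //.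
  by move: h2 => /ltW h2; lra.
apply: le_trans h3 _; rewrite ler_wpM2l //; first by rewrite addr_ge0 // ltW.
by rewrite lerBlDr; lra.
Qed.

Lemma mode_velocity_derive (p q : R) : 0 <= p ->
    (forall r, p < r -> r < q -> b r = 0) ->
  forall t : R, p < t -> t < q ->
    is_derive t 1 (fun t => ip (v t) e) (mode_force mu lam U t).
Proof.
move=> p0 b0 t pt tq; apply: is_derive_cvg.
have t0 : 0 < t by exact: le_lt_trans pt.
set G := mode_force mu lam U t.
apply/cvgrPdist_le => eps eps0.
have [d d0 dP] := mode_force_near (ltW t0) eps0.
have d1 : 0 < Order.min d (Order.min (t - p) (q - t)).
  by rewrite !lt_min d0 !subr_gt0 pt.
have inc a c : p < a -> a < c -> c < q -> a <= t -> t <= c -> c - a < d ->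
    `|ip (v c) e - ip (v a) e - (c - a) * G| <= eps * (c - a).
  move=> pa ac cq at_ tc cad; apply: mode_velocity_increment; rewrite ?(ltW ac) //.
    exact: le_lt_trans pa.
  move=> r ar rc; rewrite b0 ?mul0r ?subr0; [|lra|lra].
  apply/ltW/dP; first lra.
  by rewrite ltr_norml; apply/andP; split; lra.
near=> h.
have h0 : h != 0 by near: h; exact: nbhs_dnbhs_neq.
have : `|h| < Order.min d (Order.min (t - p) (q - t)).
  by near: h; exact: dnbhs0_lt.
rewrite !lt_min => /and3P[hd hp hq].
rewrite (_ : h *: 1 = h); last exact: mulr1.
have hn : 0 < `|h| by rewrite normr_gt0.
rewrite -(ler_pM2r hn) -normrM /GRing.scale /=.
rewrite [X in `|X|](_ : _ = - (ip (v (h + t)) e - ip (v t) e - h * G)).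
  rewrite normrN; have [h1|h1] := ltP 0 h.
    have := inc t (h + t); rewrite addrK (gtr0_norm h1); apply; try lra.
    - by move: hq; rewrite (gtr0_norm h1); lra.
    - by move: hd; rewrite (gtr0_norm h1).
  have {}h1 : h < 0 by rewrite lt_neqAle h0.
  have := inc (h + t) t; rewrite opprD addrCA subrr addr0 (ltr0_norm h1) => it.
  rewrite [X in `|X|](_ : _ = - (ip (v t) e - ip (v (h + t)) e - - h * G)).
    rewrite normrN; apply: it; try lra.
    - by move: hp; rewrite (ltr0_norm h1); lra.
    - by move: hd; rewrite (ltr0_norm h1).
  by ring.
by field.
Unshelve. all: by end_near. Qed.

End mode_equation.

(** * Decay *)

Section mode_congruence.
Context (R : realType) (mu : R -> R) (lam : R).
Implicit Types U V W : R -> R.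

Lemma eq_wI_hist (f : R -> R) U W T t : (forall r, r <= T -> W r = U r) ->
  t <= T -> wI mu (fun s => f (hist W t s)) = wI mu (fun s => f (hist U t s)).
Proof.
move=> WU tT; rewrite /wI; apply: eq_Rintegral => s.
rewrite inE /= in_itv /= andbT => s0; rewrite /hist !WU //.
by rewrite (le_trans _ tT) // gerBl ltW.
Qed.

Lemma eq_mode_force U W T t : (forall r, r <= T -> W r = U r) -> t <= T ->
  mode_force mu lam W t = mode_force mu lam U t.
Proof. by move=> WU tT; rewrite /mode_force WU // (eq_wI_hist id WU tT). Qed.

Lemma eq_mode_energy U V W W' T t : (forall r, r <= T -> W r = U r) ->
  (forall r, r <= T -> W' r = V r) -> t <= T ->
  mode_energy mu lam W W' t = mode_energy mu lam U V t.
Proof.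
move=> WU WV tT; rewrite /mode_energy WU // WV //.
by rewrite (eq_wI_hist (fun x => x ^+ 2) WU tT).
Qed.

Lemma hist_shift U p t : hist (fun t => U (t + p)) t = hist U (t + p).
Proof. by apply/funext => s; rewrite /hist addrAC. Qed.

Lemma mode_force_shift U p t :
  mode_force mu lam (fun t => U (t + p)) t = mode_force mu lam U (t + p).
Proof. by rewrite /mode_force hist_shift. Qed.

Lemma mode_energy_shift U V p t :
  mode_energy mu lam (fun t => U (t + p)) (fun t => V (t + p)) t =
  mode_energy mu lam U V (t + p).
Proof. by rewrite /mode_energy hist_shift. Qed.

End mode_congruence.

Section mode_decay.
Context (R : realType) (H : completeNormedModType R) (ip : {dot H for @idfun R}).
Context (A S : operator H) (mu : R -> R) (tau : R) (adm : admissible_kernel mu).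
Context (Sadj : self_adjoint ip S).
Context (b : R -> R) (u0 : R -> H) (v0 : H) (u v : R -> H).
Context (sol : is_solution ip A S mu tau b u0 v0 u v).
Context (lam : R) (e : H).
Context (lam0 : 0 < lam) (Se : opdom S e) (SeE : S e = Num.sqrt lam *: e).
Local Notation leb := (@lebesgue_measure R).
Context (U : R -> R) (UV : trajectory mu U (fun t => ip (v t) e)).
Context (Up : forall t, 0 <= t -> U t = ip (u t) e).
Context (UE : forall t, 0 <= t -> {ae leb, forall s, 0 < s -> 0 < mu s ->
   hist U t s = ip (Defs.eta u t s) e}).
Context (C alpha : R) (decay : decay_constants ip A S mu tau C alpha).

Local Notation E := (mode_energy mu lam U (fun t => ip (v t) e)).

Let E_ge0 t : 0 <= E t.
Proof. by apply: mode_energy_ge0 => //; exact: ltW. Qed.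

Let V_dini := mode_velocity_dini adm Sadj sol lam0 Se SeE UV Up UE.
Let V_derive := mode_velocity_derive adm Sadj sol lam0 Se SeE UV Up UE.

Lemma mode_energy_delay (p q beta E0 : R) : 0 <= p -> p <= q -> 0 <= beta ->
    0 <= E0 -> (forall r, p < r -> r < q -> `|b r| <= beta) ->
    (forall r, p < r -> r < q -> ip (v (r - tau)) e ^+ 2 <= 2 * E0) ->
  E q + E0 <= expR (beta * (q - p)) * (E p + E0).
Proof.
move=> p0 pq beta0 E00 bb vb.
apply: mode_energy_growth => //; first exact: ltW.
apply: V_dini => // r pr rq; rewrite normrM ler_pM ?bb //.
rewrite -sqrtr_sqr ler_wsqrtr //; exact: vb.
Qed.

Lemma mode_energy_nonincreasing (p q : R) : 0 <= p -> p <= q ->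
    (forall r, p < r -> r < q -> b r = 0) -> E q <= E p.
Proof.
move=> p0 pq b0.
have := @mode_energy_growth _ _ adm _ _ UV lam p q 0 0 (ltW lam0) p0 pq (lexx _) (lexx _).
rewrite !mul0r expR0 mul1r !addr0; apply => t pt tq eps eps0.
by apply: (V_dini (q := q) p0) => // r pr rq; rewrite b0 // mul0r normr0.
Qed.

(* The constants [C, alpha] only speak about global undelayed solutions, so the
   restriction of the mode to [p, q] is first extended to such a solution. *)
Lemma mode_energy_free_decay (p q : R) : `|e| = 1 -> 0 <= p -> p <= q ->
    (forall r, p < r -> r < q -> b r = 0) ->
  E q <= C * expR (- (alpha * (q - p))) * E p.
Proof.
move=> e1 p0 pq b0.
have UV1 := trajectory_shift p0 UV.
have T0 : 0 <= q - p by rewrite subr_ge0.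
have [W [W' [WW WU WV dW]]] := extension adm (ltW lam0) T0 UV1.
set T := q - p in T0 WU WV dW *.
have cF := @mode_force_continuous _ _ adm _ _ WW lam.
have itvS a c : 0 <= a -> `[a, c]%classic `<=` (`[0, +oo[%classic : set R).
  by move=> a0 x /=; rewrite !in_itv /= andbT => /andP[ax _]; exact: le_trans ax.
have ftc a c : 0 <= a -> a <= c ->
    (forall x : R, a < x -> x < c -> is_derive x 1 W' (mode_force mu lam W x)) ->
    W' c - W' a = \int[leb]_(r in `[a, c]) mode_force mu lam W r.
  move=> a0 ac d; apply: FTC_within => //.
    exact: continuous_subspaceW (itvS a c a0) (traj_V_continuous WW).
  exact: continuous_subspaceW (itvS a c a0) cF.
have dV t : 0 < t -> t < T -> is_derive t 1 W' (mode_force mu lam W t).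
  move=> t0 tT; rewrite (eq_mode_force _ _ WU (ltW tT)) mode_force_shift.
  have h1 : is_derive (t + p) 1 (fun t => ip (v t) e) (mode_force mu lam U (t + p)).
    by apply: (V_derive p0 b0); rewrite /T in tT; lra.
  have h2 : is_derive t 1 (fun t : R => t + p) 1.
    by apply: is_derive_eq; rewrite addr0.
  have := @is_derive1_comp _ (fun t => ip (v t) e) (fun t => t + p) t _ _ h1 h2.
  rewrite mulr1; apply: near_eq_is_derive; near=> r.
  by rewrite WV //; apply: ltW; near: r; exact: lt_nbhsl.
(* [W'] is known to be differentiable on either side of [T] but not at [T], so an integral across
   [T] is split there. *)
have wave a c : 0 <= a -> a <= c ->
    W' c - W' a = \int[leb]_(r in `[a, c]) mode_force mu lam W r.
  move=> a0 ac; have [cT|Tc] := leP c T.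
    by apply: ftc => // x ax xc; apply: dV; lra.
  have [Ta|aT] := leP T a.
    by apply: ftc => // x ax xc; apply: dW; lra.
  have i : leb.-integrable `[a, c] (EFin \o mode_force mu lam W).
    apply: continuous_compact_integrable; first exact: segment_compact.
    exact: continuous_subspaceW (itvS a c a0) cF.
  have := Rintegral_itvB (x := T) i.
  rewrite !bnd_simp (ltW aT) (ltW Tc) => /(_ isT isT).
  have d1 x : a < x -> x < T -> is_derive x 1 W' (mode_force mu lam W x).
    by move=> ax xT; apply: dV; lra.
  have d2 x : T < x -> x < c -> is_derive x 1 W' (mode_force mu lam W x).
    by move=> Tx _; exact: dW.
  rewrite -(ftc a T a0 (ltW aT) d1).
  rewrite Rintegral_itv_obnd_cbnd; last first.
    by apply: integrableS i => //; apply: subset_itvr; rewrite bnd_simp ltW.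
  rewrite -(ftc T c T0 (ltW Tc) d2).
  lra.
have [Slin _ _] := Sadj.
have sW := mode_solution A tau adm lam0 Slin (self_adjoint_sym Sadj) Se SeE e1
  WW wave.
have [_ _ dec] := decay; have := dec _ _ _ _ sW T T0.
rewrite !(energy_mode lam0 Slin Se SeE e1 WW) //.
rewrite !(eq_mode_energy _ _ WU WV) //.
rewrite !(mode_energy_shift _ _ U (fun t => ip (v t) e)) add0r.
by rewrite /T subrK.
Unshelve. all: by end_near. Qed.

Context (tm beta : nat -> R) (bonoff : on_off b tm beta).
Context (odd_short : forall n, step tm n.*2.+1 <= tau).
Context (even_long : forall n, tau <= step tm n.*2).

Local Notation c n := (C * expR (- (alpha * step tm n.*2))).
Local Notation x n := (beta n.*2.+1 * step tm n.*2.+1).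
Local Notation gain n := (expR (x n) * (c n + 1 - expR (- x n))).

Let tm_ge0 n : 0 <= tm n.
Proof.
have [t0 tS _ _ _] := bonoff.
by elim: n => [|n IH]; [rewrite t0|rewrite (le_trans IH) // ltW].
Qed.

Lemma mode_energy_off (n : nat) (t : R) : tm n.*2 <= t -> t <= tm n.*2.+1 ->
  E t <= E (tm n.*2).
Proof.
move=> nt tn; have [_ _ _ b0 _] := bonoff.
apply: mode_energy_nonincreasing => // r nr rt; apply: (b0 n).
by rewrite (ltW nr) (lt_le_trans rt).
Qed.

Lemma mode_energy_on (n : nat) (t : R) : `|e| = 1 ->
    tm n.*2.+1 <= t -> t <= tm n.*2.+2 ->
  E t <= gain n * E (tm n.*2).
Proof.
move=> e1 nt tn; have [_ tS beta0 b0 bb] := bonoff.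
set E0 := E (tm n.*2).
have bn0 : 0 <= beta n.*2.+1 by rewrite ltW.
have := odd_short n; have := even_long n; rewrite /step => even odd.
have E1 : E (tm n.*2.+1) <= c n * E0.
  apply: mode_energy_free_decay => //; first by rewrite ltW.
  by move=> r pr rq; apply: (b0 n); rewrite (ltW pr).
have := @mode_energy_delay (tm n.*2.+1) t (beta n.*2.+1) E0
  (tm_ge0 _) nt bn0 (E_ge0 _).
have bb' r : tm n.*2.+1 < r -> r < t -> `|b r| <= beta n.*2.+1.
  by move=> pr rq; apply/ltW/bb; rewrite (ltW pr) (lt_le_trans rq).
(* [even] gives [tm n.*2 <= r - tau] and [odd] gives [r - tau <= tm n.*2.+1]. *)
have vb r : tm n.*2.+1 < r -> r < t -> ip (v (r - tau)) e ^+ 2 <= 2 * E0.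
  move=> pr rq; have := velocity_le_mode_energy adm U (fun t => ip (v t) e) (r - tau) (ltW lam0).
  move=> /le_trans; apply.
  by rewrite ler_pM2l //; apply: mode_energy_off; lra.
move=> /(_ bb' vb) growth.
have : expR (beta n.*2.+1 * (t - tm n.*2.+1)) * (E (tm n.*2.+1) + E0) <=
    expR (x n) * (c n * E0 + E0).
  apply: ler_pM (expR_ge0 _) (addr_ge0 (E_ge0 _) (E_ge0 _)) _ _.
    by rewrite ler_expR ler_wpM2l // lerB.
  by rewrite lerD2r.
have -> : gain n * E0 = expR (x n) * (c n * E0 + E0) - E0.
  rewrite mulrBr -expRD subrr expR0; ring.
move: growth; lra.
Qed.

(** On the off interval of period [n] only the earlier gains count; on its on interval [gain n] is
    included. A single gain may be on either side of 1, hence the maximum. *)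
Lemma mode_energy_gain (n : nat) (t : R) : `|e| = 1 -> (forall n, 0 <= gain n) ->
    tm n.*2 <= t -> t <= tm n.*2.+2 ->
  E t <= Order.max (\prod_(0 <= k < n) gain k) (\prod_(0 <= k < n.+1) gain k) * E 0.
Proof.
move=> e1 g0 nt tn; have [t0 tS _ _ _] := bonoff.
have prod0 j : 0 <= \prod_(0 <= k < j) gain k by apply: prodr_ge0.
have En j : E (tm j.*2) <= \prod_(0 <= k < j) gain k * E 0.
  elim: j => [|j IH]; first by rewrite big_geq // mul1r t0.
  rewrite big_nat_recr //= (mulrC _ (gain j)) -mulrA.
  apply: le_trans (ler_wpM2l (g0 j) IH).
  by rewrite doubleS; apply: mode_energy_on => //; rewrite ltW.
have [tn1|tn1] := leP t (tm n.*2.+1).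
  apply: le_trans (mode_energy_off nt tn1) _; apply: le_trans (En n) _.
  by rewrite ler_wpM2r // le_max lexx.
apply: le_trans (mode_energy_on e1 (ltW tn1) tn) _.
apply: le_trans (ler_wpM2l (g0 n) (En n)) _.
rewrite mulrA ler_wpM2r // le_max mulrC [in X in _ || X]big_nat_recr //=.
by rewrite lexx orbT.
Qed.

End mode_decay.

(** * The energy as the sum of the energies of the modes *)

Section energy_series.
Context (R : realType) (H : completeNormedModType R) (ip : {dot H for @idfun R}).
Context (ipE : dot_induces_norm ip).
Context (A S : operator H) (mu : R -> R) (tau : R) (adm : admissible_kernel mu).
Context (Sadj : self_adjoint ip S).
Context (b : R -> R) (u0 : R -> H) (v0 : H) (u v : R -> H).
Context (sol : is_solution ip A S mu tau b u0 v0 u v).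
Context (lam : nat -> R) (e : nat -> H).
Context (lam0 : forall k, 0 < lam k).
Context (Se : forall k, opdom S (e k) /\ S (e k) = Num.sqrt (lam k) *: e k).
Context (e1 : forall k, e k != 0 -> `|e k| = 1).
Context (eo : forall j k, j != k -> ip (e j) (e k) = 0).
Context (e_total : forall x, (forall k, ip x (e k) = 0) -> x = 0).
Local Notation leb := (@lebesgue_measure R).
Local Notation D := (`]0, +oo[%classic : set R).
Context (U : nat -> R -> R).
Context (wU : forall k t, 0 <= t -> wL2 mu (hist (U k) t)).
Context (Up : forall k t, 0 <= t -> U k t = ip (u t) (e k)).
Context (UE : forall k t, 0 <= t -> {ae leb, forall s, 0 < s -> 0 < mu s ->
   hist (U k) t s = ip (Defs.eta u t s) (e k)}).

Let S_parseval x : opdom S x ->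
  \sum_(0 <= k < n) lam k * ip x (e k) ^+ 2 @[n --> \oo] --> `|S x| ^+ 2.
Proof.
move=> Sx; have := @parseval _ _ _ ipE e (S x) e1 eo e_total.
apply: cvg_trans; apply: near_eq_cvg; apply: nearW => n; apply: eq_bigr => k _.
have [Sk SkE] := Se k.
by rewrite (self_adjoint_sym Sadj) // SkE ipZr exprMn sqr_sqrtr // ltW.
Qed.

(** Parseval for [S (eta u t s)] at almost every lag with [mu s > 0], then termwise integration of a
    nonnegative series. Where [mu] vanishes both sides are 0. The Borel series serves as the
    measurable side of the comparison. *)
Let hist_parseval t : 0 <= t ->
  \sum_(0 <= k < n) lam k * wI mu (fun s => hist (U k) t s ^+ 2) @[n --> \oo] -->
  fine (sqnorm_mu mu S (Defs.eta u t)).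
Proof.
move=> t0; have [dom _ fin] := sol_eta_L2mu sol t0.
pose f k s := (mu s * (lam k * hist (U k) t s ^+ 2))%:E.
have mf k : measurable_fun (D : set (measurableTypeR R)) (f k).
  apply/measurable_EFinP; apply: (measurable_wfun adm).
  apply: measurable_funM; first exact: measurable_cst.
  exact: measurable_funX (wU k t0).1.
have f0 k s : D s -> (0 <= f k s)%E.
  rewrite /= in_itv /= andbT => s0; rewrite lee_fin mulr_ge0 //.
    by rewrite (kernel_ge0 adm) // ltW.
  by rewrite mulr_ge0 ?sqr_ge0 // ltW.
have sqE : sqnorm_mu mu S (Defs.eta u t) =
    (\sum_(k <oo) (lam k * wI mu (fun s => hist (U k) t s ^+ 2))%:E)%E.
  transitivity (\int[leb]_(s in D) (\sum_(k <oo) f k s))%E; last first.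
    rewrite integral_nneseries //.
    apply: eq_eseriesr => k _.
    by rewrite -(wIZ _ (wU k t0).2) -wI_EFin //; exact/wintZ/(wU k t0).2.
  apply: ge0_ae_eq_integral_nomeas; first exact: measurable_itv.
  - apply: (ge0_emeasurable_sum (P := xpredT)) => [k s Ds _|k _]; last exact: mf.
    exact: f0.
  - move=> s; rewrite /= in_itv /= andbT => s0; rewrite lee_fin.
    by rewrite mulr_ge0 ?sqr_ge0 // (kernel_ge0 adm) // ltW.
  - by move=> s Ds; apply: nneseries_ge0 => k _ _; exact: f0.
  apply: ae_imply2 dom (ae_foralln (fun k => UE k t0)) => s dom UEs.
  rewrite /= in_itv /= andbT => s0.
  have := kernel_ge0 adm (ltW s0); rewrite le_eqVlt => /predU1P[mus|mus].
    by rewrite /f -mus mul0r eseries0 // => k _ _; rewrite mul0r.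
  apply/esym/cvg_lim => //.
  rewrite (_ : (fun n => _) = (fun n => (mu s *
      \sum_(0 <= k < n) lam k * ip (Defs.eta u t s) (e k) ^+ 2)%:E)).
    apply: cvg_EFin; first exact: nearW.
    apply: cvgM; first exact: cvg_cst.
    by apply: S_parseval; exact: dom.
  apply/funext => n; rewrite mulr_sumr -sumEFin; apply: eq_bigr => k _.
  by rewrite /f UEs.
have /fine_cvgP[_] : (\sum_(0 <= k < n)
    (lam k * wI mu (fun s => hist (U k) t s ^+ 2))%:E)%E @[n --> \oo] -->
    (fine (sqnorm_mu mu S (Defs.eta u t)))%:E.
  rewrite fineK; last first.
    rewrite ge0_fin_numE //; apply: integral_ge0 => s.
    rewrite /= in_itv /= andbT => s0.
    by rewrite lee_fin mulr_ge0 ?sqr_ge0 // (kernel_ge0 adm) // ltW.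
  rewrite sqE; apply: is_cvg_nneseries => k _ _; rewrite lee_fin mulr_ge0 ?(ltW (lam0 k)) //.
  by apply: (wI_ge0 adm) => s _; exact: sqr_ge0.
apply: cvg_trans; apply: near_eq_cvg; apply: nearW => n /=.
by rewrite sumEFin.
Qed.

Lemma energy_series t : 0 <= t ->
  \sum_(0 <= k < n) mode_energy mu (lam k) (U k) (fun t => ip (v t) (e k)) t
    @[n --> \oo] --> energy S mu u v t.
Proof.
move=> t0; rewrite /energy.
have h1 := @parseval _ _ _ ipE e (v t) e1 eo e_total.
have h2 := S_parseval (sol_u_dom sol t0).
have h3 := hist_parseval t0.
rewrite (_ : (fun n => _) = (fun n =>
    2^-1 * \sum_(0 <= k < n) ip (v t) (e k) ^+ 2 +
    (1 - kernel_mass mu) / 2 * \sum_(0 <= k < n) lam k * ip (u t) (e k) ^+ 2 +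
    2^-1 * \sum_(0 <= k < n) lam k * wI mu (fun s => hist (U k) t s ^+ 2))).
  by apply: cvgD; [apply: cvgD|]; apply: cvgMl_tmp.
apply/funext => n; rewrite !mulr_sumr -!big_split; apply: eq_bigr => k _ /=.
by rewrite /mode_energy Up //; ring.
Qed.

End energy_series.

Section on_off_times.
Context (R : realType) (b : R -> R) (tm beta : nat -> R) (tau : R).
Context (bonoff : on_off b tm beta) (tau0 : 0 < tau).
Context (even_long : forall n, tau <= step tm n.*2).

Lemma on_off_times_le m n : (m <= n)%N -> tm m <= tm n.
Proof.
have [_ tS _ _ _] := bonoff; elim: n => [|n IH]; first by rewrite leqn0 => /eqP ->.
by rewrite leq_eqVlt ltnS => /predU1P[->//|/IH /le_trans]; apply; exact: ltW.
Qed.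

(** Every off interval has length at least [tau > 0], so the switching times cannot accumulate. *)
Lemma on_off_times_unbounded t : exists n, t < tm n.*2.
Proof.
have [t0 tS _ _ _] := bonoff.
have h n : n%:R * tau <= tm n.*2.
  elim: n => [|n IH]; first by rewrite mul0r t0.
  rewrite -natr1 mulrDl mul1r doubleS.
  have := even_long n; have := tS n.*2.+1; rewrite /step; lra.
exists (Num.truncn (`|t| / tau)).+1; apply: lt_le_trans (h _).
rewrite -ltr_pdivrMr // (le_lt_trans _ (truncnS_gt _)) //.
by rewrite ler_pM2r ?invr_gt0 // ler_norm.
Qed.

Lemma on_off_period N t : tm N.*2 <= t ->
  exists2 n, (N <= n)%N & tm n.*2 <= t <= tm n.*2.+2.
Proof.
(* The period sought is the predecessor of the least [m] with [t < tm m.*2]; this [m] is positive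
   because [m > N]. *)
move=> Nt; case: (ex_minnP (on_off_times_unbounded t)) => m tm_m min_m.
have Nm : (N < m)%N.
  rewrite ltnNge; apply/negP => mN.
  have : tm m.*2 <= tm N.*2 by apply: on_off_times_le; rewrite leq_double.
  lra.
case: m Nm tm_m min_m => // n Nn tn min_n; exists n => //.
rewrite -doubleS (ltW tn) andbT leNgt; apply/negP => nt.
by have := min_n n nt; rewrite ltnn.
Qed.

End on_off_times.

Lemma prod_lt_of_sum_ln (R : realType) (g : nat -> R) (M eps : R) :
    (forall n, 0 < g n) -> 0 <= M -> 0 < eps ->
    \sum_(0 <= k < n) ln (g k) @[n --> \oo] --> -oo ->
  exists N, forall n, (N <= n)%N -> \prod_(0 <= k < n) g k * M < eps.
Proof.
move=> g0 M0 eps0 gNy.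
have gE n : \prod_(0 <= k < n) g k = expR (\sum_(0 <= k < n) ln (g k)).
  elim: n => [|n IH]; first by rewrite !big_geq // expR0.
  by rewrite !big_nat_recr //= expRD -IH lnK // posrE.
have M1 : 0 < M + 1 by rewrite ltr_wpDl.
have e1 : 0 < eps / (M + 1) by rewrite divr_gt0.
have [N _ NP] := cvgrNy_lt gNy (ln (eps / (M + 1))).
exists N => n Nn.
have : expR (\sum_(0 <= k < n) ln (g k)) < expR (ln (eps / (M + 1))).
  by rewrite ltr_expR; exact: NP.
rewrite -gE lnK ?posrE // ltr_pdivlMr // => h.
by apply: le_lt_trans h; rewrite ler_wpM2l ?lerDl // gE expR_ge0.
Qed.

Theorem theorem3p10 (R : realType) (H : completeNormedModType R)
    (ip : {dot H for @idfun R}) (A S : operator H) (tau : R) (mu b : R -> R)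
    (tm beta : nat -> R) (C alpha : R) :
  dot_induces_norm ip ->
  self_adjoint ip A -> positive_operator ip A -> has_compact_inverse A ->
  is_sqrt_operator ip S A ->
  0 < tau ->
  admissible_kernel mu ->
  Linfty_loc b ->
  on_off b tm beta ->
  (forall n, step tm n.*2.+1 <= tau) ->
  (forall n, tau <= step tm n.*2) ->
  decay_constants ip A S mu tau C alpha ->
  let c n := C * expR (- (alpha * step tm n.*2)) in
  let x n := beta n.*2.+1 * step tm n.*2.+1 in
  \sum_(0 <= k < n) ln (expR (x k) * (c k + 1 - expR (- x k)))
    @[n --> \oo] --> -oo ->
  asymptotically_stable ip A S mu tau b.
Proof.
move=> ipE Aadj Apos Acpt Ssqrt tau0 adm _ bonoff odd even decay c x gain_cvg.
move=> u0 v0 u v sol.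
have [e [lam [lam0 Ae e1 eo e_total]]] := eigenbasis ipE Aadj Apos Acpt.
have Se k : opdom S (e k) /\ S (e k) = Num.sqrt (lam k) *: e k.
  have [dom AeE] := Ae k.
  exact: (sqrt_operator_eigenvector ipE Ssqrt (lam0 k) dom AeE).
have [Sadj _ _ _] := Ssqrt.
set gain := fun k => expR (x k) * (c k + 1 - expR (- x k)).
(* Since [c k > 0] and [expR (- x k) <= 1], the logarithms are taken of positive numbers and their
   sums exponentiate to the products of gains. *)
have gain0 k : 0 < gain k.
  have [_ tS beta0 _ _] := bonoff; have [C1 _ _] := decay.
  have x0 : 0 <= x k by rewrite mulr_ge0 ?subr_ge0 // ltW.
  have : expR (- x k) <= 1 by rewrite -expR0 ler_expR oppr_le0.
  have : 0 < c k by rewrite mulr_gt0 ?expR_gt0 // (lt_trans _ C1).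
  by move=> c0 x1; rewrite mulr_gt0 ?expR_gt0 //; lra.
pose a n := \prod_(0 <= k < n) gain k.
have /choice [U UP] : forall k, exists Uk : R -> R,
    [/\ forall t, 0 <= t -> wL2 mu (hist Uk t),
        forall t, 0 <= t -> Uk t = ip (u t) (e k),
        forall t, 0 <= t -> {ae lebesgue_measure, forall s, 0 < s -> 0 < mu s ->
          hist Uk t s = ip (Defs.eta u t s) (e k)} &
        forall n t, tm n.*2 <= t -> t <= tm n.*2.+2 ->
          mode_energy mu (lam k) Uk (fun t => ip (v t) (e k)) t <=
          Order.max (a n) (a n.+1) *
          mode_energy mu (lam k) Uk (fun t => ip (v t) (e k)) 0].
  move=> k; have [Sk SkE] := Se k.
  (* A padding vector [e k = 0] carries the zero mode; it is treated apart because the decay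
     estimate needs a unit vector. *)
  have [ek0|ek0] := eqVneq (e k) 0.
    have hist0 (t : R) : hist (fun=> 0) t = (fun=> 0 : R).
      by apply/funext => s; rewrite /hist subrr.
    exists (fun=> 0); split => [t t0|t t0|t t0|n t _ _].
    - by rewrite hist0; exact: wL2_cst.
    - by rewrite ek0 ip0r.
    - by apply: aeW => s _ _; rewrite hist0 ek0 ip0r.
    rewrite /mode_energy !hist0 ek0 !ip0r !expr0n /= (wI_cst adm).
    by rewrite !mulr0 !addr0 mulr0.
  have ek1 : `|e k| <= 1 by rewrite e1.
  have [Uk [UV Up UE]] := mode_of_solution ipE adm Sadj sol (lam0 k) Sk SkE ek1.
  exists Uk; split => // [t t0|n t nt tn]; first exact: traj_wL2 UV t t0.
  apply: (mode_energy_gain adm Sadj sol (lam0 k) Sk SkE UV Up UE decay bonoff) => //.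
    exact: e1.
  by move=> j; exact: ltW (gain0 j).
have series t : 0 <= t -> \sum_(0 <= k < n)
    mode_energy mu (lam k) (U k) (fun t => ip (v t) (e k)) t @[n --> \oo] -->
    energy S mu u v t.
  by apply: (energy_series ipE adm Sadj sol lam0 Se e1 eo e_total) => k;
    have [] := UP k.
have tm0 : 0 = tm 0%N by have [->] := bonoff.
have bound n t : tm n.*2 <= t -> t <= tm n.*2.+2 ->
    energy S mu u v t <= Order.max (a n) (a n.+1) * energy S mu u v 0.
  move=> nt tn; have t0 : 0 <= t.
    by rewrite tm0 (le_trans _ nt) // (on_off_times_le bonoff).
  apply: ler_cvg_to (series t t0) _ _.
    apply: cvgMl_tmp (series 0 (lexx 0)).
  apply: nearW => N; rewrite mulr_sumr; apply: ler_sum => k _.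
  by have [_ _ _ ->] := UP k.
have energy_ge0 t : 0 <= energy S mu u v t.
  have m1 := kernel_mass_lt1 adm.
  rewrite /energy !addr_ge0 //.
    by rewrite mulr_ge0 ?sqr_ge0 // divr_ge0 // subr_ge0 ltW.
  rewrite mulr_ge0 // fine_ge0 //; apply: integral_ge0 => s.
  rewrite /= in_itv /= andbT => s0.
  by rewrite lee_fin mulr_ge0 ?sqr_ge0 // (kernel_ge0 adm) // ltW.
apply/cvgrPdist_lt => eps eps0.
have [N NP] := prod_lt_of_sum_ln gain0 (energy_ge0 0) eps0 gain_cvg.
near=> t.
have Nt : tm N.*2 <= t by near: t; apply: nbhs_pinfty_ge; exact: num_real.
have [n Nn /andP[nt tn]] := on_off_period bonoff tau0 even Nt.
rewrite sub0r normrN ger0_norm //; apply: le_lt_trans (bound n t nt tn) _.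
by rewrite /Order.max; case: ifP => _; apply: NP => //; exact: leqW.
Unshelve. all: by end_near. Qed.
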